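(* Let $A$ be a commutative local Gorenstein ring with maximal ideal $\mathfrak{m}$ and let $X$ be an indeterminate. If any one of the rings $$A,\quad \widehat{A},\quad A[[X]],\quad A[X]_{(\mathfrak{m},X)}$$ has finite finitistic extension degree, then all of them do.
   Context: Rings are Noetherian; a commutative ring $A$ is Gorenstein if its injective dimension as a module over itself is finite. $\widehat{A}$ is the $\mathfrak{m}$-adic completion of $A$, $A[[X]]$ the formal power series ring, and $A[X]_{(\mathfrak{m},X)}$ the localization of the polynomial ring $A[X]$ at its maximal ideal generated by $\mathfrak{m}$ and $X$. For a commutative Noetherian ring $B$, ''$B$-module'' means finitely generated $B$-module. The self-extension degree of a $B$-module $M$ is $\mathrm{ext.deg}_B(M)=\sup\{i\ge 0\mid \mathrm{Ext}_B^i(M,M)\ne 0\}\in\{0,1,2,\dots\}\cup\{\infty\}$, with the convention that the zero module has self-extension degree $0$. The finitistic extension degree of $B$ is $\mathrm{fed}(B)=\sup\{\mathrm{ext.deg}_B(M)\mid M \text{ a } B\text{-module with } \mathrm{ext.deg}_B(M)<\infty\}$. *)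

(* Defs.v *)
From HB Require Import structures.
From mathcomp Require Import all_boot all_algebra generic_quotient ring_quotient.
From mathcomp Require Import ring.
From mathcomp Require Import boolp classical_sets.

Set Implicit Arguments.
Unset Strict Implicit.
Unset Printing Implicit Defensive.

Import GRing.Theory.
Local Open Scope ring_scope.
Local Open Scope quotient_scope.
Local Open Scope classical_set_scope.

(* Suprema in the extended natural numbers; None stands for infinity, and the
   supremum of the empty set is 0, so that the zero module has ext_deg 0. *)

Definition nat_sup (S : set nat) : option nat :=
  match pselect (exists n, `[< forall k, S k -> (k <= n)%N >]) with
  | left bounded => Some (ex_minn bounded)
  | right _ => None
  end.

Section Modules.
Variable R : comNzRingType.

Definition lin_span (M : lmodType R) (S : set M) : set M :=
  [set x | exists2 s : seq (R * M),
     forall p, p \in s -> S p.2 & x = \sum_(p <- s) p.1 *: p.2].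

Definition finitely_generated (M : lmodType R) : Prop :=
  exists s : seq M, forall x : M, lin_span [set y | y \in s] x.

Definition noetherian : Prop :=
  forall I : {pred R^o}, submod_closed I ->
  exists2 s : seq R^o, {subset s <= I} &
    forall x, x \in I -> lin_span [set y | y \in s] x.

Definition surjection (U V : lmodType R) (f : {linear U -> V}) : Prop :=
  forall v, exists u, f u = v.

Definition exact_at (U V W : lmodType R)
    (f : {linear U -> V}) (g : {linear V -> W}) : Prop :=
  forall v, g v = 0 <-> exists u, f u = v.

Definition projective (P : lmodType R) : Prop :=
  forall (U V : lmodType R) (g : {linear U -> V}) (f : {linear P -> V}),
  surjection g -> exists h : {linear P -> U}, forall x, g (h x) = f x.

Definition injective_module (E : lmodType R) : Prop :=
  forall (U V : lmodType R) (i : {linear U -> V}) (f : {linear U -> E}),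
  injective i -> exists h : {linear V -> E}, forall x, h (i x) = f x.

Record proj_resolution (M : lmodType R) := ProjResolution {
  pr_mod : nat -> lmodType R;
  pr_diff : forall n, {linear pr_mod n.+1 -> pr_mod n};
  pr_aug : {linear pr_mod 0 -> M};
  pr_projective : forall n, projective (pr_mod n);
  pr_aug_surj : surjection pr_aug;
  pr_exact0 : exact_at (pr_diff 0) pr_aug;
  pr_exactS : forall n, exact_at (pr_diff n.+1) (pr_diff n)
}.

Record inj_resolution (M : lmodType R) := InjResolution {
  ir_mod : nat -> lmodType R;
  ir_diff : forall n, {linear ir_mod n -> ir_mod n.+1};
  ir_aug : {linear M -> ir_mod 0};
  ir_injective : forall n, injective_module (ir_mod n);
  ir_aug_inj : injective ir_aug;
  ir_exact0 : exact_at ir_aug (ir_diff 0);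
  ir_exactS : forall n, exact_at (ir_diff n) (ir_diff n.+1)
}.

Definition inj_dim_le (M : lmodType R) (n : nat) : Prop :=
  exists I : inj_resolution M,
    forall k, (n < k)%N -> forall x : ir_mod I k, x = 0.

Definition gorenstein : Prop := exists n, inj_dim_le R^o n.

Definition cocycle (M N : lmodType R) (P : proj_resolution M) (i : nat)
    (f : {linear pr_mod P i -> N}) : Prop :=
  forall x, f (pr_diff P i x) = 0.

Definition coboundary (M N : lmodType R) (P : proj_resolution M) (i : nat) :
    {linear pr_mod P i -> N} -> Prop :=
  match i with
  | 0 => fun f => forall x, f x = 0
  | j.+1 => fun f => exists g : {linear pr_mod P j -> N},
                     forall x, f x = g (pr_diff P j x)
  end.

(* Nonvanishing of Ext^i(M, N), the i-th cohomology of Hom(P, N) for a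
   projective resolution P of M. It does not depend on P, so quantifying P
   existentially is the same as fixing one resolution. *)

Definition ext_nonzero (i : nat) (M N : lmodType R) : Prop :=
  exists (P : proj_resolution M) (f : {linear pr_mod P i -> N}),
    cocycle f /\ ~ coboundary f.

Definition ext_deg (M : lmodType R) : option nat :=
  nat_sup [set i | ext_nonzero i M M].

Definition fed : option nat :=
  nat_sup [set d | exists2 M : lmodType R,
             finitely_generated M & ext_deg M = Some d].

Definition finite_fed : Prop := fed <> None.

End Modules.

Arguments noetherian : clear implicits.
Arguments gorenstein : clear implicits.
Arguments fed : clear implicits.
Arguments finite_fed : clear implicits.

Section Ideals.
Variable R : comNzRingType.

Definition maximal_ideal (I : idealr R) : Prop :=
  forall J : idealr R, {subset I <= J} -> {subset J <= I}.

Definition local_ring_with (m : idealr R) : Prop :=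
  maximal_ideal m /\ forall J : idealr R, maximal_ideal J -> J =i m.

Definition gen_ideal (S : set R) : {pred R} :=
  fun x => `[< lin_span (S : set R^o) x >].

Lemma gen_idealP (S : set R) x : reflect
  (exists2 s : seq (R * R),
     forall p, p \in s -> S p.2 & x = \sum_(p <- s) p.1 * p.2)
  (x \in gen_ideal S).
Proof. exact: asboolP. Qed.

Lemma gen_ideal_sub (S : set R) (I : idealr R) :
  (forall x, S x -> x \in I) -> {subset gen_ideal S <= I}.
Proof.
move=> SI x /gen_idealP[s sS ->]; rewrite big_seq.
by apply: rpred_sum => p ps; apply: idealMr; apply: SI; apply: sS.
Qed.

Lemma gen_ideal_mem (S : set R) x : S x -> x \in gen_ideal S.
Proof.
move=> Sx; apply/gen_idealP; exists [:: (1, x)]; last first.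
  by rewrite big_seq1 mul1r.
by move=> p; rewrite inE => /eqP->.
Qed.

Lemma gen_ideal_closed (S : set R) (I : idealr R) :
  (forall x, S x -> x \in I) -> idealr_closed (gen_ideal S).
Proof.
move=> SI; split=> [||a u v].
- by apply/gen_idealP; exists [::]; rewrite ?big_nil.
- by apply/negP => /(gen_ideal_sub SI); rewrite idealr1.
move=> /gen_idealP[s sS ->] /gen_idealP[t tS ->]; apply/gen_idealP.
exists ([seq (a * p.1, p.2) | p <- s] ++ t).
  by move=> p; rewrite mem_cat => /orP[/mapP[q qs ->]|/tS //]; exact: (sS q qs).
rewrite big_cat big_map mulr_sumr; congr (_ + _).
by apply: eq_bigr => p _; rewrite mulrA.
Qed.

Lemma maximal_prime (m : idealr R) :
  maximal_ideal m -> prime_idealr_closed m.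
Proof.
move=> mmax u v uv; apply/orP; case: (boolP (u \in m)) => um; [by left|right].
pose J : {pred R} := fun x => x * v \in m.
apply: contraNT um => vm.
have JE x : (x \in J) = (x * v \in m) by [].
have Jid : idealr_closed J.
  split; rewrite ?JE ?mul0r ?rpred0 ?mul1r // => a x y.
  by rewrite !JE => xJ yJ; rewrite mulrDl -mulrA rpredD // idealMr.
pose JI : idealr R := HB.pack J (isIdealr.Build R J Jid).
apply: (mmax JI) => [x xm|]; rewrite [_ \in _]JE //.
by rewrite mulrC idealMr.
Qed.

End Ideals.

Section PowerIdeal.
Variables (R : comNzRingType) (m : idealr R) (n : nat).

(* The power m^(n+1). The shift keeps every power proper: m^0 is the unit
   ideal, which idealr excludes and which plays no role in the completion. *)

Definition power_ideal : {pred R} :=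
  gen_ideal [set x | exists2 s : n.+1.-tuple R,
                     {subset s <= m} & x = \prod_(a <- s) a].

Lemma power_ideal_closed : idealr_closed power_ideal.
Proof.
apply: (@gen_ideal_closed _ _ m) => x [t tm ->].
case: t tm => [[|a s] //= sz] sm.
rewrite big_cons mulrC; apply: idealMr; apply: sm.
by rewrite inE eqxx.
Qed.

HB.instance Definition _ := isIdealr.Build R power_ideal power_ideal_closed.

End PowerIdeal.

Lemma power_idealS (R : comNzRingType) (m : idealr R) n :
  {subset power_ideal m n.+1 <= power_ideal m n}.
Proof.
apply: (@gen_ideal_sub _ _ (power_ideal m n)) => x [t tm ->].
case: t tm => [[|a s] //= sz] sm.
rewrite big_cons; apply: idealMr; apply: gen_ideal_mem; exists (Tuple sz) => //.
by move=> y ys; apply: sm; rewrite inE ys orbT.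
Qed.

Section Completion.
Variables (R : comNzRingType) (m : idealr R).

Local Notation residue_ring n := {ideal_quot (power_ideal m n)}.

Definition residue n : R -> residue_ring n :=
  \pi_(residue_ring n).

(* The projection R / m^(n+2) -> R / m^(n+1). *)

Definition transition n (x : residue_ring n.+1) : residue_ring n :=
  residue n (repr x).

Lemma residueD n (x y : R) :
  residue n (x + y) = residue n x + residue n y.
Proof. by rewrite /residue rmorphD. Qed.

Lemma residueM n (x y : R) :
  residue n (x * y) = residue n x * residue n y.
Proof. by rewrite /residue rmorphM. Qed.

Lemma residueN n (x : R) : residue n (- x) = - residue n x.
Proof. by rewrite /residue rmorphN. Qed.

Lemma transition_residue n x : transition (residue n.+1 x) = residue n x.
Proof.
apply/eqP; rewrite /transition /residue -Quotient.idealrBE power_idealS //.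
by rewrite Quotient.idealrBE reprK.
Qed.

Lemma residueP n (x : residue_ring n) : exists a, x = residue n a.
Proof. by exists (repr x); rewrite /residue reprK. Qed.

Lemma transitionD n (x y : residue_ring n.+1) :
  transition (x + y) = transition x + transition y.
Proof.
have [[a ->] [b ->]] := (residueP x, residueP y).
by rewrite -residueD !transition_residue residueD.
Qed.

Lemma transitionM n (x y : residue_ring n.+1) :
  transition (x * y) = transition x * transition y.
Proof.
have [[a ->] [b ->]] := (residueP x, residueP y).
by rewrite -residueM !transition_residue residueM.
Qed.

Lemma transitionN n (x : residue_ring n.+1) : transition (- x) = - transition x.
Proof.
have [a ->] := residueP x.
by rewrite -residueN !transition_residue residueN.
Qed.

Lemma transition0 n : @transition n 0 = 0.
Proof.
have <- : residue n.+1 0 = 0 by rewrite /residue rmorph0.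
by rewrite transition_residue /residue rmorph0.
Qed.

Lemma transition1 n : @transition n 1 = 1.
Proof.
have <- : residue n.+1 1 = 1 by rewrite /residue rmorph1.
by rewrite transition_residue /residue rmorph1.
Qed.

(* The m-adic completion, as the inverse limit of the rings R / m^(n+1). *)

Record completion := Completion {
  comp_val : forall n, residue_ring n;
  comp_coherent : forall n, transition (comp_val n.+1) = comp_val n
}.

Lemma completion_eq (x y : completion) :
  (forall n, comp_val x n = comp_val y n) -> x = y.
Proof.
case: x y => [x hx] [y hy] /= xy.
have {}xy : x = y by apply: functional_extensionality_dep.
by case: _ / xy hy => hy; rewrite (Prop_irrelevance hx hy).
Qed.

HB.instance Definition _ := gen_eqMixin completion.
HB.instance Definition _ := gen_choiceMixin completion.

Definition comp0 := Completion (comp_val := fun=> 0) transition0.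
Definition comp1 := Completion (comp_val := fun=> 1) transition1.

Lemma comp_opp_subproof (x : completion) n :
  transition (- comp_val x n.+1) = - comp_val x n.
Proof. by rewrite transitionN comp_coherent. Qed.
Definition comp_opp x := Completion (comp_opp_subproof x).

Lemma comp_add_subproof (x y : completion) n :
  transition (comp_val x n.+1 + comp_val y n.+1) = comp_val x n + comp_val y n.
Proof. by rewrite transitionD !comp_coherent. Qed.
Definition comp_add x y := Completion (comp_add_subproof x y).

Lemma comp_mul_subproof (x y : completion) n :
  transition (comp_val x n.+1 * comp_val y n.+1) = comp_val x n * comp_val y n.
Proof. by rewrite transitionM !comp_coherent. Qed.
Definition comp_mul x y := Completion (comp_mul_subproof x y).

Lemma comp_addA : associative comp_add.
Proof. by move=> x y z; apply: completion_eq => n; apply: addrA. Qed.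
Lemma comp_addC : commutative comp_add.
Proof. by move=> x y; apply: completion_eq => n; apply: addrC. Qed.
Lemma comp_add0 : left_id comp0 comp_add.
Proof. by move=> x; apply: completion_eq => n; apply: add0r. Qed.
Lemma comp_addN : left_inverse comp0 comp_opp comp_add.
Proof. by move=> x; apply: completion_eq => n; apply: addNr. Qed.

HB.instance Definition _ :=
  GRing.isZmodule.Build completion comp_addA comp_addC comp_add0 comp_addN.

Lemma comp_mulA : associative comp_mul.
Proof. by move=> x y z; apply: completion_eq => n; apply: mulrA. Qed.
Lemma comp_mulC : commutative comp_mul.
Proof. by move=> x y; apply: completion_eq => n; apply: mulrC. Qed.
Lemma comp_mul1 : left_id comp1 comp_mul.
Proof. by move=> x; apply: completion_eq => n; apply: mul1r. Qed.
Lemma comp_mulDl : left_distributive comp_mul +%R.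
Proof. by move=> x y z; apply: completion_eq => n; apply: mulrDl. Qed.
Lemma comp1_neq0 : comp1 != 0.
Proof.
apply/eqP => /(congr1 (comp_val^~ 0%N)) /= /eqP.
by rewrite (negPf (oner_neq0 _)).
Qed.

HB.instance Definition _ := GRing.Zmodule_isComNzRing.Build completion
  comp_mulA comp_mulC comp_mul1 comp_mulDl comp1_neq0.

End Completion.

Section PowerSeries.
Variable R : comNzRingType.

(* A record, not a definition, so that the pointwise ring structure on
   functions cannot be inferred for power series. *)

Record power_series := PowerSeries { ps_coef : nat -> R }.

Lemma power_series_eq (f g : power_series) : ps_coef f =1 ps_coef g -> f = g.
Proof. by case: f g => [f] [g] /= /funext ->. Qed.

HB.instance Definition _ := gen_eqMixin power_series.
HB.instance Definition _ := gen_choiceMixin power_series.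

Definition ps0 := PowerSeries (fun=> 0).
Definition ps1 := PowerSeries (fun n => (n == 0)%:R).
Definition ps_opp f := PowerSeries (fun n => - ps_coef f n).
Definition ps_add f g := PowerSeries (fun n => ps_coef f n + ps_coef g n).
Definition ps_mul f g :=
  PowerSeries (fun n => \sum_(i < n.+1) ps_coef f i * ps_coef g (n - i)%N).

Lemma ps_addA : associative ps_add.
Proof. by move=> f g h; apply: power_series_eq => n; apply: addrA. Qed.
Lemma ps_addC : commutative ps_add.
Proof. by move=> f g; apply: power_series_eq => n; apply: addrC. Qed.
Lemma ps_add0 : left_id ps0 ps_add.
Proof. by move=> f; apply: power_series_eq => n; apply: add0r. Qed.
Lemma ps_addN : left_inverse ps0 ps_opp ps_add.
Proof. by move=> f; apply: power_series_eq => n; apply: addNr. Qed.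

HB.instance Definition _ :=
  GRing.isZmodule.Build power_series ps_addA ps_addC ps_add0 ps_addN.

Definition ps_trunc n f : {poly R} := \poly_(i < n) ps_coef f i.

Lemma ps_mul_coef n k f g : (n < k)%N ->
  ps_coef (ps_mul f g) n = (ps_trunc k f * ps_trunc k g)`_n.
Proof.
move=> nk; rewrite coefM; apply: eq_bigr => i _; rewrite !coef_poly.
have ik : (i < k)%N by apply: leq_trans nk; apply: ltn_ord.
by rewrite ik (leq_ltn_trans (leq_subr _ _) nk).
Qed.

Lemma ps_mulC : commutative ps_mul.
Proof.
move=> f g; apply: power_series_eq => n.
by rewrite !(@ps_mul_coef n n.+1) // mulrC.
Qed.

Lemma ps_mulA : associative ps_mul.
Proof.
move=> f g h; apply: power_series_eq => n.
pose t := ps_trunc n.+1.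
transitivity ((t f * (t g * t h))`_n).
  rewrite (@ps_mul_coef n n.+1) // !coefM; apply: eq_bigr => i _.
  congr (_ * _); rewrite coef_poly ltnS leq_subr.
  by rewrite (@ps_mul_coef _ n.+1) // ltnS leq_subr.
rewrite mulrA (@ps_mul_coef n n.+1) // !coefM; apply: eq_bigr => i _.
congr (_ * _); rewrite coef_poly ltn_ord.
by rewrite (@ps_mul_coef _ n.+1).
Qed.

Lemma ps_mul1 : left_id ps1 ps_mul.
Proof.
move=> f; apply: power_series_eq => n /=.
rewrite big_ord_recl /= mul1r subn0 big1 ?addr0 // => i _.
by rewrite mul0r.
Qed.

Lemma ps_mulDl : left_distributive ps_mul +%R.
Proof.
move=> f g h; apply: power_series_eq => n /=.
by rewrite -big_split; apply: eq_bigr => i _; rewrite mulrDl.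
Qed.

Lemma ps1_neq0 : ps1 != 0.
Proof.
apply/eqP => /(congr1 (ps_coef^~ 0%N)) /= /eqP.
by rewrite (negPf (oner_neq0 _)).
Qed.

HB.instance Definition _ := GRing.Zmodule_isComNzRing.Build power_series
  ps_mulA ps_mulC ps_mul1 ps_mulDl ps1_neq0.

End PowerSeries.

Section Localization.
Variables (R : comNzRingType) (P : prime_idealr R).

Record fracpair := FracPair {
  frac_num : R;
  frac_den : R;
  frac_denP : frac_den \notin P
}.

HB.instance Definition _ := gen_eqMixin fracpair.
HB.instance Definition _ := gen_choiceMixin fracpair.

Lemma prime_compl1 : 1 \notin P.
Proof. by rewrite idealr1. Qed.

Lemma prime_complM s t : s \notin P -> t \notin P -> s * t \notin P.
Proof. by move=> sP tP; rewrite prime_idealrM negb_or sP. Qed.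

Definition frac_equiv (x y : fracpair) : bool :=
  `[< exists2 u, u \notin P &
        u * (frac_num x * frac_den y - frac_num y * frac_den x) = 0 >].

Lemma frac_equiv_class : equiv_class_of frac_equiv.
Proof.
split=> [x|x y|y x z].
- by apply/asboolP; exists 1; rewrite ?prime_compl1 // subrr mulr0.
- by apply/asboolP/asboolP=> -[u uP e]; exists u => //;
    rewrite -opprB mulrN e oppr0.
move=> /asboolP[u uP /eqP e] /asboolP[v vP /eqP f]; apply/asboolP.
exists (u * v * frac_den y); first by rewrite !prime_complM // frac_denP.
move: e f; rewrite !mulrBr !subr_eq0 => /eqP e /eqP f.
apply/eqP; rewrite subr_eq0; apply/eqP.
transitivity (v * frac_den z * (u * (frac_num x * frac_den y))).
  ring.
rewrite e; transitivity (u * frac_den x * (v * (frac_num y * frac_den z))).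
  ring.
by rewrite f; ring.
Qed.

Canonical frac_equiv_canonical := EquivRelPack frac_equiv_class.

Definition localization := {eq_quot frac_equiv}.

HB.instance Definition _ := Choice.on localization.

Definition loc_frac : fracpair -> localization := \pi_{eq_quot frac_equiv}.

Lemma loc_fracP (x : localization) : exists p, x = loc_frac p.
Proof. by exists (repr x); rewrite /loc_frac reprK. Qed.

Lemma loc_frac_eq p q : reflect
  (exists2 u, u \notin P &
     u * (frac_num p * frac_den q - frac_num q * frac_den p) = 0)
  (loc_frac p == loc_frac q).
Proof. by rewrite /loc_frac eqmodE; apply: asboolP. Qed.

Definition frac_of (a : R) := FracPair a prime_compl1.
Definition frac_opp p := FracPair (- frac_num p) (frac_denP p).
Definition frac_add p q :=
  FracPair (frac_num p * frac_den q + frac_num q * frac_den p)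
           (prime_complM (frac_denP p) (frac_denP q)).
Definition frac_mul p q :=
  FracPair (frac_num p * frac_num q)
           (prime_complM (frac_denP p) (frac_denP q)).

Definition loc0 : localization := loc_frac (frac_of 0).
Definition loc1 : localization := loc_frac (frac_of 1).
Definition loc_opp (x : localization) : localization :=
  loc_frac (frac_opp (repr x)).
Definition loc_add (x y : localization) : localization :=
  loc_frac (frac_add (repr x) (repr y)).
Definition loc_mul (x y : localization) : localization :=
  loc_frac (frac_mul (repr x) (repr y)).

Lemma loc_repr p : exists2 u, u \notin P &
  u * (frac_num (repr (loc_frac p)) * frac_den p)
  = u * (frac_num p * frac_den (repr (loc_frac p))).
Proof.
have /loc_frac_eq[u uP e] : loc_frac (repr (loc_frac p)) == loc_frac p.
  by rewrite {1}/loc_frac reprK.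
by exists u => //; apply/eqP; rewrite -subr_eq0 -mulrBr e.
Qed.

Lemma loc_oppE p : loc_opp (loc_frac p) = loc_frac (frac_opp p).
Proof.
apply/eqP/loc_frac_eq; have [u uP e] := loc_repr p; exists u => //=.
by rewrite !mulNr -opprD mulrN mulrBr e subrr oppr0.
Qed.

Lemma loc_addE p q :
  loc_add (loc_frac p) (loc_frac q) = loc_frac (frac_add p q).
Proof.
apply/eqP/loc_frac_eq.
have [u uP e] := loc_repr p; have [v vP f] := loc_repr q.
exists (u * v); first exact: prime_complM.
move: (repr (loc_frac p)) (repr (loc_frac q)) e f => p' q' e f /=.
transitivity
  (v * frac_den q' * frac_den q * (u * (frac_num p' * frac_den p)
     - u * (frac_num p * frac_den p'))
   + u * frac_den p' * frac_den p * (v * (frac_num q' * frac_den q)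
     - v * (frac_num q * frac_den q'))); first ring.
by rewrite e f !subrr !mulr0 addr0.
Qed.

Lemma loc_mulE p q :
  loc_mul (loc_frac p) (loc_frac q) = loc_frac (frac_mul p q).
Proof.
apply/eqP/loc_frac_eq.
have [u uP e] := loc_repr p; have [v vP f] := loc_repr q.
exists (u * v); first exact: prime_complM.
move: (repr (loc_frac p)) (repr (loc_frac q)) e f => p' q' e f /=.
transitivity
  ((u * (frac_num p' * frac_den p)) * (v * (frac_num q' * frac_den q))
   - (u * (frac_num p * frac_den p')) * (v * (frac_num q * frac_den q'))).
  ring.
by rewrite e f subrr.
Qed.

Lemma loc_eq p q :
  frac_num p * frac_den q = frac_num q * frac_den p -> loc_frac p = loc_frac q.
Proof.
move=> e; apply/eqP/loc_frac_eq; exists 1; first exact: prime_compl1.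
by rewrite e subrr mulr0.
Qed.

Lemma loc_addA : associative loc_add.
Proof.
move=> x y z; have [p ->] := loc_fracP x; have [q ->] := loc_fracP y.
have [r ->] := loc_fracP z.
by rewrite !loc_addE; apply: loc_eq => /=; ring.
Qed.
Lemma loc_addC : commutative loc_add.
Proof.
move=> x y; have [p ->] := loc_fracP x; have [q ->] := loc_fracP y.
by rewrite !loc_addE; apply: loc_eq => /=; ring.
Qed.
Lemma loc_add0 : left_id loc0 loc_add.
Proof.
move=> x; have [p ->] := loc_fracP x.
by rewrite loc_addE; apply: loc_eq => /=; ring.
Qed.
Lemma loc_addN : left_inverse loc0 loc_opp loc_add.
Proof.
move=> x; have [p ->] := loc_fracP x.
by rewrite loc_oppE loc_addE; apply: loc_eq => /=; ring.
Qed.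

HB.instance Definition _ :=
  GRing.isZmodule.Build localization loc_addA loc_addC loc_add0 loc_addN.

Lemma loc_mulA : associative loc_mul.
Proof.
move=> x y z; have [p ->] := loc_fracP x; have [q ->] := loc_fracP y.
have [r ->] := loc_fracP z.
by rewrite !loc_mulE; apply: loc_eq => /=; ring.
Qed.
Lemma loc_mulC : commutative loc_mul.
Proof.
move=> x y; have [p ->] := loc_fracP x; have [q ->] := loc_fracP y.
by rewrite !loc_mulE; apply: loc_eq => /=; ring.
Qed.
Lemma loc_mul1 : left_id loc1 loc_mul.
Proof.
move=> x; have [p ->] := loc_fracP x.
by rewrite loc_mulE; apply: loc_eq => /=; ring.
Qed.
Lemma loc_mulDl : left_distributive loc_mul loc_add.
Proof.
move=> x y z; have [p ->] := loc_fracP x; have [q ->] := loc_fracP y.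
have [r ->] := loc_fracP z.
by rewrite !(loc_mulE, loc_addE); apply: loc_eq => /=; ring.
Qed.
Lemma loc1_neq0 : loc1 != loc0.
Proof.
apply/negP => /loc_frac_eq[u uP] /=; rewrite !mulr1 subr0 mulr1 => u0.
by rewrite u0 rpred0 in uP.
Qed.

HB.instance Definition _ := GRing.Zmodule_isComNzRing.Build localization
  loc_mulA loc_mulC loc_mul1 loc_mulDl loc1_neq0.

End Localization.

Section PolynomialIdeal.
Variables (R : comNzRingType) (m : idealr R).

Definition mX_ideal : {pred {poly R}} :=
  gen_ideal [set p | (exists2 a, a \in m & p = a%:P) \/ p = 'X].

Lemma mX_ideal_coef0 p : (p \in mX_ideal) = (p`_0 \in m).
Proof.
apply/idP/idP => [/gen_idealP[s sS ->]|p0].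
  rewrite coef_sum big_seq; apply: rpred_sum => q /sS[[a am ->]|->].
    by rewrite coefMC; apply: idealMr.
  by rewrite coefMX rpred0.
apply/gen_idealP; exists [:: (1, (p`_0)%:P); (drop_poly 1 p, 'X)].
  by move=> q; rewrite !inE => /orP[]/eqP->; [left; exists p`_0|right].
rewrite big_cons big_seq1 /= mul1r -{1}[p](poly_take_drop 1) expr1.
congr (_ + _); apply/polyP => i; rewrite coef_take_poly coefC.
by case: i.
Qed.

Lemma mX_ideal_closed : idealr_closed mX_ideal.
Proof.
split; rewrite ?mX_ideal_coef0 ?coef0 ?rpred0 ?coef1 ?idealr1 // => p q r.
by rewrite !mX_ideal_coef0 coefD coef0M => qm rm; rewrite rpredD ?idealMr.
Qed.

HB.instance Definition _ := isIdealr.Build {poly R} mX_ideal mX_ideal_closed.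

Hypothesis m_maximal : maximal_ideal m.

Lemma mX_ideal_prime : prime_idealr_closed mX_ideal.
Proof.
move=> p q; rewrite !mX_ideal_coef0 coef0M.
exact: maximal_prime m_maximal _ _.
Qed.

Definition mX_prime_ideal : prime_idealr {poly R} :=
  HB.pack mX_ideal (isPrimeIdealrClosed.Build {poly R} mX_ideal mX_ideal_prime).

End PolynomialIdeal.

(* Main.v *)
Require Import Defs.
From HB Require Import structures.
From mathcomp Require Import all_boot all_algebra generic_quotient ring_quotient.
From mathcomp Require Import ring zify.
From mathcomp Require Import boolp classical_sets.

(** Call Ext-finite a finitely generated module M with Ext^i(M, M) = 0 for large
    i. Over a Gorenstein ring, if M is Ext-finite then so is the sum of M and
    its j-th syzygy Omega^j M; since Ext^j(M, Omega^j M) = 0 forces Omega^j M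
    to be a direct summand of a free module, fed is finite exactly when all
    Ext-finite modules have projective dimension at most some fixed D.

    Finiteness of fed descends along faithfully flat extensions, which gives
    the passage to [A] from each of the three other rings [B]. Conversely, for
    [B] the power series ring or the localized polynomial ring, the reduction
    modulo X of a syzygy of an Ext-finite [B]-module is an Ext-finite
    [A]-module, and projectivity lifts back by Nakayama. For the completion one
    reduces instead modulo a regular sequence s of [A] generating an ideal
    which contains a power of [m]: the quotient of a syzygy by s is the base
    change of an [A]-module. Such a sequence exists because [A] has finite
    injective dimension: for a maximal regular sequence s, Bass' argument shows
    Ext^i(A / J, A) = 0 for all ideals J and i > length s, and for y in [m] and
    z a large power of y this makes multiplication by z on Ext^r(A / (s), A) =
    A / (s), r the length of s, factor through Ext^r(A / (s : z), A) = 0.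

    Finitely generated modules are handled as cokernels of matrices acting on
    row vectors, and Ext through free resolutions by matrices. *)

Set Implicit Arguments.
Unset Strict Implicit.
Unset Printing Implicit Defensive.

Import GRing.Theory.
Local Open Scope ring_scope.
Local Open Scope quotient_scope.

(** * Free resolutions by matrices *)

(** No Ext group is ever formed: [extv] only says that cocycles are coboundaries, and an exact
    sequence of Ext groups enters as an implication between vanishing statements. The one group that
    has to be known, Ext^r(A / (s), A), is recorded in [koszul_data] by a generator and its
    annihilator.

    The detour through projective dimension pays off because a splitting syzygy makes Ext vanish on
    every target. A bound for self-extensions ties both arguments to one module, whereas the changes
    of ring act differently on the two; [splits] can be carried up and tested against any matrix.

    The completion is harder than the other two rings because in general it has no homomorphism back
    to A along which modules could be reduced. Modules killed by a power of m are the same over both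
    rings, but a regular sequence brings syzygies there only if its ideal contains a power of m,
    that is, if A is Cohen-Macaulay. This is obtained without dimension theory.

    The degree from which Ext vanishes for a given module may grow at each passage; only D has to be
    independent of the module. *)

Section RowSpan.
Variable R : comNzRingType.

(* [rspan U T] reads [U = 0] modulo [T]: maps into the cokernel of [T] are
   represented by matrices up to this relation. *)
Definition rspan m p q (U : 'M[R]_(m, q)) (T : 'M[R]_(p, q)) : Prop :=
  exists W : 'M[R]_(m, p), U = W *m T.

(** Total, with value 0 where no quotient exists, so that [chain_map] can be defined before it is
    known to be a chain map. *)
Definition mdiv m p q (U : 'M[R]_(m, q)) (T : 'M[R]_(p, q)) : 'M[R]_(m, p) :=
  xget 0 (fun W => U = W *m T).

Lemma mdivK m p q (U : 'M[R]_(m, q)) (T : 'M[R]_(p, q)) :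
  rspan U T -> mdiv U T *m T = U.
Proof. by rewrite /mdiv => UT; have <- := xgetPex 0 UT. Qed.

Section Fixed.
Variables (p q : nat) (T : 'M[R]_(p, q)).

Lemma rspan0 m : rspan (0 : 'M_(m, q)) T.
Proof. by exists 0; rewrite mul0mx. Qed.

Lemma rspanD m (U V : 'M_(m, q)) : rspan U T -> rspan V T -> rspan (U + V) T.
Proof. by move=> [W ->] [W' ->]; exists (W + W'); rewrite mulmxDl. Qed.

Lemma rspanN m (U : 'M_(m, q)) : rspan U T -> rspan (- U) T.
Proof. by move=> [W ->]; exists (- W); rewrite mulNmx. Qed.

Lemma rspanB m (U V : 'M_(m, q)) : rspan U T -> rspan V T -> rspan (U - V) T.
Proof. by move=> UT VT; apply: rspanD => //; apply: rspanN. Qed.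

Lemma rspanBC m (U V : 'M_(m, q)) : rspan (U - V) T -> rspan (V - U) T.
Proof. by move=> /rspanN; rewrite opprB. Qed.

Lemma rspan_sum m (I : Type) (r : seq I) (P : pred I) (U : I -> 'M_(m, q)) :
  (forall i, P i -> rspan (U i) T) -> rspan (\sum_(i <- r | P i) U i) T.
Proof.
move=> h; apply: (big_ind (fun V => rspan V T)) => //; first exact: rspan0.
by move=> *; apply: rspanD.
Qed.

Lemma rspan_trans_sub m (U V W : 'M_(m, q)) :
  rspan (U - V) T -> rspan (V - W) T -> rspan (U - W) T.
Proof. by move=> h1 h2; rewrite -(subrK V U) -addrA; apply: rspanD. Qed.

Lemma rspanM m k (A : 'M_(k, m)) (U : 'M_(m, q)) :
  rspan U T -> rspan (A *m U) T.
Proof. by move=> [W ->]; exists (A *m W); rewrite mulmxA. Qed.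

Lemma rspanZ m a (U : 'M_(m, q)) : rspan U T -> rspan (a *: U) T.
Proof. by move=> UT; rewrite -mul_scalar_mx; apply: rspanM. Qed.

Lemma rspan_refl : rspan T T.
Proof. by exists 1%:M; rewrite mul1mx. Qed.

Lemma rspan_rows m (U : 'M_(m, q)) :
  (forall i, rspan (row i U) T) -> rspan U T.
Proof.
move=> h; exists (\matrix_i mdiv (row i U) T).
by apply/row_matrixP => i; rewrite row_mul rowK mdivK.
Qed.

Lemma rspan_row m (U : 'M_(m, q)) i : rspan U T -> rspan (row i U) T.
Proof. by move=> [W ->]; exists (row i W); rewrite row_mul. Qed.

Lemma rspan_col_mx m1 m2 (U : 'M_(m1, q)) (V : 'M_(m2, q)) :
  rspan (col_mx U V) T <-> rspan U T /\ rspan V T.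
Proof.
split=> [[W /(congr1 (fun A => (usubmx A, dsubmx A)))]|[[W ->] [W' ->]]].
  rewrite -{1 2}(vsubmxK W) mul_col_mx !col_mxKu !col_mxKd => -[-> ->].
  by split; [exists (usubmx W)|exists (dsubmx W)].
by exists (col_mx W W'); rewrite mul_col_mx.
Qed.

Lemma rspan_mulr m r (U : 'M_(m, q)) (A : 'M_(q, r)) :
  rspan U T -> rspan (U *m A) (T *m A).
Proof. by move=> [W ->]; exists W; rewrite mulmxA. Qed.

End Fixed.

Lemma rspan_trans m p q r (U : 'M_(m, q)) (T : 'M_(p, q)) (S : 'M_(r, q)) :
  rspan U T -> rspan T S -> rspan U S.
Proof. by move=> [W ->]; apply: rspanM. Qed.

Lemma rspan_zero m p q (U : 'M_(m, q)) : rspan U (0 : 'M_(p, q)) <-> U = 0.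
Proof. by split=> [[W ->]|->]; [rewrite mulmx0|apply: rspan0]. Qed.

Lemma rspan_col_mx_r m p r q (U : 'M_(m, q)) (T : 'M_(p, q)) (S : 'M_(r, q)) :
  rspan U (col_mx T S) <-> exists W, rspan (U - W *m S) T.
Proof.
split=> [[W ->]|[W [W' e]]].
  exists (rsubmx W); exists (lsubmx W).
  by rewrite -{1}(hsubmxK W) mul_row_col addrK.
exists (row_mx W' W); rewrite mul_row_col.
by rewrite -e subrK.
Qed.

End RowSpan.

Section Resolutions.
Variable R : comNzRingType.

(* A free resolution of the cokernel of [d 0], vectors being rows. *)
Record resolution := Resolution {
  rk : nat -> nat;
  d : forall i, 'M[R]_(rk i.+1, rk i);
  d_exact : forall i p (U : 'M_(p, rk i.+1)), U *m d i = 0 -> rspan U (d i.+1);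
  d_d : forall i, d i.+1 *m d i = 0
}.

Definition cobound (F : resolution) i p q (T : 'M[R]_(p, q)) :
    'M[R]_(rk F i, q) -> Prop :=
  match i with
  | 0 => fun Z => rspan Z T
  | j.+1 => fun Z => exists Y : 'M[R]_(rk F j, q), rspan (Z - d F j *m Y) T
  end.

(* The vanishing of Ext^i(coker (d F 0), coker T). *)
Definition extv (F : resolution) i p q (T : 'M[R]_(p, q)) : Prop :=
  forall Z : 'M[R]_(rk F i, q), rspan (d F i *m Z) T -> cobound T Z.

Section Cobound.
Variables (F : resolution) (p q : nat) (T : 'M[R]_(p, q)).

Lemma cobound_rspan i (Z : 'M_(rk F i, q)) : rspan Z T -> cobound T Z.
Proof.
by case: i Z => [//|i] Z ZT /=; exists 0; rewrite mulmx0 subr0.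
Qed.

Lemma coboundD i (Z Z' : 'M_(rk F i, q)) :
  cobound T Z -> cobound T Z' -> cobound T (Z + Z').
Proof.
case: i Z Z' => [|i] Z Z' /=; first exact: rspanD.
move=> [Y h] [Y' h']; exists (Y + Y').
by rewrite mulmxDr opprD addrACA; apply: rspanD.
Qed.

Lemma coboundM i a (Z : 'M_(rk F i, q)) : cobound T Z -> cobound T (a *: Z).
Proof.
case: i Z => [|i] Z /=; first exact: rspanZ.
move=> [Y h]; exists (a *: Y).
by rewrite -scalemxAr -scalerBr; apply: rspanZ.
Qed.

Lemma cobound_sub i (Z Z' : 'M_(rk F i, q)) :
  cobound T (Z - Z') -> cobound T Z' -> cobound T Z.
Proof. by move=> h h'; rewrite -(subrK Z' Z); apply: coboundD. Qed.

End Cobound.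

Lemma extv_rank0 F i p q (T : 'M[R]_(p, q)) : rk F i = 0%N -> extv F i T.
Proof.
move=> r0 Z _; apply: cobound_rspan; move: Z; rewrite r0 => Z.
by rewrite flatmx0; apply: rspan0.
Qed.

Section ChainMap.
Variables (G F : resolution) (a0 : 'M[R]_(rk G 0, rk F 0)).

Fixpoint chain_map i : 'M[R]_(rk G i, rk F i) :=
  if i is j.+1 then mdiv (d G j *m chain_map j) (d F j) else a0.

Hypothesis a0P : rspan (d G 0 *m a0) (d F 0).

Lemma chain_mapP i : rspan (d G i *m chain_map i) (d F i).
Proof.
elim: i => [//|i IH] /=; apply: d_exact.
by rewrite -mulmxA mdivK // mulmxA d_d mul0mx.
Qed.

Lemma chain_mapE i : chain_map i.+1 *m d F i = d G i *m chain_map i.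
Proof. by rewrite mdivK //; apply: chain_mapP. Qed.

End ChainMap.

Section Comparison.
Variables (F G : resolution).
Variables (g : 'M[R]_(rk F 0, rk G 0)) (h : 'M[R]_(rk G 0, rk F 0)) (z : R).
Hypotheses (gP : rspan (d F 0 *m g) (d G 0)) (hP : rspan (d G 0 *m h) (d F 0)).
Hypothesis ghz : rspan (g *m h - z%:M) (d F 0).

Local Notation a := (chain_map g).
Local Notation b := (chain_map h).

(** In degree i a homotopy reads a b - z = k d(i) + d(i-1) k'. Multiplication by [d F i] on the left
    kills the last term, so that degree 0 has the same form and the induction carries a single
    [k]. *)
Lemma comparison_homotopy i : exists k : 'M[R]_(rk F i, rk F i.+1),
  d F i *m (a i *m b i - z%:M) = d F i *m k *m d F i.
Proof.
elim: i => [|i [k ek]]; first by have [k ->] := ghz; exists k; rewrite mulmxA.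
have [|k' ek'] := @d_exact F i _ (a i.+1 *m b i.+1 - z%:M - d F i *m k).
  rewrite !mulmxBl -ek -mulmxA !chain_mapE // !mulmxA !chain_mapE //.
  by rewrite mulmxBr !mulmxA mul_scalar_mx mul_mx_scalar subrr.
exists k'; rewrite -mulmxA -ek' [in RHS]mulmxBr.
by rewrite (mulmxA (d F i.+1) (d F i)) d_d mul0mx subr0.
Qed.

(* If multiplication by [z] on coker (d F 0) factors through coker (d G 0)
   then [z] kills Ext^i(coker (d F 0), -) as soon as the latter vanishes on
   coker (d G 0). *)
Lemma comparison i p q (T : 'M[R]_(p, q)) (Z : 'M[R]_(rk F i, q)) :
  extv G i T -> rspan (d F i *m Z) T -> cobound T (z *: Z).
Proof.
move=> vG Zc; have bZc : rspan (d G i *m (b i *m Z)) T.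
  by rewrite mulmxA -chain_mapE // -mulmxA; apply: rspanM.
have {vG bZc} := vG _ bZc; case: i Z Zc => [|i] Z Zc /= => [bZ|[Y bZ]].
  rewrite -mul_scalar_mx -(subrK (g *m h) z%:M) mulmxDl.
  apply: rspanD; last by rewrite -mulmxA; apply: rspanM.
  have [k /(congr1 -%R)] := ghz; rewrite opprB => ->.
  by rewrite mulNmx -mulmxA; apply/rspanN/rspanM.
have [k ek] := comparison_homotopy i.
have [|k' ek'] := @d_exact F i _ (a i.+1 *m b i.+1 - z%:M - d F i *m k).
  rewrite !mulmxBl -ek -mulmxA !chain_mapE // !mulmxA !chain_mapE //.
  by rewrite mulmxBr !mulmxA mul_scalar_mx mul_mx_scalar subrr.
exists (a i *m Y - k *m Z).
(* [k] and [k'] are consecutive terms of a homotopy between [z] and [a b]; the term with [k']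
   vanishes modulo T because Z is a cocycle. *)
have -> : z *: Z = a i.+1 *m (b i.+1 *m Z) - d F i *m (k *m Z)
                   - k' *m (d F i.+1 *m Z).
  rewrite !mulmxA -ek' -!mulmxBl -mul_scalar_mx; congr (_ *m _).
  by rewrite [in RHS](addrAC _ (- z%:M)) subKr.
apply: (@rspan_trans_sub _ _ _ _ _ _
          (a i.+1 *m (b i.+1 *m Z) - d F i *m (k *m Z))).
  by rewrite addrAC subrr sub0r; apply/rspanN/rspanM.
rewrite mulmxBr opprB addrA subrK (mulmxA (d F i)) -(chain_mapE gP) -mulmxA.
rewrite -mulmxBr.
exact: rspanM.
Qed.

End Comparison.

(** The case z = 1 of [comparison]. One composite being the identity is enough: the module of F is
    then a direct summand of that of G. *)
Lemma extv_iso (F G : resolution) (g : 'M[R]_(rk F 0, rk G 0)) h i p q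
    (T : 'M[R]_(p, q)) :
  rspan (d F 0 *m g) (d G 0) -> rspan (d G 0 *m h) (d F 0) ->
  rspan (g *m h - 1%:M) (d F 0) -> extv G i T -> extv F i T.
Proof.
by move=> gP hP gh vG Z Zc; rewrite -[Z]scale1r; apply: (comparison gP hP gh).
Qed.

End Resolutions.

(** * Mapping cones and long exact sequences *)

Section Cone.
Variables (R : comNzRingType) (F G : resolution R).
Variable a : forall i, 'M[R]_(rk G i, rk F i).
Hypothesis chainE : forall i, a i.+1 *m d F i = d G i *m a i.
Hypothesis a_inj : forall p (U : 'M_(p, rk G 0)),
  rspan (U *m a 0) (d F 0) -> rspan U (d G 0).

Definition cone_rk i := if i is j.+1 then (rk F j.+1 + rk G j)%N else rk F 0.

Definition cone_d i : 'M[R]_(cone_rk i.+1, cone_rk i) :=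
  match i with
  | 0 => col_mx (d F 0) (a 0)
  | j.+1 => block_mx (d F j.+1) 0 (a j.+1) (- d G j)
  end.

Lemma cone_dd i : cone_d i.+1 *m cone_d i = 0.
Proof.
case: i => [|i] /=.
  rewrite mul_block_col mul0mx addr0 d_d mulNmx (chainE 0).
  by rewrite subrr col_mx0.
rewrite mulmx_block !mul0mx !mulmx0 !addr0 !add0r d_d mulmxN !mulNmx opprK d_d.
by rewrite (chainE i.+1) subrr block_mx0.
Qed.

Lemma cone_exact i p (U : 'M_(p, cone_rk i.+1)) :
  U *m cone_d i = 0 -> rspan U (cone_d i.+1).
Proof.
case: i U => [|i] /= U; rewrite -[U]hsubmxK; set u := lsubmx U;
  set v := rsubmx U.
  rewrite mul_row_col => /eqP; rewrite addr_eq0 => /eqP e.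
  have [w ew] : rspan v (d G 0).
    by apply: a_inj; rewrite -[_ *m _]opprK -e -mulNmx; apply/rspanM/rspan_refl.
  have [|t et] := @d_exact _ F 0 _ (u + w *m a 1).
    by rewrite mulmxDl -mulmxA (chainE 0) mulmxA -ew e addNr.
  exists (row_mx t (- w)).
  rewrite mul_row_block mulmx0 add0r mulmxN !mulNmx opprK -ew -et.
  by rewrite addrK.
rewrite mul_row_block mulmx0 add0r mulmxN -[0]row_mx0 => /eq_row_mx[e].
move=> /eqP; rewrite oppr_eq0 => /eqP /d_exact[w ew].
have [|t et] := @d_exact _ F i.+1 _ (u + w *m a i.+2).
  by rewrite mulmxDl -mulmxA (chainE i.+1) mulmxA -ew e.
exists (row_mx t (- w)).
rewrite mul_row_block mulmx0 add0r mulmxN !mulNmx opprK -ew -et.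
by rewrite addrK.
Qed.

(* For coker (d G 0) -> coker (d F 0) injective, a resolution of the
   quotient. *)
Definition cone : resolution R := Resolution cone_exact cone_dd.

Section Ext.
Variables (p q : nat) (T : 'M[R]_(p, q)).

Lemma cone_cobound i (U : 'M_(rk F i.+1, q)) (Z : 'M_(rk G i, q)) :
  cobound (F := cone) (i := i.+1) T (col_mx U Z) <->
  exists Y : 'M_(rk F i, q),
    rspan (U - d F i *m Y) T /\ cobound T (Z - a i *m Y).
Proof.
case: i U Z => [|i] U Z /=.
  split=> -[Y].
    by rewrite mul_col_mx opp_col_mx add_col_mx => /rspan_col_mx[? ?]; exists Y.
  move=> [? ?]; exists Y; rewrite mul_col_mx opp_col_mx add_col_mx.
  exact/rspan_col_mx.
split=> [[Y]|[Y [h1 [Y' h2]]]].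
  rewrite -[Y]vsubmxK; set y := usubmx Y; set y' := dsubmx Y.
  rewrite mul_block_col mul0mx addr0 opp_col_mx add_col_mx.
  move=> /rspan_col_mx[h1 h2]; exists y; split=> //; exists (- y').
  by rewrite mulmxN -mulNmx -addrA -opprD.
exists (col_mx Y (- Y')); rewrite mul_block_col mul0mx addr0 opp_col_mx.
rewrite add_col_mx; apply/rspan_col_mx; split=> //.
by rewrite mulNmx mulmxN opprK opprD addrA.
Qed.

Lemma cone_cocycle i (U : 'M_(rk F i.+1, q)) (Z : 'M_(rk G i, q)) :
  rspan (d cone i.+1 *m col_mx U Z) T <->
  rspan (d F i.+1 *m U) T /\ rspan (a i.+1 *m U - d G i *m Z) T.
Proof.
by rewrite mul_block_col mul0mx addr0 mulNmx; apply: rspan_col_mx.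
Qed.

(** Let G, F and the cone resolve N, M and M / N. This lemma and the next two are exactness at the
    inner terms of Ext^i(M) -> Ext^i(N) -> Ext^(i+1)(M / N) -> Ext^(i+1)(M) -> Ext^(i+1)(N). *)
Lemma extv_cone_sub i : extv F i T -> extv cone i.+1 T -> extv G i T.
Proof.
move=> vF vH Z Zc; have /vH : rspan (d cone i.+1 *m col_mx 0 Z) T.
  apply/cone_cocycle; rewrite !mulmx0 sub0r.
  by split; [apply: rspan0|apply: rspanN].
move=> /cone_cobound[Y []]; rewrite sub0r => /rspanN; rewrite opprK => /vF Yb.
move=> h; apply: (cobound_sub h); case: i {Z Zc vF vH h} Y Yb => [|i] Y /=.
  exact: rspanM.
move=> [Y' h]; exists (a i *m Y').
rewrite (mulmxA (d G i)) -(chainE i) -mulmxA -mulmxBr.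
exact: rspanM.
Qed.

Lemma extv_cone i : extv G i T -> extv F i.+1 T -> extv cone i.+1 T.
Proof.
move=> vG vF Z; rewrite -[Z]vsubmxK => /cone_cocycle[Uc Zc].
have [Y UY] := vF _ Uc; apply/cone_cobound; exists Y; split=> //.
apply: vG; rewrite mulmxBr mulmxA -chainE -mulmxA; apply: rspanBC.
apply: (rspan_trans_sub _ Zc).
by rewrite -mulmxBr; apply/rspanM/rspanBC.
Qed.

Lemma extv_cone_mid i : extv G i.+1 T -> extv cone i.+1 T -> extv F i.+1 T.
Proof.
move=> vG vH U Uc; have [|Z UZ] := vG (a i.+1 *m U).
  by rewrite mulmxA -chainE -mulmxA; apply: rspanM.
have /vH : rspan (d cone i.+1 *m col_mx U Z) T by apply/cone_cocycle.
by move=> /cone_cobound[Y [h _]]; exists Y.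
Qed.

End Ext.
End Cone.

(** * Noetherian rings and Nakayama's lemma *)

Section Noetherian.
Variable R : comNzRingType.

(** Stated for submodules of all free modules, the form that yields matrices of generators for
    kernels; [noeth_of_ideals] reduces it to ideals. *)
Definition noeth : Prop := forall n (S : 'rV[R]_n -> Prop), S 0 ->
  (forall a u v, S u -> S v -> S (a *: u + v)) ->
  exists p (G : 'M[R]_(p, n)), forall u, S u <-> rspan u G.

(** One generator is peeled off at a time, the recursion that also governs [regular_seq] and the
    Koszul cones. *)
Fixpoint idl (s : seq R) (y : R) : Prop :=
  if s is x :: s' then exists a, idl s' (y - a * x) else y = 0.

Definition ideal (I : R -> Prop) : Prop :=
  I 0 /\ forall a x y, I x -> I y -> I (a * x + y).

Lemma idealD I x y : ideal I -> I x -> I y -> I (x + y).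
Proof. by move=> [_ h] Ix Iy; rewrite -[x]mul1r; apply: h. Qed.

Lemma idealM I a x : ideal I -> I x -> I (a * x).
Proof. by move=> [I0 h] Ix; rewrite -[_ * _]addr0; apply: h. Qed.

Lemma idealB I x y : ideal I -> I x -> I y -> I (x - y).
Proof.
by move=> Ii Ix Iy; apply: idealD => //; rewrite -mulN1r; apply: idealM.
Qed.

Lemma ideal_sum I (J : Type) (r : seq J) (P : pred J) (f : J -> R) :
  ideal I -> (forall j, P j -> I (f j)) -> I (\sum_(j <- r | P j) f j).
Proof.
move=> Ii h; apply: (big_ind I) => //; first by case: Ii.
by move=> x y; apply: idealD.
Qed.

Lemma ideal_mulmx I m n p (U : 'M_(m, n)) (V : 'M_(n, p)) : ideal I ->
  (forall i j, I (V i j)) -> forall i j, I ((U *m V) i j).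
Proof. by move=> Ii h i j; rewrite mxE; apply: ideal_sum => // k _;
  apply: idealM. Qed.

Lemma idl_ideal s : ideal (idl s).
Proof.
elim: s => [|x s [IH0 IH]] /=.
  by split=> // a x y -> ->; rewrite mulr0 addr0.
split=> [|a y z [b hb] [c hc]]; first by exists 0; rewrite mul0r subr0.
exists (a * b + c).
have -> : a * y + z - (a * b + c) * x = a * (y - b * x) + (z - c * x) by ring.
exact: IH.
Qed.

Lemma idl_tail x s y : idl s y -> idl (x :: s) y.
Proof. by move=> h /=; exists 0; rewrite mul0r subr0. Qed.

Lemma idl_mem s x : x \in s -> idl s x.
Proof.
elim: s => // y s IH; rewrite in_cons => /predU1P[->|/IH]; last exact: idl_tail.
by exists 1; rewrite mul1r subrr; have [] := idl_ideal s.
Qed.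

Lemma idl_min s I y :
  ideal I -> (forall x, x \in s -> I x) -> idl s y -> I y.
Proof.
move=> Ii; elim: s y => [|x s IH] y h /=; first by move=> ->; case: Ii.
move=> [a /IH Ia]; rewrite -(subrK (a * x) y); apply: idealD => //.
  by apply: Ia => z zs; apply: h; rewrite in_cons zs orbT.
by apply: idealM => //; apply: h; rewrite mem_head.
Qed.

Lemma idl_sub s t y : {subset s <= t} -> idl s y -> idl t y.
Proof.
by move=> st; apply: idl_min; [exact: idl_ideal|move=> x /st /idl_mem].
Qed.

Lemma idl_rspan s : exists p (G : 'M[R]_(p, 1)),
  forall y, idl s y <-> rspan y%:M G.
Proof.
elim: s => [|x s [p [G IH]]].
  exists 0%N, 0 => y; rewrite rspan_zero; split=> [->|];
    first by rewrite raddf0.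
  by move=> /matrixP /(_ 0 0); rewrite !mxE.
exists (p + 1)%N, (col_mx G x%:M) => y; rewrite rspan_col_mx_r; split.
  by move=> [a] /IH h; exists a%:M; rewrite -scalar_mxM -raddfB.
by move=> [W]; rewrite [W]mx11_scalar -scalar_mxM -raddfB => /IH h;
  exists (W 0 0).
Qed.

Definition fg_ideal (I : R -> Prop) : Prop :=
  exists s, (forall x, x \in s -> I x) /\ forall y, I y -> idl s y.

Lemma fg_idealE I : ideal I -> fg_ideal I -> exists s, forall y, I y <->
  idl s y.
Proof.
by move=> Ii [s [sI Is]]; exists s => y; split; [exact: Is|exact: idl_min].
Qed.

(** Induction along 0 -> R^n -> R^(n+1) -> R -> 0: [I] is the ideal of first coordinates and [S']
    the part of S with first coordinate 0. *)
Lemma noeth_of_ideals : (forall I, ideal I -> fg_ideal I) -> noeth.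
Proof.
move=> nI; elim=> [|n IH] S S0 Slin.
  by exists 0%N, 0 => u; rewrite thinmx0 rspan_zero.
have SlinE a (x y : 'rV_1) (u v : 'rV_n) : S (row_mx x u : 'rV_(1 + n)) ->
    S (row_mx y v : 'rV_(1 + n)) ->
    S (row_mx (a *: x + y) (a *: u + v) : 'rV_(1 + n)).
  move=> Su Sv; have := Slin a _ _ Su Sv.
  by rewrite -add_row_mx -(scale_row_mx a x u).
pose I x := exists v : 'rV_n, S (row_mx x%:M v : 'rV_(1 + n)).
pose S' (v : 'rV_n) := S (row_mx 0 v : 'rV_(1 + n)).
have Ii : ideal I.
  split; first by exists 0; rewrite raddf0 row_mx0.
  move=> a x y [u Su] [v Sv]; exists (a *: u + v).
  by have := SlinE a _ _ _ _ Su Sv; rewrite scale_scalar_mx -raddfD.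
have [s sE] := fg_idealE Ii (nI _ Ii); have [p [G GE]] := idl_rspan s.
have IE x : I x <-> rspan x%:M G by rewrite sE GE.
have [||p' [G' G'E]] := IH S'; first by rewrite /S' row_mx0.
  move=> a u v Su Sv; have := SlinE a _ _ _ _ Su Sv.
  by rewrite scaler0 addr0.
have Grow i : exists v : 'rV_n, S (row_mx (row i G) v : 'rV_(1 + n)).
  have [v Sv] : I (G i 0).
    apply/IE; rewrite (_ : _%:M = row i G); first exact/rspan_row/rspan_refl.
    by apply/rowP => j; rewrite !ord1 !mxE eqxx mulr1n.
  exists v; rewrite (_ : row i G = (G i 0)%:M) //.
  by apply/rowP => j; rewrite !ord1 !mxE eqxx mulr1n.
have Smul k (A : 'rV_k) (M : 'M_(k, n.+1)) :
    (forall i, S (row i M)) -> S (A *m M).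
  move=> h; rewrite mulmx_sum_row; apply: (big_ind S) => // [u v Su Sv|i _].
    by rewrite -[u]scale1r; apply: Slin.
  by rewrite -[_ *: _]addr0; apply: Slin.
pose V := \matrix_i xget 0 (fun v : 'rV_n =>
  S (row_mx (row i G) v : 'rV_(1 + n))).
pose H : 'M_(p + p', 1 + n) := col_mx (row_mx G V) (row_mx 0 G').
exists (p + p')%N, H => u; split; last first.
  move=> [A ->]; apply: Smul => i; case: (split_ordP i) => j ->.
    have -> : row (lshift p' j) H = row_mx (row j G) (row j V).
      by rewrite rowKu row_row_mx.
    by rewrite rowK; have := xgetPex 0 (Grow j).
  have -> : row (rshift p j) H = row_mx 0 (row j G').
    by rewrite rowKd row_row_mx row0.
  by apply/(G'E (row j G'))/rspan_row/rspan_refl.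
rewrite -[u](@hsubmxK _ 1 1 n); set x := lsubmx _; set v := rsubmx _.
rewrite [x]mx11_scalar => Su.
have [A eA] : rspan (x 0 0)%:M G by apply/IE; exists v.
have [B eB] : rspan (v - A *m V) G'.
  apply/G'E; rewrite /S'.
  have SV : S (row_mx (x 0 0)%:M (A *m V) : 'rV_(1 + n)).
    rewrite eA -mul_mx_row; apply: Smul => i.
    have -> : row i (row_mx G V) = row_mx (row i G) (row i V) by rewrite
      row_row_mx.
    by rewrite rowK; have := xgetPex 0 (Grow i).
  have := SlinE (-1) _ _ _ _ SV Su.
  by rewrite scaleN1r addNr scaleN1r addrC.
exists (row_mx A B); transitivity (A *m row_mx G V + B *m row_mx 0 G').
  by rewrite !mul_mx_row mulmx0 add_row_mx addr0 -eA -eB addrC subrK.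
by rewrite /H mul_row_col.
Qed.

Definition jac (x : R) : Prop := forall b, exists c, c * (1 - x * b) = 1.

(* [P] is generated by the rows of [G] modulo [N] and [P = x P + N]: the rows
   of [G] are removed one by one. *)
Lemma nakayama x n (P N : 'rV[R]_n -> Prop) p (G : 'M[R]_(p, n)) : jac x ->
  (N 0 /\ forall a u v, N u -> N v -> N (a *: u + v)) ->
  (forall u, P u -> exists u', P u' /\ N (u - x *: u')) ->
  (forall i, P (row i G)) ->
  (forall u, P u -> exists w, N (u - w *m G)) ->
  forall u, P u -> N u.
Proof.
move=> xJ [N0 Nlin] Px.
elim: p G => [|p IH] G GP PG.
  move=> u /PG[w]; rewrite [w]thinmx0 mul0mx subr0; exact.
pose g := row 0 G; pose H : 'M_(p, n) := dsubmx (G : 'M_(1 + p, n)).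
have wG (w : 'rV_(1 + p)) : exists b w', w *m G = b *: g + w' *m H.
  exists (lsubmx w 0 0), (rsubmx w).
  rewrite -{1}[w]hsubmxK -{1}[G](@vsubmxK _ 1 p) mul_row_col; congr (_ + _).
  rewrite [lsubmx w]mx11_scalar mul_scalar_mx !mxE; congr (_ *: _).
  by apply/rowP => j; rewrite !mxE; congr (G _ j); apply/val_inj.
apply: (IH H) => [i|u Pu].
  rewrite (_ : row i H = row (rshift 1 i) G); first exact: GP.
  by apply/rowP => j; rewrite !mxE.
have [w hw] := PG _ Pu; have [b [w' e]] := wG w.
(* Modulo N, g = x g' and g' = b' g + v' H. Hence (1 - x b') g = x v' H, and c, the inverse of 1 - x
   b', expresses g by the remaining rows. *)
have [g' [Pg' hg]] := Px _ (GP 0); rewrite -/g in hg.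
have [v hv] := PG _ Pg'; have [b' [v' e']] := wG v.
have [c ec] := xJ b'.
exists (w' + (b * c * x) *: v').
have -> : u - (w' + (b * c * x) *: v') *m H =
  (b * c) *: (1 *: (g - x *: g') + x *: (g' - v *m G)) + (u - w *m G).
  rewrite e e' mulmxDl -scalemxAl; move: (w' *m H) (v' *m H) => y y'.
  apply/rowP => j; rewrite !mxE; apply/eqP; rewrite -subr_eq0.
  set l := (X in X == _); have -> : l = b * (1 - c * (1 - x * b')) * G 0 j.
    by rewrite /l; ring.
  by rewrite ec subrr mulr0 mul0r.
apply: (Nlin _ _ _ _ hw); apply: (Nlin _ _ _ hg).
by rewrite -[_ *: _]addr0; apply: Nlin.
Qed.

End Noetherian.

Section NoetherianResolutions.
Variables (R : comNzRingType) (R_noeth : noeth R).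

Lemma left_kernel_fg m n (M : 'M[R]_(m, n)) : exists K : {k & 'M[R]_(k, m)},
  tagged K *m M = 0 /\ forall p (U : 'M_(p, m)), U *m M = 0 ->
    rspan U (tagged K).
Proof.
have [||k [K KE]] := R_noeth (S := fun u : 'rV_m => u *m M = 0).
- by rewrite mul0mx.
- by move=> a u v uM vM; rewrite mulmxDl -scalemxAl uM vM scaler0 addr0.
exists (Tagged (fun k => 'M_(k, m)) K); split=> [|p U UM].
  apply/row_matrixP => i; rewrite row_mul row0.
  by apply/KE/rspan_row/rspan_refl.
by apply: rspan_rows => i; apply/KE; rewrite -row_mul UM row0.
Qed.

Definition syz m n (M : 'M[R]_(m, n)) : {k & 'M[R]_(k, m)} :=
  projT1 (cid (left_kernel_fg M)).

Lemma syz_mul m n (M : 'M[R]_(m, n)) : tagged (syz M) *m M = 0.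
Proof. by rewrite /syz; case: cid => K []. Qed.

Lemma syz_exact m n (M : 'M[R]_(m, n)) p (U : 'M_(p, m)) :
  U *m M = 0 -> rspan U (tagged (syz M)).
Proof. by rewrite /syz; case: cid => K [] /= _; apply. Qed.

(** Sizes are bundled because the size of each syzygy matrix is only found along the recursion. *)
Record any_matrix := AnyMatrix {
  am_rows : nat; am_cols : nat; am_matrix : 'M[R]_(am_rows, am_cols)
}.

Definition any_syz (M : any_matrix) : any_matrix :=
  AnyMatrix (tagged (syz (am_matrix M))).

Section MkRes.
Variables (p n : nat) (T : 'M[R]_(p, n)).

Fixpoint iter_syz i : any_matrix :=
  if i is j.+1 then any_syz (iter_syz j) else AnyMatrix T.

(* The columns of each syzygy matrix are, by conversion, the rows of the
   previous one; in particular [d mkres 0] is [T] itself. *)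
Definition mkres : resolution R :=
  @Resolution R (fun i => am_cols (iter_syz i)) (fun i =>
    am_matrix (iter_syz i))
    (fun i => @syz_exact _ _ (am_matrix (iter_syz i)))
    (fun i => syz_mul (am_matrix (iter_syz i))).

End MkRes.

(** Nakayama for the finitely generated module of cocycles modulo coboundaries, applied inside the
    free module of all cochains. *)
Lemma extv_nakayama x (F : resolution R) i p q (T : 'M[R]_(p, q)) : jac x ->
  (forall Z : 'M_(rk F i, q), rspan (d F i *m Z) T ->
     exists Z', rspan (d F i *m Z') T /\ cobound T (Z - x *: Z')) ->
  extv F i T.
Proof.
move=> xJ Zx.
pose P v := rspan (d F i *m vec_mx v) T.
have Plin a u v : P u -> P v -> P (a *: u + v).
  rewrite /P linearP mulmxDr -scalemxAr => Pu Pv.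
  by apply: rspanD => //; apply: rspanZ.
have [|k [G GE]] := R_noeth (S := P) _ Plin.
  by rewrite /P linear0 mulmx0; apply: rspan0.
move=> Z Zc; rewrite -[Z]mxvecK.
apply: (@nakayama _ x _ P (fun v => cobound T (vec_mx v)) _ G) => //.
- split=> [|a u v Nu Nv]; first by rewrite linear0; apply/cobound_rspan/rspan0.
  by rewrite linearP; apply: coboundD => //; apply: coboundM.
- move=> u /Zx[Z' [Z'c h]]; exists (mxvec Z').
  by rewrite /P mxvecK linearB linearZ /= mxvecK.
- by move=> j; apply/GE/rspan_row/rspan_refl.
- move=> u /GE[w ->]; exists w; rewrite subrr linear0.
  exact/cobound_rspan/rspan0.
- by rewrite /P mxvecK.
Qed.

End NoetherianResolutions.

Definition regular_on (R : comNzRingType) (x : R) p q (T : 'M[R]_(p,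
  q)) : Prop :=
  forall u : 'rV_q, rspan (x *: u) T -> rspan u T.

Lemma regular_on_mx (R : comNzRingType) (x : R) p q (T : 'M[R]_(p, q)) m
    (U : 'M_(m, q)) : regular_on x T -> rspan (x *: U) T -> rspan U T.
Proof.
move=> xT xU; apply: rspan_rows => i; apply: xT.
by rewrite -linearZ; apply: rspan_row.
Qed.

(** * Quotients by a regular element *)

Section Koszul.
Variables (R : comNzRingType) (F : resolution R) (x : R).
Hypothesis xF : regular_on x (d F 0).

Lemma scalar_chain i : x%:M *m d F i = d F i *m x%:M.
Proof. by rewrite mul_scalar_mx mul_mx_scalar. Qed.

Lemma scalar_inj p (U : 'M[R]_(p, rk F 0)) :
  rspan (U *m x%:M) (d F 0) -> rspan U (d F 0).
Proof. by rewrite mul_mx_scalar; apply: regular_on_mx. Qed.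

(* A resolution of M / x M, when F resolves M. *)
Definition cone_scalar : resolution R := cone scalar_chain scalar_inj.

(** In Ext^i(M, -) -> Ext^i(M, -) -> Ext^(i+1)(M / x M, -) the last term vanishes, so that
    multiplication by x is onto. *)
Lemma cone_scalar_nakayama i p q (T : 'M[R]_(p, q)) : noeth R -> jac x ->
  extv cone_scalar i.+1 T -> extv F i T.
Proof.
move=> Rn xJ vH; apply: (extv_nakayama Rn xJ) => Z Zc.
have /vH : rspan (d cone_scalar i.+1 *m col_mx 0 Z) T.
  apply/cone_cocycle; rewrite !mulmx0 sub0r.
  by split; [apply: rspan0|apply: rspanN].
move=> /cone_cobound[Y []]; rewrite sub0r mul_scalar_mx => /rspanN.
by rewrite opprK => Yc h; exists Y.
Qed.

(** The sequence 0 -> N -> N -> N / x N -> 0 in the second argument. *)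
Lemma extv_mod i p q (T : 'M[R]_(p, q)) : regular_on x T ->
  extv F i T -> extv F i.+1 T -> extv F i (col_mx T x%:M).
Proof.
move=> xT v0 v1 Z /rspan_col_mx_r[W]; rewrite mul_mx_scalar => Zc.
have [|Y h] := v1 W.
  apply: (regular_on_mx xT); move: (rspanM (d F i.+1) Zc).
  by rewrite mulmxBr mulmxA d_d mul0mx sub0r -scalemxAr => /rspanN;
    rewrite opprK.
have {v0} : cobound T (Z - x *: Y).
  apply: v0; rewrite mulmxBr -scalemxAr; apply: (rspan_trans_sub Zc).
  by rewrite -scalerBr; apply: rspanZ.
case: i Z Y {W Zc v1 h} => [|i] Z Y /= => [h|[Y' h]]; last exists Y'.
all: by apply/rspan_col_mx_r; exists Y; rewrite mul_mx_scalar // addrAC.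
Qed.

End Koszul.

(** * Self-extensions and projective dimension *)

Section SelfExtensions.
Variable R : comNzRingType.
Implicit Type F : resolution R.

Definition shift j (F : resolution R) : resolution R :=
  @Resolution R (fun i => rk F (i + j)) (fun i => d F (i + j))
    (fun i => @d_exact R F (i + j)) (fun i => d_d F (i + j)).

(** Degree 0 has to be excluded: there the syzygy has only trivial coboundaries, while F has those
    through the differential before [d F j]. *)
Lemma extv_shift j F i p q (T : 'M[R]_(p, q)) : (0 < i)%N ->
  extv (shift j F) i T <-> extv F (i + j) T.
Proof. by case: i. Qed.

Section DirectSum.
Variables F G : resolution R.

Definition dsum_rk i := (rk F i + rk G i)%N.
Definition dsum_d i : 'M[R]_(dsum_rk i.+1, dsum_rk i) :=
  block_mx (d F i) 0 0 (d G i).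

Lemma rspan_block m p1 q1 p2 q2 (U : 'M[R]_(m, q1)) (V : 'M[R]_(m, q2))
    (T1 : 'M[R]_(p1, q1)) (T2 : 'M[R]_(p2, q2)) :
  rspan (row_mx U V) (block_mx T1 0 0 T2) <-> rspan U T1 /\ rspan V T2.
Proof.
split=> [[W]|[[W1 ->] [W2 ->]]].
  rewrite -[W]hsubmxK mul_row_block !mulmx0 addr0 add0r => /eq_row_mx[-> ->].
  by split; apply/rspanM/rspan_refl.
by exists (row_mx W1 W2); rewrite mul_row_block !mulmx0 addr0 add0r.
Qed.

Lemma dsum_exact i p (U : 'M_(p, dsum_rk i.+1)) :
  U *m dsum_d i = 0 -> rspan U (dsum_d i.+1).
Proof.
rewrite -[U]hsubmxK mul_row_block !mulmx0 addr0 add0r -[0]row_mx0.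
by move=> /eq_row_mx[/d_exact h1 /d_exact h2]; apply/rspan_block.
Qed.

Lemma dsum_dd i : dsum_d i.+1 *m dsum_d i = 0.
Proof.
by rewrite mulmx_block !mulmx0 !mul0mx !d_d !addr0 block_mx0.
Qed.

Definition dsum : resolution R := Resolution dsum_exact dsum_dd.

Lemma extv_dsum i p q (T : 'M[R]_(p, q)) :
  extv F i T -> extv G i T -> extv dsum i T.
Proof.
move=> vF vG Z; rewrite -[Z]vsubmxK mul_block_col !mul0mx addr0 add0r.
move=> /rspan_col_mx[/vF h1 /vG h2] {vF vG}.
case: i Z h1 h2 => [|i] Z /=; first by move=> *; apply/rspan_col_mx.
move=> [Y1 h1] [Y2 h2]; exists (col_mx Y1 Y2).
rewrite mul_block_col !mul0mx addr0 add0r opp_col_mx add_col_mx.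
exact/rspan_col_mx.
Qed.

Lemma extv_dsum_l i p q (T : 'M[R]_(p, q)) : extv dsum i T -> extv F i T.
Proof.
move=> v Z Zc; have {v} : cobound (F := dsum) T (col_mx Z 0 : 'M_(dsum_rk i,
  q)).
  apply: v; rewrite mul_block_col !mul0mx !mulmx0 !addr0.
  by apply/rspan_col_mx; split=> //; apply: rspan0.
case: i Z Zc => [|i] Z Zc /= => [/rspan_col_mx[] //|[Y]].
rewrite -[Y]vsubmxK mul_block_col !mul0mx addr0 add0r opp_col_mx add_col_mx.
by move=> /rspan_col_mx[h _]; exists (usubmx Y).
Qed.

End DirectSum.

Lemma extv_block F i p1 q1 p2 q2 (T1 : 'M[R]_(p1, q1)) (T2 : 'M[R]_(p2, q2)) :
  extv F i (block_mx T1 0 0 T2) <-> extv F i T1 /\ extv F i T2.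
Proof.
split=> [v|[v1 v2] Z].
  split=> Z Zc.
    have {v} : cobound (block_mx T1 0 0 T2) (row_mx Z 0).
      by apply: v; rewrite mul_mx_row mulmx0; apply/rspan_block; split=> //;
        apply: rspan0.
    case: i Z Zc => [|i] Z Zc /= => [/rspan_block[] //|[Y]].
    rewrite -[Y]hsubmxK mul_mx_row opp_row_mx add_row_mx => /rspan_block[h _].
    by exists (lsubmx Y).
  have {v} : cobound (block_mx T1 0 0 T2) (row_mx 0 Z).
    by apply: v; rewrite mul_mx_row mulmx0; apply/rspan_block; split=> //;
      apply: rspan0.
  case: i Z Zc => [|i] Z Zc /= => [/rspan_block[] //|[Y]].
  rewrite -[Y]hsubmxK mul_mx_row opp_row_mx add_row_mx => /rspan_block[_ h].
  by exists (rsubmx Y).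
rewrite -[Z]hsubmxK mul_mx_row => /rspan_block[/v1 h1 /v2 h2] {v1 v2}.
case: i Z h1 h2 => [|i] Z /=; first by move=> *; apply/rspan_block.
move=> [Y1 h1] [Y2 h2]; exists (row_mx Y1 Y2).
by rewrite mul_mx_row opp_row_mx add_row_mx; apply/rspan_block.
Qed.

(* For [0 < i], the i-th syzygy module, which [d F i] presents, is a direct
   summand of the free module of rank [rk F i.-1]. *)
Definition splits (F : resolution R) i : Prop := extv F i (d F i).

(** The identity is the universal cocycle: every Z in degree i is obtained from it by composition
    with Z, and so is a cochain bounding Z. *)
Lemma cobound_id_extv F i p q (T : 'M[R]_(p, q)) :
  cobound (d F i) (1%:M : 'M_(rk F i)) -> extv F i T.
Proof.
move=> h Z Zc; case: i Z Zc h => [|i] Z Zc /= => [[W e]|[Y [W e]]].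
  by rewrite -[Z]mul1mx e -mulmxA; apply: rspanM.
exists (Y *m Z); rewrite mulmxA -{1}[Z]mul1mx -mulmxBl e -mulmxA.
exact: rspanM.
Qed.

Lemma splits_cobound F i :
  splits F i <-> cobound (d F i) (1%:M : 'M_(rk F i)).
Proof.
split=> [h|]; last exact: cobound_id_extv.
by apply: h; rewrite mulmx1; apply: rspan_refl.
Qed.

Lemma splits_extv F i p q (T : 'M[R]_(p, q)) : splits F i -> extv F i T.
Proof. by move=> /splits_cobound; apply: cobound_id_extv. Qed.

Lemma splitsS F i : splits F i -> splits F i.+1.
Proof.
move=> h; have [W hW] : exists W : 'M_(_, rk F i.+1),
  d F i *m (1%:M - W *m d F i) = 0.
  have {h} /splits_cobound := h; case: i => [|i] /= => [[W e]|[Y [W e]]];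
    exists W.
    by rewrite -e subrr mulmx0.
  by rewrite -e opprB addrC subrK mulmxA d_d mul0mx.
have [|K hK] := @d_exact _ F i _ (1%:M - d F i *m W).
  by rewrite mulmxBl mul1mx -mulmxA -{1}[d F i]mulmx1 -mulmxBr.
move=> Z ZT; exists (W *m Z).
by rewrite mulmxA -{1}[Z]mul1mx -mulmxBl hK -mulmxA; apply: rspanM.
Qed.

(** The sequence 0 -> Omega^(j+1) -> F_j -> Omega^j -> 0 in the second argument; the matrix without
    rows presents the free module F_j. *)
Lemma extv_syzygy F i j : extv F i (d F j) ->
  extv F i.+1 (0 : 'M_(0, rk F j)) -> extv F i.+1 (d F j.+1).
Proof.
move=> v0 v1 Z [W ZW].
have [|Y /rspan_zero/eqP] := v1 (Z *m d F j).
  by apply/rspan_zero; rewrite mulmxA ZW -mulmxA d_d mulmx0.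
rewrite subr_eq0 => /eqP ZY.
have /v0 Yb : rspan (d F i *m Y) (d F j) by rewrite -ZY;
  apply/rspanM/rspan_refl.
have [W' YW] : exists W, d F i *m (Y - W *m d F j) = 0.
  case: i Y {v0 v1 Z W ZW ZY} Yb => [|i] Y /= => [[W ->]|[Y' [W e]]]; exists W.
    by rewrite subrr mulmx0.
  by rewrite -e opprB addrC subrK mulmxA d_d mul0mx.
exists W'; apply: d_exact; rewrite mulmxBl ZY -mulmxA.
by apply/eqP; rewrite -mulmxBr YW.
Qed.

Definition eventually_extv F p q (T : 'M[R]_(p, q)) : Prop :=
  exists e, forall i, (e < i)%N -> extv F i T.

(** Over a Noetherian ring this is injective dimension at most n, and it is how the Gorenstein
    condition enters from here on. *)
Definition free_ext_bound n : Prop := forall F i q, (n < i)%N ->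
  extv F i (0 : 'M[R]_(0, q)).

Definition selfext_bound D : Prop := forall F,
  eventually_extv F (d F 0) -> forall i, (D < i)%N -> extv F i (d F 0).

Definition pd_bound D : Prop := forall F,
  eventually_extv F (d F 0) -> forall i, (D < i)%N -> splits F i.

Lemma eventually_extv_syzygy n F j : free_ext_bound n ->
  eventually_extv F (d F 0) -> eventually_extv F (d F j).
Proof.
move=> Gn F0; elim: j => [//|j [e h]]; exists (maxn e n).+1 => -[//|i].
rewrite ltnS gtn_max => /andP[ei ni].
by apply: extv_syzygy; [apply: h|apply: Gn; apply: ltnW].
Qed.

(* Apply the bound to M + Omega^(D+1) M: the class of the identity in
   Ext^(D+1)(M, Omega^(D+1) M) vanishes, so that Omega^D M is projective. *)
Lemma pd_bound_of_selfext n D :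
  free_ext_bound n -> selfext_bound D -> pd_bound D.
Proof.
move=> Gn RD F F0; have [e0 h0] := F0;
  have [e1 h1] := eventually_extv_syzygy D.+1 Gn F0.
suff h : splits F D.+1 by elim=> // i IH;
  rewrite ltnS leq_eqVlt => /predU1P[<- //|/IH/splitsS].
have /RD h : eventually_extv (dsum F (shift D.+1 F)) (d (dsum F (shift D.+1 F))
  0).
  exists (maxn e0 e1) => i; rewrite gtn_max => /andP[e0i e1i].
  apply: extv_dsum; first by apply/extv_block; split; [apply: h0|apply: h1].
  apply/extv_shift; first by apply: leq_trans e0i.
  by apply/extv_block; split; [apply: h0|apply: h1]; apply: ltn_addr.
by have /extv_dsum_l/extv_block[_] := h D.+1 (leqnn _).
Qed.

End SelfExtensions.

(** * Reduction modulo a regular element *)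

Section Reduction.
Variables (B A : comNzRingType) (pi : {rmorphism B -> A}) (x : B).
Hypothesis pi_surj : forall a, exists b, pi b = a.
Hypothesis pi_x : pi x = 0.
Hypothesis pi_ker : forall b, pi b = 0 -> exists c, b = x * c.
Hypothesis x_regular : forall b, x * b = 0 -> b = 0.

Local Notation "U ^pi" := (map_mx pi U) (at level 2, format "U ^pi").

Lemma map_mx_lift m n (U : 'M[A]_(m, n)) : exists V : 'M[B]_(m, n), V^pi = U.
Proof.
exists (\matrix_(i, j) xget 0 (fun b => pi b = U i j)).
by apply/matrixP => i j; rewrite !mxE; apply: (xgetPex 0 (pi_surj (U i j))).
Qed.

Lemma map_mx_ker m n (U : 'M[B]_(m, n)) : U^pi = 0 -> exists V, U = x *: V.
Proof.
move=> /matrixP U0; exists (\matrix_(i, j) xget 0 (fun c => U i j = x * c)).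
apply/matrixP => i j; rewrite !mxE.
by have := U0 i j; rewrite !mxE => /pi_ker /(xgetPex 0).
Qed.

Lemma scale_regular m n (U : 'M[B]_(m, n)) : x *: U = 0 -> U = 0.
Proof.
by move=> /matrixP U0; apply/matrixP=> i j; have := U0 i j;
  rewrite !mxE => /x_regular.
Qed.

Lemma map_mx_scale m n (U : 'M[B]_(m, n)) : (x *: U)^pi = 0.
Proof. by rewrite map_mxZ pi_x scale0r. Qed.

Lemma rspan_map p m q (U : 'M[B]_(m, q)) (T : 'M[B]_(p, q)) :
  rspan U^pi T^pi <-> exists V, rspan (U - x *: V) T.
Proof.
split=> [[W]|[V [W /(congr1 (map_mx pi))]]]; last first.
  by rewrite map_mxB map_mx_scale subr0 map_mxM => ->; apply/rspanM/rspan_refl.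
have [W' <-] := map_mx_lift W; rewrite -map_mxM => /eqP.
rewrite -subr_eq0 -map_mxB => /eqP /map_mx_ker[V e].
by exists V, W'; rewrite -e opprB addrC subrK.
Qed.

Lemma regular_on_zero q : regular_on x (0 : 'M[B]_(0, q)).
Proof. by move=> u /rspan_zero/scale_regular->; apply: rspan0. Qed.

Variable F : resolution B.

Lemma regular_on_syzygy i : regular_on x (d F i.+1).
Proof.
move=> u [w /(congr1 (mulmx^~ (d F i)))]; rewrite -mulmxA d_d mulmx0.
by rewrite -scalemxAl => /scale_regular /d_exact.
Qed.

Lemma reduction_exact i p (U : 'M[A]_(p, rk F i.+2)) :
  U *m (d F i.+1)^pi = 0 -> rspan U (d F i.+2)^pi.
Proof.
have [V <-] := map_mx_lift U; rewrite -map_mxM => /map_mx_ker[W e].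
have /(regular_on_mx (@regular_on_syzygy i))[Y eY] : rspan (x *: W) (d F i.+1).
  by rewrite -e; apply/rspanM/rspan_refl.
apply/rspan_map; exists Y; apply: d_exact.
by rewrite mulmxBl e eY -scalemxAl subrr.
Qed.

Lemma reduction_dd i : (d F i.+2)^pi *m (d F i.+1)^pi = 0.
Proof. by rewrite -map_mxM d_d map_mx0. Qed.

(* Since [x] is regular on the first syzygy module of [F], its resolution
   remains exact modulo [x]. *)
Definition reduction : resolution A :=
  @Resolution A (fun i => rk F i.+1) (fun i => (d F i.+1)^pi)
    reduction_exact reduction_dd.

Section Target.
Variables (p q : nat) (T : 'M[B]_(p, q)).
Hypothesis xT : regular_on x T.

(** The reduction resolves Omega / x Omega for the first syzygy Omega of M. Its Ext^(i+1) over A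
    into T / x T is Ext^(i+2)(M, T / x T) over B, which sits between Ext^(i+2)(M, T) and
    Ext^(i+3)(M, T). *)
Lemma extv_reduction i : extv F i.+2 T -> extv F i.+3 T ->
  extv reduction i.+1 T^pi.
Proof.
move=> v0 v1 Z; have [Z' <-] := map_mx_lift Z; rewrite -map_mxM.
move=> /rspan_map[U hU]; have [|Y UY] := v1 U.
  apply: (regular_on_mx xT); move: (rspanM (d F i.+3) hU).
  by rewrite mulmxBr mulmxA d_d mul0mx sub0r -scalemxAr => /rspanN;
    rewrite opprK.
have [|Y' h] := v0 (Z' - x *: Y).
  rewrite mulmxBr -scalemxAr; apply: (rspan_trans_sub hU).
  by rewrite -scalerBr; apply: rspanZ.
exists Y'^pi; rewrite -map_mxM -map_mxB; apply/rspan_map; exists Y.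
by rewrite addrAC.
Qed.

(** A cocycle Z becomes a coboundary modulo x, so Z is x Z' up to a coboundary; since x is regular
    on T, Z' is again a cocycle and Nakayama applies. *)
Lemma extv_of_reduction i : noeth B -> jac x ->
  extv reduction i.+1 T^pi -> extv F i.+2 T.
Proof.
move=> Bn xJ v; apply: (extv_nakayama Bn xJ) => Z Zc.
have [|Y] := v Z^pi; first by rewrite -map_mxM; apply/rspan_map; exists 0;
  rewrite scaler0 subr0.
have [Y' <-] := map_mx_lift Y; rewrite -map_mxM -map_mxB => /rspan_map[Z' hZ'].
exists Z'; split; last by exists Y'; rewrite addrAC.
apply: (regular_on_mx xT); move: (rspanB Zc (rspanM (d F i.+2) hZ')).
by rewrite mulmxBr mulmxBr mulmxA d_d mul0mx subr0 scalemxAr subKr.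
Qed.

End Target.
End Reduction.

Section ReductionBounds.
Variables (B A : comNzRingType) (pi : {rmorphism B -> A}) (x : B).
Hypothesis pi_surj : forall a, exists b, pi b = a.
Hypothesis pi_x : pi x = 0.
Hypothesis pi_ker : forall b, pi b = 0 -> exists c, b = x * c.
Hypothesis x_regular : forall b, x * b = 0 -> b = 0.
Hypotheses (B_noeth : noeth B) (xJ : jac x).

Lemma free_ext_bound_reduction n : free_ext_bound A n -> free_ext_bound B n.+1.
Proof.
move=> An F [|[|i]] q //; rewrite ltnS => ni.
apply: (@extv_of_reduction _ _ _ _ pi_surj pi_x pi_ker x_regular) => //.
  exact: regular_on_zero.
by rewrite map_mx0; apply: An.
Qed.

Lemma pd_bound_reduction n D :
  free_ext_bound A n -> pd_bound A D -> pd_bound B D.+1.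
Proof.
move=> An AD F F0.
have Bn := free_ext_bound_reduction An.
have [e h] := eventually_extv_syzygy 1 Bn F0.
have xF i : regular_on x (d F i.+1) by apply: regular_on_syzygy.
pose G := reduction pi_surj pi_x pi_ker x_regular F.
(* [d G 0] is [d F 1] modulo x: self-extensions of the reduced syzygy are controlled by extensions
   of M by its first syzygy, on which x is regular. *)
have GG : eventually_extv G (d G 0).
  exists e => -[//|i] ei; apply: (extv_reduction (xF 0%N)); apply: h.
    exact: ltnW.
  exact/ltnW/ltnW.
move=> [|[|i]] // Di; rewrite /splits.
apply: (@extv_of_reduction _ _ _ _ pi_surj pi_x pi_ker x_regular) => //.
exact: (AD _ GG i.+1).
Qed.

End ReductionBounds.

(** * Modules and their presentations *)

Section Quotient.
Variables (R : comNzRingType) (U : lmodType R).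

Record submod := Submod {
  submod_pred :> {pred U};
  submod_closedP : submod_closed submod_pred
}.

Lemma submod_zmod_closed (S : submod) : zmod_closed (submod_pred S).
Proof.
have [S0 h] := submod_closedP S; split=> // u v Su Sv.
by rewrite -scaleN1r addrC; apply: h.
Qed.

HB.instance Definition _ (S : submod) :=
  GRing.isZmodClosed.Build U (submod_pred S) (submod_zmod_closed S).

Variable S : submod.

Definition quotm : Type := (Quotient.quot (submod_pred S)).
HB.instance Definition _ := GRing.Zmodule.on quotm.

Definition qpi (u : U) : quotm := \pi_(Quotient.quot (submod_pred S)) u.

Lemma qpiP (x : quotm) : exists u, qpi u = x.
Proof. by exists (repr x); rewrite /qpi reprK. Qed.

Lemma qpiD u v : qpi (u + v) = qpi u + qpi v.
Proof. by rewrite /qpi [LHS]raddfD. Qed.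

Lemma qpi_eq u v : (qpi u == qpi v) = (u - v \in submod_pred S).
Proof. by rewrite /qpi Quotient.idealrBE. Qed.

Definition qscale a (x : quotm) : quotm :=
  qpi (a *: repr (x : Quotient.quot (submod_pred S))).

Lemma submodZ a u : u \in submod_pred S -> a *: u \in submod_pred S.
Proof.
have [S0 h] := submod_closedP S.
by move=> Su; rewrite -[_ *: _]addr0; apply: h.
Qed.

Lemma qscaleE a u : qscale a (qpi u) = qpi (a *: u).
Proof.
apply/eqP; rewrite qpi_eq -scalerBr; apply: submodZ.
by rewrite -qpi_eq /qpi reprK.
Qed.

Lemma qscaleA a b x : qscale a (qscale b x) = qscale (a * b) x.
Proof. by have [u <-] := qpiP x; rewrite !qscaleE scalerA. Qed.
Lemma qscale1 : left_id 1 qscale.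
Proof. by move=> x; have [u <-] := qpiP x; rewrite qscaleE scale1r. Qed.
Lemma qscaleDr : right_distributive qscale +%R.
Proof.
move=> a x y; have [u <-] := qpiP x; have [v <-] := qpiP y.
by rewrite -qpiD !qscaleE -qpiD scalerDr.
Qed.
Lemma qscaleDl x : {morph qscale^~ x : a b / a + b}.
Proof. by move=> a b; have [u <-] := qpiP x;
  rewrite !qscaleE scalerDl qpiD. Qed.

HB.instance Definition _ := GRing.Zmodule_isLmodule.Build R quotm
  qscaleA qscale1 qscaleDr qscaleDl.

Lemma qpi_linear : linear qpi.
Proof. by move=> a u v; rewrite qpiD -qscaleE. Qed.
HB.instance Definition _ := GRing.isLinear.Build R U quotm _ qpi qpi_linear.

Lemma qpi_eq0 u : qpi u = 0 <-> u \in submod_pred S.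
Proof. by rewrite -(linear0 qpi) -{2}[u]subr0 -qpi_eq; split=> /eqP. Qed.

Section Lift.
Variables (V : lmodType R) (f : {linear U -> V}).

(** The proof [fS] is an argument so that the linear structure can be inferred from the term. *)
Definition qlift (fS : forall u, u \in submod_pred S ->
  f u = 0) (x : quotm) : V := f (repr (x : Quotient.quot (submod_pred S))).

Hypothesis fS : forall u, u \in submod_pred S -> f u = 0.

Lemma qliftE u : qlift fS (qpi u) = f u.
Proof.
apply/eqP; rewrite -subr_eq0 -linearB; apply/eqP/fS.
by rewrite -qpi_eq /qpi reprK.
Qed.

Lemma qlift_linear : linear (qlift fS).
Proof.
move=> a x y; have [u <-] := qpiP x; have [v <-] := qpiP y.
by rewrite -linearP !qliftE linearP.
Qed.
HB.instance Definition _ :=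
  GRing.isLinear.Build R quotm V _ (qlift fS) qlift_linear.

End Lift.
End Quotient.

Section Projective.
Variable R : comNzRingType.

Lemma kernel_submod_closed (U V : lmodType R) (g : {linear U -> V}) :
  submod_closed [pred u | g u == 0].
Proof.
split=> [|a u v]; first by rewrite inE linear0.
by rewrite !inE => /eqP gu /eqP gv; rewrite linearP gu gv scaler0 addr0.
Qed.

Definition kernel (U V : lmodType R) (g : {linear U -> V}) : submod U :=
  Submod (kernel_submod_closed g).

(** Here g need not be onto. Instead of restricting its target to the image, f is factored through U
    / ker g, onto which U surjects. *)
Lemma projective_lift (P U V : lmodType R) (f : {linear P -> V})
    (g : {linear U -> V}) : projective P -> (forall x, exists u, g u = f x) ->
  exists h : {linear P -> U}, forall x, g (h x) = f x.
Proof.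
move=> Pp fg; pose K := kernel g.
pose t x : quotm K := qpi K (xget 0 (fun u => g u = f x)).
have tE x u : g u = f x -> t x = qpi K u.
  move=> gu; apply/eqP; rewrite qpi_eq inE linearB gu.
  by rewrite (xgetPex 0 (fg x)) subrr.
have tl : linear t.
  move=> a x y; have [u gu] := fg x; have [v gv] := fg y.
  rewrite (tE x u gu) (tE y v gv) -linearP; apply: tE.
  by rewrite !linearP gu gv.
pose tL : {linear P -> quotm K} :=
  HB.pack t (GRing.isLinear.Build R P _ _ t tl).
have [|h hE] := Pp U (quotm K) (qpi K) tL; first exact: qpiP.
exists h => x; have [u gu] := fg x.
have /eqP := hE x; rewrite [X in _ == X](tE x u gu) qpi_eq inE linearB gu.
by rewrite subr_eq0 => /eqP.
Qed.

End Projective.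

(** * Independence of the projective resolution *)

Section ProjectiveComparison.
Variables (R : comNzRingType) (M : lmodType R).
Implicit Types P Q : proj_resolution M.

(** [a] is the degree n part of a chain map over the identity of M. The lower parts are only
    asserted to exist, which avoids building a dependent family. *)
Fixpoint lifts_id P Q n : {linear pr_mod P n -> pr_mod Q n} -> Prop :=
  match n with
  | 0 => fun a => forall x, pr_aug Q (a x) = pr_aug P x
  | k.+1 => fun a => exists b : {linear pr_mod P k -> pr_mod Q k},
      lifts_id b /\ forall x, pr_diff Q k (a x) = b (pr_diff P k x)
  end.

Lemma aug_diff P x : pr_aug P (pr_diff P 0 x) = 0.
Proof. by apply/(pr_exact0 (p := P)); exists x. Qed.

Lemma diff_diff P n x : pr_diff P n (pr_diff P n.+1 x) = 0.
Proof. by apply/(pr_exactS (p := P)); exists x. Qed.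

Lemma lifts_id_boundary P Q n (a : {linear pr_mod P n -> pr_mod Q n}) x :
  lifts_id a -> exists u, pr_diff Q n u = a (pr_diff P n x).
Proof.
case: n a x => [|n] a x /=.
  by move=> aE; apply/(pr_exact0 (p := Q)); rewrite aE aug_diff.
by move=> [b [_ aE]]; apply/(pr_exactS (p := Q)); rewrite aE diff_diff linear0.
Qed.

Lemma lifts_idS P Q n (a : {linear pr_mod P n -> pr_mod Q n}) : lifts_id a ->
  exists b : {linear pr_mod P n.+1 -> pr_mod Q n.+1},
    forall x, pr_diff Q n (b x) = a (pr_diff P n x).
Proof.
move=> aP; apply: (projective_lift (f := a \o pr_diff P n) (g := pr_diff Q n)).
  exact: pr_projective.
by move=> x; apply: lifts_id_boundary.
Qed.

Lemma lifts_id_ex P Q n :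
  exists a : {linear pr_mod P n -> pr_mod Q n}, lifts_id a.
Proof.
elim: n => [|n [a aP]].
  apply: (projective_lift (f := pr_aug P) (g := pr_aug Q)).
    exact: pr_projective.
  by move=> x; apply: pr_aug_surj.
by have [b bE] := lifts_idS aP; exists b, a.
Qed.

Lemma lifts_id_comp P Q P' n (a : {linear pr_mod P n -> pr_mod Q n})
    (b : {linear pr_mod Q n -> pr_mod P' n}) :
  lifts_id a -> lifts_id b -> lifts_id (b \o a).
Proof.
elim: n a b => [|n IH] a b /=; first by move=> aE bE x; rewrite bE aE.
move=> [a' [a'P aE]] [b' [b'P bE]]; exists (b' \o a'); split; first exact: IH.
by move=> x /=; rewrite bE aE.
Qed.

Lemma id_homotopy0 P (c : {linear pr_mod P 0 -> pr_mod P 0}) : lifts_id c ->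
  exists h : {linear pr_mod P 0 -> pr_mod P 1},
    forall x, pr_diff P 0 (h x) = c x - x.
Proof.
move=> cE; apply: (projective_lift (f := c \- idfun) (g := pr_diff P 0)).
  exact: pr_projective.
by move=> x; apply/(pr_exact0 (p := P)); rewrite linearB cE subrr.
Qed.

Lemma id_homotopyS P n (c : {linear pr_mod P n.+1 -> pr_mod P n.+1}) :
  lifts_id c ->
  exists (h : {linear pr_mod P n -> pr_mod P n.+1})
         (h' : {linear pr_mod P n.+1 -> pr_mod P n.+2}),
    forall x, pr_diff P n.+1 (h' x) = c x - x - h (pr_diff P n x).
Proof.
elim: n c => [|n IH] c [b [bP cE]].
  have [h hE] := id_homotopy0 bP; exists h.
  apply: (projective_lift (f := (c \- idfun) \- (h \o pr_diff P 0))).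
    exact: pr_projective.
  move=> x; apply/(pr_exactS (p := P)).
  by rewrite !linearB cE hE /= subrr.
have [h [h' hE]] := IH _ bP; exists h'.
apply: (projective_lift (f := (c \- idfun) \- (h' \o pr_diff P n.+1))).
  exact: pr_projective.
move=> x; apply/(pr_exactS (p := P)).
by rewrite !linearB cE hE /= diff_diff linear0 subr0 subrr.
Qed.

Lemma coboundary_comparison P Q (N : lmodType R) i :
  (forall g : {linear pr_mod Q i -> N}, cocycle g -> coboundary g) ->
  forall f : {linear pr_mod P i -> N}, cocycle f -> coboundary f.
Proof.
move=> vQ f fc.
have [a aP] := lifts_id_ex P Q i.
(* The lift is taken up to degree i + 1, since [b'] is what makes f o b a cocycle. *)
have [b' [b [bP bE]]] := lifts_id_ex Q P i.+1.
have {vQ} : coboundary (f \o b).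
  by apply: vQ => x /=; rewrite -bE; apply: fc.
case: i f fc a aP b' b bP bE => [|i] f fc a aP b' b bP bE /=.
  move=> fb x; have [h hE] := id_homotopy0 (lifts_id_comp aP bP).
  by rewrite -[x](subKr (b (a x))) linearB fb -hE fc subrr.
move=> [g fb]; have [h [h' hE]] := id_homotopyS (lifts_id_comp aP bP).
have [a' [_ aE]] := aP.
exists ((g \o a') \- (f \o h)) => x /=.
rewrite -aE -fb -linearB; apply/eqP; rewrite -subr_eq0 -linearB -opprB.
by rewrite -[b (a x)]/((b \o a) x) addrAC -hE linearN fc oppr0.
Qed.

End ProjectiveComparison.

(** * Finitely generated modules as cokernels of matrices *)

Section Bridge.
Variable R : comNzRingType.

Definition row_lin n (U : lmodType R) (s : 'I_n -> U) (u : 'rV[R]_n) : U :=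
  \sum_j u 0 j *: s j.

Lemma row_lin_linear n (U : lmodType R) (s : 'I_n -> U) : linear (row_lin s).
Proof.
move=> a u v; rewrite /row_lin scaler_sumr -big_split; apply: eq_bigr => j _.
by rewrite !mxE scalerDl scalerA.
Qed.
HB.instance Definition _ n (U : lmodType R) (s : 'I_n -> U) :=
  GRing.isLinear.Build R 'rV[R]_n U _ (row_lin s) (row_lin_linear s).

Lemma linear_rowE n (U : lmodType R) (f : {linear 'rV[R]_n -> U}) u :
  f u = \sum_j u 0 j *: f (delta_mx 0 j).
Proof.
by rewrite {1}[u]row_sum_delta linear_sum; apply: eq_bigr => j _;
  rewrite linearZ.
Qed.

Lemma rV_projective n : projective 'rV[R]_n.
Proof.
move=> U V g f gs.
exists (row_lin (fun j => xget 0 (fun u => g u = f (delta_mx 0 j)))) => u.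
rewrite [f u]linear_rowE /row_lin /= linear_sum; apply: eq_bigr => j _.
by rewrite linearZ (xgetPex 0 (gs (f (delta_mx 0 j)))).
Qed.

Definition mulr_lin m n (T : 'M[R]_(m, n)) (u : 'rV_m) : 'rV_n := u *m T.

Lemma mulr_lin_linear m n (T : 'M[R]_(m, n)) : linear (mulr_lin T).
Proof. by move=> a u v; rewrite /mulr_lin mulmxDl scalemxAl. Qed.
HB.instance Definition _ m n (T : 'M[R]_(m, n)) :=
  GRing.isLinear.Build R 'rV[R]_m 'rV[R]_n _ (mulr_lin T) (mulr_lin_linear T).

Definition presents p n (T : 'M[R]_(p, n)) (M : lmodType R)
    (e : {linear 'rV[R]_n -> M}) : Prop :=
  surjection e /\ forall u, e u = 0 <-> rspan u T.

Section Resolution.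
Variables (F : resolution R) (M : lmodType R) (e : {linear 'rV[R]_(rk F 0) ->
  M}).
Hypothesis eM : presents (d F 0) e.

Lemma presents_exact0 : exact_at (mulr_lin (d F 0)) e.
Proof. by move=> u; rewrite eM.2; split=> [[w ->]|[w <-]]; exists w. Qed.

Lemma presents_exactS i : exact_at (mulr_lin (d F i.+1)) (mulr_lin (d F i)).
Proof.
move=> u; split=> [/d_exact[w ->]|[w <-]]; first by exists w.
by rewrite /= /mulr_lin -mulmxA d_d mulmx0.
Qed.

Definition free_resolution : proj_resolution M :=
  @ProjResolution R M (fun i => 'rV[R]_(rk F i)) (fun i => mulr_lin (d F i)) e
    (fun i => @rV_projective (rk F i)) eM.1 presents_exact0 presents_exactS.

Variables (N : lmodType R) (p q : nat) (T : 'M[R]_(p, q)).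
Variable g : {linear 'rV[R]_q -> N}.
Hypothesis gN : presents T g.

Lemma presents_rspan m (U : 'M_(m, q)) :
  (forall u : 'rV_m, g (u *m U) = 0) <-> rspan U T.
Proof.
split=> [h|UT u]; last by apply/gN.2/rspanM.
by apply: rspan_rows => i; apply/gN.2; rewrite rowE.
Qed.

Lemma linear_to_presented m (f : {linear 'rV[R]_m -> N}) :
  exists Z : 'M_(m, q), forall u, f u = g (u *m Z).
Proof.
exists (\matrix_j xget 0 (fun v => g v = f (delta_mx 0 j))) => u.
rewrite linear_rowE mulmx_sum_row linear_sum; apply: eq_bigr => j _.
by rewrite linearZ rowK (xgetPex 0 (gN.1 (f (delta_mx 0 j)))).
Qed.

(** [ext_nonzero] admits any projective resolution, so the question is first moved to the free one;
    there cochains lift to matrices because their source is free. *)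
Lemma extv_ext i : extv F i T <-> ~ ext_nonzero i M N.
Proof.
split=> [v [P [f [fc]]]|v Z Zc].
  apply; apply: (@coboundary_comparison _ _ P free_resolution) fc => {}f fc.
  have [Z fE] := linear_to_presented f.
  have {v} : cobound T Z.
    apply: v; apply/presents_rspan => u; rewrite mulmxA -fE.
    exact: fc.
  case: i f fc Z fE => [|i] f fc Z fE /= => [/presents_rspan h x|[Y h]].
    by rewrite fE.
  exists (g \o mulr_lin Y) => x; rewrite fE /= /mulr_lin -mulmxA.
  apply/eqP; rewrite -subr_eq0 -linearB -mulmxBr; apply/eqP.
  by move: x; apply/presents_rspan.
pose f : {linear 'rV[R]_(rk F i) -> N} := g \o mulr_lin Z.
have [|h] := pselect (coboundary (P := free_resolution) f); last first.
  case: v; exists free_resolution, f; split=> // x.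
  by rewrite /f /= /mulr_lin -mulmxA; move: x; apply/presents_rspan.
case: i {v} Z Zc @f => [|i] Z Zc /= => [h|[h hE]]; first exact/presents_rspan.
have [Y YE] := linear_to_presented h; exists Y.
apply/presents_rspan => u; rewrite mulmxBr linearB mulmxA -YE.
by move: (hE u) => /= ->; rewrite subrr.
Qed.

End Resolution.
End Bridge.

Section FiniteFed.

Lemma nat_sup_bounded (S : classical_sets.set nat) :
  nat_sup S <> None <-> exists n, forall k, S k -> (k <= n)%N.
Proof.
rewrite /nat_sup; case: pselect => [b|nb]; split=> //.
  by move=> _; have [n /asboolP] := b; exists n.
by move=> [n h]; case: nb; exists n; apply/asboolP.
Qed.

Lemma nat_sup_le (S : classical_sets.set nat) n m : nat_sup S = Some n ->
  (forall k, S k -> (k <= m)%N) -> (n <= m)%N.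
Proof.
rewrite /nat_sup; case: pselect => // b [<-] h.
by case: ex_minnP => k _; apply; apply/asboolP.
Qed.

Lemma nat_sup_ge (S : classical_sets.set nat) n k :
  nat_sup S = Some n -> S k -> (k <= n)%N.
Proof.
rewrite /nat_sup; case: pselect => // b [<-] Sk.
by case: ex_minnP => j /asboolP h _; apply: h.
Qed.

Variable R : comNzRingType.

Lemma noeth_of_noetherian : noetherian R -> noeth R.
Proof.
move=> Rn; apply: noeth_of_ideals => I Ii.
pose J : {pred R^o} := fun x => `[< I x >].
have [|s sJ Js] := Rn J.
  split=> [|a x y]; first by apply/asboolP; case: Ii.
  by move=> /asboolP Ix /asboolP Iy; apply/asboolP; case: Ii => _; apply.
exists s; split=> [x /sJ /asboolP //|y Iy].
have /Js[t ts ->] : y \in J by apply/asboolP.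
rewrite big_seq; apply: ideal_sum => [|p /ts ps]; first exact: idl_ideal.
by apply: idealM; [apply: idl_ideal|apply: idl_mem].
Qed.

Lemma presents_fg p n (T : 'M[R]_(p, n)) (M : lmodType R)
  (e : {linear 'rV[R]_n -> M}) : presents T e -> finitely_generated M.
Proof.
move=> [es _]; exists [seq e (delta_mx 0 j) | j <- enum 'I_n] => x.
have [u <-] := es x.
exists [seq (u 0 j, e (delta_mx 0 j)) | j <- enum 'I_n] => [y|].
  by move=> /mapP[j _ ->]; apply/mapP; exists j; rewrite // mem_enum.
rewrite big_map big_enum linear_rowE.
exact: eq_bigr.
Qed.

Lemma rspan_submod_closed p n (T : 'M[R]_(p, n)) :
  submod_closed (fun u : 'rV[R]_n => `[< rspan u T >]).
Proof.
split=> [|a u v /asboolP uT /asboolP vT]; apply/asboolP; first exact: rspan0.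
by apply: rspanD => //; apply: rspanZ.
Qed.

Definition coker p n (T : 'M[R]_(p, n)) : lmodType R :=
  quotm (Submod (rspan_submod_closed T)).

Lemma coker_presents p n (T : 'M[R]_(p, n)) :
  presents T (qpi (Submod (rspan_submod_closed T))).
Proof.
split=> [x|u]; first exact: qpiP.
by rewrite qpi_eq0; split=> /asboolP.
Qed.

Lemma fg_presents (M : lmodType R) : noeth R -> finitely_generated M ->
  exists p n (T : 'M[R]_(p, n)) (e : {linear 'rV[R]_n -> M}), presents T e.
Proof.
move=> Rn [s sM].
pose e : {linear 'rV[R]_(size s) -> M} := row_lin (fun j : 'I_(size s) => s`_j).
have [||p [T TE]] := Rn (size s) (fun u => e u = 0); first by rewrite linear0.
  by move=> a u v e0 e1; rewrite linearP e0 e1 scaler0 addr0.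
exists p, (size s), T, e; split=> [x|]; last exact: TE.
have [t ts ->] := sM x.
rewrite big_seq; apply: (big_ind (fun x => exists u, e u = x)).
- by exists 0; rewrite linear0.
- by move=> _ _ [u <-] [v <-]; exists (u + v); rewrite linearD.
move=> y /ts ys; have ltj : (index y.2 s < size s)%N by rewrite index_mem.
exists (y.1 *: delta_mx 0 (Ordinal ltj)); rewrite linearZ /=; congr (_ *: _).
rewrite /row_lin (bigD1 (Ordinal ltj)) //= mxE !eqxx scale1r nth_index //.
rewrite big1 ?addr0 // => j jn; rewrite mxE (negPf jn) andbF scale0r //.
Qed.

Lemma finite_fedP : noeth R ->
  finite_fed R <-> exists D, selfext_bound R D.
Proof.
move=> Rn; rewrite /finite_fed /fed nat_sup_bounded; split=> -[D h]; exists D.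
  move=> F [e0 F0] i Di; have eM := coker_presents (d F 0).
  apply/(extv_ext eM eM) => ei.
  have vM : exists n, forall k, ext_nonzero k (coker (d F 0)) (coker (d F 0)) ->
      (k <= n)%N.
    exists e0 => k; apply: contraPleq => /F0 v.
    exact: (proj1 (extv_ext eM eM _) v).
  have := vM; rewrite -(nat_sup_bounded (fun k => ext_nonzero k _ _)).
  case E: nat_sup => [n|] // _.
  have := nat_sup_ge E ei; rewrite leqNgt => /negP; apply.
  apply: leq_ltn_trans Di; apply: h; exists (coker (d F 0)) => //.
  exact: presents_fg eM.
move=> n [M Mfg Mn]; have [p [k [T [e eM]]]] := fg_presents Rn Mfg.
apply: (nat_sup_le Mn) => i; apply: contraPleq.
have eM' : presents (d (mkres Rn T) 0) e := eM.
move=> Di; apply/(extv_ext eM' eM); apply: (h (mkres Rn T)) => //.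
exists n => j nj; apply/(extv_ext eM' eM) => /(nat_sup_ge Mn).
by rewrite leqNgt nj.
Qed.

Section Gorenstein.
Variables (F : resolution R) (M : lmodType R) (I : inj_resolution M).

(* A double complex chase, with rows F_i -> F_{i-1} and columns the injective
   resolution: [f] is a cocycle in degree [i] with values in the [k]-th
   cosyzygy of [M]. *)
Lemma cosyzygy_coboundary n : (forall k, (n < k)%N -> forall x : ir_mod I k,
  x = 0) ->
  forall k i (f : {linear 'rV_(rk F i.+1) -> ir_mod I k}), (n < i.+1 + k)%N ->
  (forall u, f (u *m d F i.+1) = 0) -> (forall u, ir_diff I k (f u) = 0) ->
  exists h : {linear 'rV_(rk F i) -> ir_mod I k},
    (forall u, ir_diff I k (h u) = 0) /\ forall u, f u = h (u *m d F i).
Proof.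
(* Induction on n + 1 - k: the step passes to the next cosyzygy and lowers the degree by one. *)
move=> In k i; move: {2}(n.+1 - k)%N (leqnn (n.+1 - k)) => b.
elim: b k i => [|b IH] k i.
  rewrite leqn0 subn_eq0 => nk f _ _ _; have z := In k nk.
  exists (row_lin (fun=> 0)); split=> u; last by rewrite [LHS]z [RHS]z.
  by rewrite -[RHS](linear0 (ir_diff I k)); congr (ir_diff I k _); apply: z.
move=> bk f nik fc fk.
pose e : {linear 'rV[R]_(rk F i.+1) -> 'rV[R]_(rk F i)} := mulr_lin (d F i).
have fK u : u \in submod_pred (kernel e) -> f u = 0.
  by rewrite inE => /eqP /d_exact[w ->].
have eK u : u \in submod_pred (kernel e) -> e u = 0 by rewrite inE => /eqP.
have e_inj : injective (qlift eK).
  move=> x y; have [u <-] := qpiP x; have [v <-] := qpiP y.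
  rewrite !qliftE => uv; apply/eqP.
  by rewrite qpi_eq inE linearB uv subrr.
(* [f] factors through the image of [d F i], and injectivity extends it to [h0] on the whole free
   module. [h0] need not take values in the kernel of [ir_diff I k]; subtracting [h2] repairs
   this. *)
have [h0 h0E] := ir_injective (qlift fK) e_inj.
have {h0E} fh0 u : f u = h0 (u *m d F i).
  have E1 : qlift eK (qpi (kernel e) u) = u *m d F i := qliftE eK u.
  by rewrite -(qliftE fK u) -E1; apply/esym/h0E.
have [kn|nk] := leqP k n; last first.
  exists h0; split=> // u; rewrite -[RHS](linear0 (ir_diff I k)).
  by have -> : h0 u = 0 by apply: In.
have dd x : ir_diff I k.+1 (ir_diff I k x) = 0 by apply/ir_exactS; exists x.
case: i f fc fk @e fK eK e_inj h0 fh0 nik =>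
  [|i] f fc fk e fK eK e_inj h0 fh0 nik.
  exists h0; split=> // u; apply: In.
  by move: nik; rewrite add1n ltnS.
have [||||h1 [dh1 h1E]] := IH k.+1 i _ (ir_diff I k \o h0).
- by rewrite subSS; move: bk; rewrite subSn // ltnS.
- by rewrite addnS -addSn.
- by move=> u; rewrite /= -fh0 fk.
- by move=> u; apply: dd.
have [|h2 h2E] := projective_lift (f := h1) (g :=
  ir_diff I k) (@rV_projective R _).
  by move=> u; apply/ir_exactS.
exists (h0 \- (h2 \o mulr_lin (d F i))); split=> u /=.
  by have /= e1 := h1E u; rewrite linearB h2E e1 subrr.
by rewrite /mulr_lin -mulmxA d_d mulmx0 linear0 subr0.
Qed.

Lemma gorenstein_extv n : (forall k, (n < k)%N -> forall x : ir_mod I k,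
  x = 0) ->
  forall i (f : {linear 'rV_(rk F i.+1) -> M}), (n < i.+1)%N ->
  (forall u, f (u *m d F i.+1) = 0) ->
  exists h : {linear 'rV_(rk F i) -> M}, forall u, f u = h (u *m d F i).
Proof.
move=> In i f ni fc.
have [|||h [dh hE]] := cosyzygy_coboundary In (i := i) (f := ir_aug I \o f).
- by rewrite addn0.
- by move=> u; rewrite /= fc linear0.
- by move=> u; apply/ir_exact0; exists (f u).
have [|h' h'E] := projective_lift (f := h) (g := ir_aug I) (@rV_projective R _).
  by move=> u; apply/ir_exact0.
by exists h' => u; apply: (ir_aug_inj (i := I)); rewrite h'E -hE.
Qed.

End Gorenstein.

Lemma free_ext_bound_gorenstein :
  gorenstein R -> exists n, free_ext_bound R n.
Proof.
move=> [n [I In]]; exists n => F [//|i] q ni Z /rspan_zero Zc.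
pose f j : {linear 'rV[R]_(rk F i.+1) -> R^o} := row_lin (fun a => Z a j : R^o).
have fE j u : f j u = (u *m Z) 0 j by rewrite mxE.
have h j : exists h : {linear 'rV[R]_(rk F i) -> R^o},
    forall u, f j u = h (u *m d F i).
  apply: (gorenstein_extv In) => // u.
  by rewrite fE -mulmxA Zc mulmx0 mxE.
have [g gE] := choice h.
exists (\matrix_(b, j) g j (delta_mx 0 b)).
apply/rspan_zero/eqP; rewrite subr_eq0; apply/eqP/matrixP => a j.
have := fE j (delta_mx 0 a); rewrite -rowE [in RHS]mxE => <-.
rewrite gE -rowE linear_rowE !mxE; apply: eq_bigr => b _.
by rewrite !mxE.
Qed.

End FiniteFed.

(** * Regular sequences in Gorenstein rings *)

Section AscendingChains.
Variables (R : comNzRingType) (R_noeth : noeth R).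

Lemma noeth_fg I : ideal I -> exists s : seq R, forall y, I y <-> idl s y.
Proof.
move=> Ii; have [I0 Ilin] := Ii.
have [||p [G GE]] := R_noeth (S := fun u : 'rV_1 => I (u 0 0));
  first by rewrite mxE.
  by move=> a u v; rewrite !mxE; apply: Ilin.
exists [seq G i 0 | i <- enum 'I_p] => y; split=> [Iy|].
  have /GE[w /matrixP/(_ 0 0)] : I ((y%:M : 'rV_1) 0 0) by rewrite mxE eqxx.
  rewrite !mxE eqxx mulr1n => ->; apply: ideal_sum; first exact: idl_ideal.
  move=> j _; apply: idealM; first exact: idl_ideal.
  by apply/idl_mem/mapP; exists j; rewrite // mem_enum.
apply: idl_min => // _ /mapP[j _ ->].
have : I ((row j G) 0 0) by apply/GE/rspan_row/rspan_refl.
by rewrite mxE.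
Qed.

Lemma chain_stable (I : nat -> R -> Prop) : (forall n, ideal (I n)) ->
  (forall n x, I n x -> I n.+1 x) ->
  exists N, forall n x, I n x -> I N x.
Proof.
move=> Ii Ic.
have Imono n k x : (n <= k)%N -> I n x -> I k x.
  by move=> /subnK <-; elim: (k - n)%N => // j IH /IH /Ic.
have Ui : ideal (fun x => exists n, I n x).
  split; first by exists 0%N; case: (Ii 0%N).
  move=> a x y [n Ix] [k Iy]; exists (maxn n k).
  have [_ h] := Ii (maxn n k); apply: h; first exact: Imono (leq_maxl n k) Ix.
  exact: Imono (leq_maxr n k) Iy.
have [s sE] := noeth_fg Ui.
have [N hN] : exists N, forall x, x \in s -> I N x.
  have : forall x, x \in s -> exists n, I n x by move=> x /idl_mem /sE.
  elim: s {sE} => [|y s IH] h; first by exists 0%N.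
  have [|N hN] := IH; first by move=> x xs; apply: h; rewrite in_cons xs orbT.
  have [n Iy] := h y (mem_head _ _); exists (maxn n N) => x.
  rewrite in_cons => /predU1P[->|/hN]; first exact: Imono (leq_maxl _ _) Iy.
  exact/Imono/leq_maxr.
by exists N => n x Ix; apply: (idl_min (Ii N) hN); apply/sE; exists n.
Qed.

Lemma noeth_max (P : (R -> Prop) -> Prop) : (forall I, P I -> ideal I) ->
  (exists I, P I) ->
  exists I, P I /\ forall J, P J -> (forall x, I x -> J x) -> forall x, J x ->
    I x.
Proof.
move=> Pi [I0 PI0]; apply: contrapT => nmax.
have next (I : {I | P I}) : exists J : {I | P I},
    (forall x, sval I x -> sval J x) /\ ~ (forall x, sval J x -> sval I x).
  apply: contrapT => nJ; apply: nmax; exists (sval I); split;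
    first exact: svalP.
  move=> J PJ IJ; apply: contrapT => JI; apply: nJ.
  by exists (exist _ J PJ).
have [f fE] := choice next.
pose I n := sval (iter n f (exist _ I0 PI0)).
have [||N hN] := @chain_stable I; first by move=> n; apply/Pi/svalP.
  by move=> n x; apply: (fE _).1.
by apply: (fE (iter N f (exist _ I0 PI0))).2 => x; apply: (hN N.+1).
Qed.

End AscendingChains.

(** * Associated primes and zero divisors *)

Section Depth.
Variables (R : comNzRingType) (R_noeth : noeth R).
Variables (m I : R -> Prop).
Hypotheses (mi : ideal m) (Ii : ideal I).

Definition colon s : R -> Prop := fun y => I (s * y).

Lemma colon_ideal s : ideal (colon s).
Proof.
split=> [|a x y]; rewrite /colon; first by rewrite mulr0; case: Ii.
by move=> Ix Iy; rewrite mulrDr mulrCA; case: Ii => _; apply.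
Qed.

(** (I : s) is then an associated prime of R / I; the prime is represented by the element s. *)
Definition max_colon s : Prop := ~ I s /\ forall s', ~ I s' ->
  (forall y, colon s y -> colon s' y) -> forall y, colon s' y -> colon s y.

Lemma max_colon_prime s y z : max_colon s ->
  colon s (y * z) -> colon s y \/ colon s z.
Proof.
move=> [_ smax] syz; have [sz|sz] := pselect (colon s z); [by right|left].
apply: (smax (s * z)) => // [x sx|]; rewrite /colon.
  by rewrite mulrAC [_ * z]mulrC; apply: idealM.
by rewrite mulrAC -mulrA.
Qed.

Lemma max_colon_ex s : ~ I s ->
  exists t, max_colon t /\ forall y, colon s y -> colon t y.
Proof.
move=> Is.
have [||J [[t [It [-> st]]] tmax]] := noeth_max R_noeth
  (P := fun J => exists t, ~ I t /\ J = colon t /\ forall y, colon s y -> J y).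
- by move=> _ [t [_ [-> _]]]; apply: colon_ideal.
- by exists (colon s), s.
exists t; split=> //; split=> // s' Is' ts'; apply: tmax => //.
by exists s'; split=> //; split=> // y /st/ts'.
Qed.

Lemma max_colon_prod s (ts : seq R) : max_colon s ->
  (forall q, q \in ts -> exists e, colon q e /\ ~ colon s e) ->
  exists e, (forall q, q \in ts -> colon q e) /\ ~ colon s e.
Proof.
move=> sm; elim: ts => [|q ts IH] h.
  by exists 1; split=> //; rewrite /colon mulr1; case: sm.
have [|e [et es]] := IH; first by move=> r rt; apply: h;
  rewrite in_cons rt orbT.
have [e' [e'q e's]] := h q (mem_head _ _).
exists (e * e'); split=> [r|/(max_colon_prime sm)[]//].
rewrite in_cons => /predU1P[->|/et ?]; last first.
  by rewrite mulrC; apply: idealM => //; apply: colon_ideal.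
by apply: idealM => //; apply: colon_ideal.
Qed.

Lemma prime_avoidance (ts : seq R) : (forall s, s \in ts -> max_colon s) ->
  (forall s, s \in ts -> exists a, m a /\ ~ colon s a) ->
  exists a, m a /\ forall s, s \in ts -> ~ colon s a.
Proof.
elim: ts => [|s ts IH] tm h; first by exists 0; split=> //; case: mi.
have [||a [ma at_]] := IH.
- by move=> q qt; apply: tm; rewrite in_cons qt orbT.
- by move=> q qt; apply: h; rewrite in_cons qt orbT.
have sm := tm s (mem_head _ _).
have [sa|sa] := pselect (colon s a); last first.
  by exists a; split=> // q; rewrite in_cons => /predU1P[->|/at_].
have [c [mc sc]] := h s (mem_head _ _).
(* No (I : q) lies in (I : s): by maximality of (I : q) the two would agree, but a lies only in (I :
   s). With e in all the (I : q) and outside (I : s), a + c e avoids every prime. *)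
have [|e [et es]] := @max_colon_prod s ts sm.
  move=> q qt; apply: contrapT => nq.
  have [_ qmax] : max_colon q by apply: tm; rewrite in_cons qt orbT.
  apply: (at_ _ qt); apply: (qmax s) => //; first by case: sm.
  by move=> y qy; apply: contrapT => sy; apply: nq; exists y.
exists (a + c * e); split.
  by apply: idealD => //; rewrite mulrC; apply: idealM.
move=> q; rewrite in_cons => /predU1P[->|qt] h'.
  have : colon s (c * e).
    by rewrite -(addKr a (c * e)) addrC; apply: idealB => //;
      apply: colon_ideal.
  by move=> /(max_colon_prime sm)[].
apply: (at_ _ qt); rewrite -(addrK (c * e) a); apply: idealB => //.
  exact: colon_ideal.
by apply: idealM; [apply: colon_ideal|apply: et].
Qed.

(* The maximal annihilators [I : s] are prime and finitely many of them cover
   the zero divisors modulo [I]. *)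
Lemma zero_divisors_annihilated :
  (forall y, m y -> exists s, ~ I s /\ I (s * y)) ->
  exists t, ~ I t /\ forall y, m y -> I (t * y).
Proof.
move=> zd.
pose J ts y := exists c, idl ts c /\ I (y - c).
have Ji ts : ideal (J ts).
  have ti := idl_ideal ts; split.
    by exists 0; rewrite subrr; split; [case: ti|case: Ii].
  move=> a x y [c [tc xc]] [c' [tc' yc']]; exists (a * c + c').
  have -> : a * x + y - (a * c + c') = a * (x - c) + (y - c') by ring.
  by split; [case: ti => _; apply|case: Ii => _; apply].
(* Finitely many primes suffice: every t with [max_colon t] lies in I + (ts) for a maximal such
   ideal, so an e killing ts modulo I also kills t. Hence some (I : q) with q in ts lies in (I : t),
   and equals it. *)
have [||_ [[ts [tm ->]] tmax]] := noeth_max R_noeth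
  (P := fun K => exists ts : seq R, (forall s, s \in ts ->
    max_colon s) /\ K = J ts).
- by move=> _ [ts [_ ->]].
- by exists (J [::]), [::].
have tJ t : max_colon t -> J ts t.
  move=> mt; apply: (tmax (J (t :: ts))).
  - exists (t :: ts); split=> // s.
    by rewrite in_cons => /predU1P[->|/tm].
  - by move=> x [c [tc xc]]; exists c; split=> //; apply: idl_tail.
  by exists t; rewrite subrr; split; [apply/idl_mem/mem_head|case: Ii].
have cover y : m y -> exists q, q \in ts /\ colon q y.
  move=> /zd[s [Is sy]]; have [t [mt st]] := max_colon_ex Is.
  apply: contrapT => nq.
  have [|e [et te]] := @max_colon_prod t ts mt.
    move=> q qt; apply: contrapT => nqt; apply: nq; exists q; split=> //.
    have [_ qmax] := tm _ qt; apply: (qmax t); [by case: mt| |exact: st].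
    by move=> z qz; apply: contrapT => tz; apply: nqt; exists z.
  apply: te; have [c [tc Itc]] := tJ _ mt.
  rewrite /colon -(subrK c t) mulrDl; apply: idealD => //.
    by rewrite mulrC; apply: idealM.
  apply: (@idl_min _ ts (fun c => I (c * e))) => //.
  have [I0 Il] := Ii; split=> [|a x z]; first by rewrite mul0r.
  by rewrite mulrDl -mulrA; apply: Il.
apply: contrapT => nt.
have [//||a [ma at_]] := @prime_avoidance ts.
  move=> s /tm[Is _]; apply: contrapT => h; apply: nt; exists s;
    split=> // y my.
  by apply: contrapT => sy; apply: h; exists y.
by have [q [/at_]] := cover a ma.
Qed.

End Depth.

(** * Koszul resolutions *)

Section KoszulResolution.
Variable R : comNzRingType.

(** The sequence is read from its end: the head is regular modulo the tail, so that extending a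
    sequence is a cons. *)
Fixpoint regular_seq (s : seq R) : Prop :=
  if s is x :: s' then
    regular_seq s' /\ forall y, idl s' (x * y) -> idl s' y
  else True.

(* [Z] generates Ext^(size s)(R / (s), R), which is isomorphic to R / (s). *)
Record koszul_data (s : seq R) := KoszulData {
  kz_res : resolution R;
  kz_g : 'M[R]_(rk kz_res 0, 1);
  kz_h : 'M[R]_(1, rk kz_res 0);
  kz_Z : 'M[R]_(rk kz_res (size s), 1);
  kz_idl : forall u : 'rV_(rk kz_res 0), idl s ((u *m kz_g) 0 0) <->
    rspan u (d kz_res 0);
  kz_hg : kz_h *m kz_g = 1%:M;
  kz_rk : forall i, (size s < i)%N -> rk kz_res i = 0%N;
  kz_ann : forall y, cobound (F := kz_res) (i := size s) (0 : 'M_(0,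
    1)) (y *: kz_Z) -> idl s y;
  kz_gen : forall Y : 'M_(rk kz_res (size s), 1),
    exists y, cobound (F := kz_res) (i := size s) (0 : 'M_(0,
      1)) (Y - y *: kz_Z)
}.

Definition koszul_rk (i : nat) : nat := if i is 0 then 1%N else 0%N.

Lemma koszul_exact0 i p (U : 'M[R]_(p, koszul_rk i.+1)) :
  U *m (0 : 'M_(koszul_rk i.+1, koszul_rk i)) = 0 ->
  rspan U (0 : 'M_(koszul_rk i.+2, koszul_rk i.+1)).
Proof. by rewrite [U]thinmx0 => _; apply: rspan0. Qed.

Definition koszul_nil : resolution R := @Resolution R koszul_rk (fun=> 0)
  koszul_exact0 (fun=> mulmx0 _ _).

Lemma koszul_data_nil : koszul_data [::].
Proof.
apply: (@KoszulData [::] koszul_nil 1%:M 1%:M 1%:M) => /=.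
- move=> u; rewrite mulmx1; split=> [u0|/rspan_zero->]; last by rewrite mxE.
  by apply/rspan_zero; rewrite [u]mx11_scalar u0 raddf0.
- by rewrite mulmx1.
- by case.
- move=> y /rspan_zero /matrixP/(_ 0 0).
  by rewrite !mxE eqxx mulr1.
- move=> Y; exists (Y 0 0); apply/rspan_zero.
  by rewrite scalemx1 -mx11_scalar subrr.
Qed.

(** With r = [size s], Ext^(r+1)(R / (x, s), R) is the cokernel of x on Ext^r(R / (s), R), because F
    has rank 0 beyond r. The connecting map takes Z to [col_mx 0 Z]. *)
Lemma koszul_data_cons x s : koszul_data s ->
  (forall y, idl s (x * y) -> idl s y) -> koszul_data (x :: s).
Proof.
move=> K xs; case: K => F g h Z gE hg Fr ann gen.
have xF : regular_on x (d F 0).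
  move=> u; rewrite -!gE -scalemxAl mxE; exact: xs.
apply: (@KoszulData (x :: s) (cone_scalar xF) g h (col_mx 0 Z)) => //.
- move=> u; rewrite [d _ 0]/(col_mx (d F 0) x%:M) rspan_col_mx_r; split.
    move=> [a ha]; exists (a *: h); apply/gE.
    suff -> : ((u - (a *: h) *m x%:M) *m g) 0 0 = (u *m g) 0 0 - a * x by [].
    rewrite mulmxBl mul_mx_scalar scalerA -scalemxAl hg scalemx1 !mxE eqxx
      mulr1n.
    by rewrite (mulrC x a).
  move=> [W /gE]; rewrite mul_mx_scalar mulmxBl -scalemxAl => hW.
  exists ((W *m g) 0 0); move: (u *m g) (W *m g) hW => U V.
  by rewrite !mxE mulrC.
- move=> [//|i] /=; rewrite ltnS => si.
  by rewrite /cone_rk (Fr i) // (Fr i.+1) // ltnW.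
- move=> y; rewrite scale_col_mx scaler0 => /cone_cobound[Y [_ h1]].
  have [y' h2] := gen Y.
  exists y'; apply: ann.
  rewrite scalerBl; move: h1; rewrite mul_scalar_mx => h1.
  have := coboundD h1 (coboundM x h2).
  by rewrite scalerBr addrA subrK scalerA mulrC.
move=> Y; have [y hy] := gen (dsubmx Y); exists y.
rewrite -[Y]vsubmxK scale_col_mx scaler0 opp_col_mx add_col_mx.
apply/cone_cobound; exists 0; rewrite !mulmx0 !subr0; split=> //.
by apply/rspan_zero; move: (usubmx Y); rewrite Fr // => U; rewrite flatmx0.
Qed.

Lemma koszul_exists s : regular_seq s -> koszul_data s.
Proof.
elim: s => [|x s IH] /=; first by move=> _; apply: koszul_data_nil.
by move=> [/IH K xs]; apply: koszul_data_cons.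
Qed.

End KoszulResolution.

(** * Vanishing of Ext beyond the length of a maximal regular sequence *)

Section Bass.
Variables (R : comNzRingType) (R_noeth : noeth R) (m : R -> Prop).
Hypotheses (mi : ideal m) (m1 : ~ m 1).
Hypothesis m_unit : forall a, ~ m a -> exists b, b * a = 1.

Lemma jac_of_max x : m x -> jac x.
Proof.
move=> mx b; apply: m_unit => h; apply: m1.
by rewrite -(subrK (x * b) 1); apply: idealD => //; rewrite mulrC;
  apply: idealM.
Qed.

Lemma max_regular_seq : exists s, [/\ regular_seq s, forall x, x \in s -> m x &
  exists t, ~ idl s t /\ forall y, m y -> idl s (t * y)].
Proof.
have [||_ [[s [rs [sm ->]]] smax]] := noeth_max R_noeth
  (P := fun I => exists s, regular_seq s /\ (forall x, x \in s ->
    m x) /\ I = idl s).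
- by move=> _ [s [_ [_ ->]]]; apply: idl_ideal.
- by exists (idl [::]), [::].
exists s; split=> //; apply: (zero_divisors_annihilated R_noeth mi (idl_ideal
  s)).
move=> y my; apply: contrapT => ny.
have rys : regular_seq (y :: s).
  split=> // z yz; apply: contrapT => sz; apply: ny; exists z.
  by rewrite mulrC.
(* Since y prolongs s, maximality of (s) puts y in (s). Regularity of y modulo (s) then puts 1 in
   (s), which lies in m. *)
have sy : idl s y.
  apply: (smax (idl (y :: s))); last by apply/idl_mem/mem_head.
    exists (y :: s); split=> //; split=> // x.
    by rewrite in_cons => /predU1P[->|/sm].
  exact: idl_tail.
apply: m1; apply: (idl_min mi sm); apply: (proj2 rys).
by rewrite mulr1.
Qed.

Lemma colon_matrix p (J : 'M[R]_(p, 1)) x : exists p' (J' : 'M[R]_(p', 1)),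
  forall k (u : 'M_(k, 1)), rspan (x *: u) J <-> rspan u J'.
Proof.
have [||p' [J' JE]] := R_noeth (S := fun u : 'rV_1 => rspan (x *: u) J).
- by rewrite scaler0; apply: rspan0.
- move=> a u v xu xv; rewrite scalerDr scalerA mulrC -scalerA.
  by apply: rspanD => //; apply: rspanZ.
exists p', J' => k u; split=> h; apply: rspan_rows => i.
  by apply/JE; rewrite -linearZ; apply: rspan_row.
by rewrite linearZ; apply/JE/rspan_row.
Qed.

Local Notation ext i J := (extv (mkres R_noeth J) i (0 : 'M[R]_(0, 1))).

Lemma rspan11 p (J : 'M[R]_(p, 1)) k (u : 'M_(k, 1)) :
  rspan u J <-> forall i, rspan ((u i 0)%:M : 'M_1) J.
Proof.
have rE i : row i u = (u i 0)%:M by rewrite [row i u]mx11_scalar mxE.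
split=> [h i|h]; first by rewrite -rE; apply: rspan_row.
by apply: rspan_rows => i; rewrite rE.
Qed.

Lemma extv_presentation (F : resolution R) p (J : 'M[R]_(p, 1))
    (g : 'M[R]_(rk F 0, 1)) (h : 'M[R]_(1, rk F 0)) i q r (T : 'M[R]_(q, r)) :
  (forall u : 'rV_(rk F 0), rspan (u *m g) J <-> rspan u (d F 0)) ->
  h *m g = 1%:M ->
  extv F i T <-> extv (mkres R_noeth J) i T.
Proof.
move=> gE hg.
have gP : rspan (d F 0 *m g) J.
  apply: rspan_rows => j; rewrite row_mul; apply/gE/rspan_row/rspan_refl.
have hP : rspan (J *m h) (d F 0).
  apply: rspan_rows => j; apply/gE; rewrite row_mul -mulmxA hg mulmx1.
  exact/rspan_row/rspan_refl.
have gh : rspan (g *m h - 1%:M) (d F 0).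
  apply: rspan_rows => j; apply/gE; rewrite -row_mul mulmxBl -mulmxA hg.
  by rewrite mulmx1 mul1mx subrr row0; apply: rspan0.
split; first apply: (@extv_iso _ (mkres R_noeth J) F h g) => //.
  by rewrite hg subrr; apply: rspan0.
exact: (@extv_iso _ F (mkres R_noeth J) g h).
Qed.

Lemma ext_unit i p (J : 'M[R]_(p, 1)) : rspan (1%:M : 'M_1) J -> ext i J.
Proof.
move=> J1.
have J1' : rspan (0 - (1%:M : 'M[R]_1)) J by rewrite sub0r; apply: rspanN.
(* This shift has rank 0 in every degree and resolves the zero module. *)
have := @extv_iso R (mkres R_noeth J) (shift 1 (koszul_nil R)) 0 0 i _ _ 0.
apply; rewrite ?mulmx0; [exact: rspan0|exact: rspan0|exact: J1'|].
by apply: extv_rank0; rewrite /= addn1.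
Qed.

(** Let J be a maximal counterexample and x in m outside J. If (J : x) = J, then x is regular on R /
    J and Nakayama uses degree e + 1. Otherwise R / J lies between R / (J : x) and R / (J, x), both
    settled by maximality. If no such x exists, J = m, and R / m embeds by t into R / (s), whose
    Ext^e vanishes for reasons of length. *)
Lemma bass_step s (K : koszul_data s) t e : (forall x, x \in s -> m x) ->
  ~ idl s t -> (forall y, m y -> idl s (t * y)) -> (size s < e)%N ->
  (forall p (J : 'M[R]_(p, 1)), ext e.+1 J) ->
  forall p (J : 'M[R]_(p, 1)), ext e J.
Proof.
move=> sm st tm se He p0 J0; apply: contrapT => nJ0.
pose idm p (J : 'M[R]_(p, 1)) y := rspan (y%:M : 'M_1) J.
have idmi p (J : 'M[R]_(p, 1)) : ideal (idm p J).
  split=> [|a x y hx hy]; rewrite /idm; first by rewrite raddf0; apply: rspan0.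
  by rewrite raddfD /= -scale_scalar_mx; apply: rspanD => //; apply: rspanZ.
have [||_ [[p [J [-> nJ]]] Jmax]] := noeth_max R_noeth
  (P := fun I => exists p (J : 'M[R]_(p, 1)), I = idm p J /\ ~ ext e J).
- by move=> _ [p [J [-> _]]].
- by exists (idm p0 J0), p0, J0.
have {}Jmax q (J' : 'M_(q, 1)) : (forall y, idm p J y -> idm q J' y) ->
    ~ (forall y, idm q J' y -> idm p J y) -> ext e J'.
  move=> h h'; apply: contrapT => nJ'; apply: h'; apply: Jmax => //.
  by exists q, J'.
have J1 : ~ idm p J 1 by move=> J1; apply: nJ; apply: ext_unit.
have [e' ee] : exists e', e = e'.+1 by case: e se {He nJ0 nJ Jmax} => // e';
  exists e'.
have [[x [mx nx]]|mJ] := pselect (exists x, m x /\ ~ idm p J x).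
  have [q [J' J'E]] := colon_matrix J x.
  have a0P : rspan (d (mkres R_noeth J') 0 *m x%:M) (d (mkres R_noeth J) 0).
    by rewrite mul_mx_scalar; apply/J'E/rspan_refl.
  have a0i k (U : 'M_(k, 1)) : rspan (U *m x%:M) J -> rspan U J'.
    by rewrite mul_mx_scalar => /J'E.
  pose H := cone (F := mkres R_noeth J) (G :=
    mkres R_noeth J') (chain_mapE a0P) a0i.
  have HJ : ext e (col_mx J x%:M).
    apply: Jmax => [y hy|h]; first by apply/rspan_col_mx_r; exists 0;
      rewrite mul0mx subr0.
    apply: nx; apply: h; apply/rspan_col_mx_r; exists 1%:M.
    by rewrite mul1mx subrr; apply: rspan0.
  have [J'J|nJ'J] := pselect (forall y, idm q J' y -> idm p J y).
    have xJ : regular_on x (d (mkres R_noeth J) 0).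
      move=> u /J'E/rspan11 h; apply/(rspan11 J) => i; exact: (J'J _ (h i)).
    apply: nJ; apply: (@cone_scalar_nakayama _ _ _ xJ) (jac_of_max mx) _ => //.
    apply/(@extv_presentation (cone_scalar xJ) _ (col_mx J x%:M) 1%:M 1%:M) =>
      //.
      by move=> u; rewrite mulmx1.
    by rewrite mulmx1.
  have eJ' : ext e J'.
    apply: Jmax => // y; rewrite /idm => hy; apply/J'E.
    exact: rspanZ.
  apply: nJ; rewrite ee; apply: (@extv_cone_mid _ _ _ _ (chain_mapE a0P) a0i);
    rewrite -ee //.
  apply/(@extv_presentation H _ (col_mx J x%:M) 1%:M 1%:M) => //.
    by move=> u; rewrite mulmx1.
  by rewrite mulmx1.
have {}mJ y : m y <-> idm p J y.
  split=> [my|Jy]; first by apply: contrapT => h; apply: mJ; exists y.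
  apply: contrapT => /m_unit[b by1]; apply: J1.
  by rewrite -by1; apply: idealM.
have [q [S SE]] := idl_rspan s.
have eS : ext e S.
  apply/(extv_presentation _ _ _ (F := kz_res K) (g := kz_g K) (h := kz_h K)).
  - by move=> u; rewrite -kz_idl SE -mx11_scalar.
  - exact: kz_hg.
  by apply: extv_rank0; apply: kz_rk.
have a0P : rspan (d (mkres R_noeth J) 0 *m t%:M) (d (mkres R_noeth S) 0).
  rewrite mul_mx_scalar; apply/rspan11 => i; apply/SE; rewrite mxE.
  apply: tm; apply/mJ; rewrite /idm.
  by move: i; apply/rspan11/rspan_refl.
have a0i k (U : 'M_(k, 1)) : rspan (U *m t%:M) S -> rspan U J.
  rewrite mul_mx_scalar !rspan11 => h i; apply/mJ;
    apply: contrapT => /m_unit[b bU].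
  apply: st; rewrite -[t]mulr1 -bU mulrCA; apply: idealM;
    first exact: idl_ideal.
  by apply/SE; move: (h i); rewrite mxE.
pose H := cone (F := mkres R_noeth S) (G :=
  mkres R_noeth J) (chain_mapE a0P) a0i.
apply: nJ; apply: (@extv_cone_sub _ _ _ _ (chain_mapE a0P) a0i _ _ _ _ eS).
apply/(@extv_presentation H _ (col_mx S t%:M) 1%:M 1%:M) => //.
  by move=> u; rewrite mulmx1.
by rewrite mulmx1.
Qed.

Lemma bass s (K : koszul_data s) t n : (forall x, x \in s -> m x) ->
  ~ idl s t -> (forall y, m y -> idl s (t * y)) -> free_ext_bound R n ->
  forall e p (J : 'M[R]_(p, 1)), (size s < e)%N -> ext e J.
Proof.
move=> sm st tm Rn.
suff h k e : (n <= e + k)%N -> forall p (J : 'M[R]_(p, 1)), (size s < e)%N ->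
  ext e J.
  by move=> e; apply: (h n); apply: leq_addl.
elim: k e => [|k IH] e.
  rewrite addn0 leq_eqVlt => /orP[/eqP ne p J se|ne p J _]; last exact: Rn.
  apply: (bass_step K sm st tm se) => q J'; apply: Rn; rewrite ne //.
move=> nek p J se; apply: (bass_step K sm st tm se) => q J'; apply: IH.
  by rewrite addSnnS.
exact: ltnW.
Qed.

Lemma nilpotent_mod_regular s (K : koszul_data s) t n y :
  (forall x, x \in s -> m x) ->
  ~ idl s t -> (forall y, m y -> idl s (t * y)) -> free_ext_bound R n ->
  m y -> exists c, idl s (y ^+ c).
Proof.
move=> sm st tm Rn my; have si := idl_ideal s.
(* Beyond N the ideals (s : y^k) are constant. For z = y^(N+1) this gives (s : z z) = (s : z), that
   is, z is regular modulo (s : z). *)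
have [||N hN] := chain_stable R_noeth (I := fun k => colon (idl s) (y ^+ k)).
- by move=> k; apply: colon_ideal.
- by move=> k x h; rewrite /colon exprS -mulrA; apply: idealM.
exists N.+1; pose z := y ^+ N.+1; rewrite -/z.
have mz : m z by rewrite /z exprS mulrC; apply: idealM.
have zz x : idl s (z * (z * x)) -> idl s (z * x).
  rewrite mulrA /z -exprD => /hN h.
  by rewrite exprS -mulrA; apply: idealM.
have [q [S SE]] := idl_rspan s.
have [p [J JE]] := colon_matrix S z.
have zJ : regular_on z (d (mkres R_noeth J) 0).
  move=> u /JE/rspan11 h; apply/JE/rspan11 => i; rewrite mxE; apply/SE/zz/SE.
  by move: (h i); rewrite !mxE.
(* [bass] applies to (J, z) in degree [size s] + 1, and Nakayama lowers the degree by one. *)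
have vJ : ext (size s) J.
  apply: (@cone_scalar_nakayama _ _ _ zJ) (jac_of_max mz) _ => //.
  apply/(@extv_presentation (cone_scalar zJ) _ (col_mx J z%:M) 1%:M 1%:M).
  - by move=> u; rewrite mulmx1.
  - by rewrite mulmx1.
  exact: (bass K sm st tm Rn).
apply: (@kz_ann _ _ K).
have gE (u : 'rV_(rk (kz_res K) 0)) :
    rspan (u *m kz_g K) S <-> rspan u (d (kz_res K) 0).
  by rewrite -kz_idl SE -mx11_scalar.
(* Multiplication by z on R / (s) is the projection to R / J followed by the map z from R / J to R /
   (s). *)
apply: (@comparison _ (kz_res K) (mkres R_noeth J) (kz_g K) (z *: kz_h K) z _ _
  _
         _ _ _ _ _ vJ).
- apply: rspan_rows => j; rewrite row_mul; apply/JE/rspanZ/gE.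
  exact/rspan_row/rspan_refl.
- apply: rspan_rows => j; apply/gE; rewrite row_mul -mulmxA -scalemxAl kz_hg.
  rewrite scalemx1 mul_mx_scalar; apply/JE/rspan_row/rspan_refl.
- rewrite -scalemxAr -scalemx1 -scalerBr; apply: rspanZ.
  apply: rspan_rows => j; apply/gE; rewrite -row_mul mulmxBl -mulmxA kz_hg.
  by rewrite mulmx1 mul1mx subrr row0; apply: rspan0.
apply/rspan_zero; move: (d _ _); rewrite (kz_rk K (leqnn _)) => M.
by rewrite [M]flatmx0 mul0mx.
Qed.

End Bass.

Section ParameterSequence.
Variable R : comNzRingType.

(** The inclusion of m^K in I, tested on products so that no power of an ideal has to be formed. *)
Definition prods_in (m : R -> Prop) K (I : R -> Prop) : Prop :=
  forall t : seq R, (K <= size t)%N -> (forall y, y \in t -> m y) ->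
  I (\prod_(y <- t) y).

Lemma prods_in_nilpotent (I : R -> Prop) gs c : ideal I ->
  (forall g, g \in gs -> I (g ^+ c)) ->
  prods_in (idl gs) (size gs * c).+1 I.
Proof.
move=> Ii; elim: gs => [|g gs IH] h.
  move=> [//|y t] _ ty; rewrite big_cons (ty y (mem_head _ _)) mul0r.
  by case: Ii.
have {}IH := IH (fun g' gg => h g' (mem_behead (s := g :: gs) gg)).
have gc := h g (mem_head _ _).
(* [t] holds the factors still to be split, [t'] the parts already found in the ideal of [gs], and
   [j] counts the factors g split off. In the end j reaches c or [t'] is long enough for the
   induction hypothesis. *)
have key n t t' j : size t = n -> ((size gs * c).+1 + c <= size t' + n + j)%N ->
    (forall y, y \in t -> idl (g :: gs) y) -> (forall y, y \in t' ->
      idl gs y) ->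
    I (g ^+ j * (\prod_(y <- t') y * \prod_(y <- t) y)).
  elim: n t t' j => [|n IHn] t t' j.
    move=> /size0nil -> st _ t'g; rewrite big_nil mulr1.
    have [cj|jc] := leqP c j.
      by rewrite -(subnK cj) exprD mulrAC; apply: idealM.
    apply: idealM => //; apply: IH => //.
    rewrite addn0 in st; rewrite -(leq_add2r c); apply: (leq_trans st).
    by rewrite leq_add2l ltnW.
  case: t => [//|y t] [st] stt' tg t'g; have [a ya] := tg y (mem_head _ _).
  rewrite big_cons -(subrK (a * g) y) mulrDl mulrDr mulrDr.
  have tg' z : z \in t -> idl (g :: gs) z by move=> zt; apply: tg;
    rewrite in_cons zt orbT.
  apply: idealD => //.
    have -> : g ^+ j * (\prod_(z <- t') z * ((y - a * g) * \prod_(z <- t) z)) =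
      g ^+ j * (\prod_(z <- (y - a * g) :: t') z * \prod_(z <- t) z).
      by rewrite big_cons; congr (_ * _); rewrite mulrCA mulrA.
    apply: IHn => // [|z]; first by move: stt' => /=; lia.
    by rewrite in_cons => /predU1P[->|/t'g].
  have -> : g ^+ j * (\prod_(z <- t') z * (a * g * \prod_(z <- t) z)) =
      a * (g ^+ j.+1 * (\prod_(z <- t') z * \prod_(z <- t) z)).
    by rewrite exprS; ring.
  apply: idealM => //; apply: IHn => //.
  by move: stt'; lia.
move=> t st tg; have := key _ t [::] 0%N erefl.
rewrite big_nil mul1r expr0 mul1r; apply=> //.
by move: st => /=; lia.
Qed.

Lemma prods_in_trans (m m' I : R -> Prop) K :
  (forall y, m y -> m' y) -> prods_in m' K I -> prods_in m K I.
Proof. by move=> mm' h t tK tm; apply: h => // y /tm /mm'. Qed.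

Lemma regular_parameters (R_noeth : noeth R) (m : R -> Prop) n : ideal m ->
  ~ m 1 ->
  (forall a, ~ m a -> exists b, b * a = 1) -> free_ext_bound R n ->
  exists s K, [/\ regular_seq s, forall x, x \in s -> m x &
    prods_in m K (idl s)].
Proof.
move=> mi m1 mu Rn.
have [s [rs sm [t [st tm]]]] := max_regular_seq R_noeth mi m1.
have K := koszul_exists rs; have si := idl_ideal s.
have nil y := nilpotent_mod_regular R_noeth mi m1 mu (y := y) K sm st tm Rn.
have [gs gE] := noeth_fg R_noeth mi.
have [c hc] : exists c, forall g, g \in gs -> idl s (g ^+ c).
  have : forall g, g \in gs -> m g by move=> g /idl_mem /gE.
  elim: gs {gE} => [|g gs IH] h; first by exists 0%N.
  have [|c hc] := IH; first by move=> x xs; apply: h; rewrite in_cons xs orbT.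
  have [c' hc'] := nil g (h g (mem_head _ _)); exists (c + c')%N => x.
  rewrite in_cons exprD => /predU1P[->|/hc ?]; first exact: idealM.
  by rewrite mulrC; apply: idealM.
exists s, (size gs * c).+1; split=> //.
by apply: prods_in_trans (prods_in_nilpotent si hc) => y /gE.
Qed.

End ParameterSequence.

(** * Regular sequences on syzygy modules *)

Section RegularSequenceOnSyzygies.
Variable R : comNzRingType.

Definition idlm (s : seq R) p q (U : 'M[R]_(p, q)) : Prop :=
  forall i j, idl s (U i j).

Section Fixed.
Variable s : seq R.

Lemma idlmD p q (U V : 'M_(p, q)) : idlm s U -> idlm s V -> idlm s (U + V).
Proof. by move=> hU hV i j; rewrite mxE; apply: idealD => //;
  apply: idl_ideal. Qed.

Lemma idlmN p q (U : 'M_(p, q)) : idlm s U -> idlm s (- U).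
Proof.
by move=> hU i j; rewrite mxE -mulN1r; apply: idealM => //; apply: idl_ideal.
Qed.

Lemma idlmB p q (U V : 'M_(p, q)) : idlm s U -> idlm s V -> idlm s (U - V).
Proof. by move=> hU hV; apply: idlmD => //; apply: idlmN. Qed.

Lemma idlm_mulr p q r (U : 'M_(p, q)) (V : 'M_(q, r)) :
  idlm s U -> idlm s (U *m V).
Proof.
move=> hU i j; rewrite mxE; apply: ideal_sum => [|k _]; first exact: idl_ideal.
by rewrite mulrC; apply: idealM => //; apply: idl_ideal.
Qed.

Lemma idlm_mull p q r (U : 'M_(p, q)) (V : 'M_(q, r)) :
  idlm s V -> idlm s (U *m V).
Proof. by move=> hV; apply: ideal_mulmx => //; apply: idl_ideal. Qed.

Lemma idlmZ p q a (U : 'M_(p, q)) : idlm s U -> idlm s (a *: U).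
Proof. by move=> hU; rewrite -mul_scalar_mx; apply: idlm_mull. Qed.

Lemma idlm0 p q : idlm s (0 : 'M_(p, q)).
Proof. by move=> i j; rewrite mxE; case: (idl_ideal s). Qed.

Lemma idlm_scale_regular x p q (U : 'M_(p, q)) :
  (forall y, idl s (x * y) -> idl s y) -> idlm s (x *: U) -> idlm s U.
Proof. by move=> xs h i j; apply: xs; move: (h i j); rewrite mxE. Qed.

Lemma idlm_cons x p q (U : 'M_(p, q)) :
  idlm (x :: s) U <-> exists W : 'M_(p, q), idlm s (U - x *: W).
Proof.
split=> [h|[W h] i j]; last by exists (W i j); move: (h i j);
  rewrite !mxE mulrC.
exists (\matrix_(i, j) xget 0 (fun a => idl s (U i j - a * x))) => i j.
by rewrite !mxE mulrC; apply: (xgetPex 0 (h i j)).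
Qed.

End Fixed.

Variable F : resolution R.

(* The analogue for regular sequences of the exactness of [reduction]. *)
Lemma idlm_exact s : regular_seq s -> forall i p (U : 'M_(p, rk F i.+1)),
  (size s <= i)%N -> idlm s (U *m d F i) ->
  exists V, idlm s (U - V *m d F i.+1).
Proof.
elim: s => [|x s IH] /=.
  move=> _ i p U _ h; have [|V ->] := @d_exact _ F i _ U.
    by apply/matrixP => a b; rewrite [RHS]mxE; apply: h.
  by exists V; rewrite subrr; apply: idlm0.
(* Modulo s, U d = x W; applying the next differential gives W d = 0, so W = V d, and U - x V is a
   cycle. Each element of the sequence thus costs one degree, whence [size s <= i]. *)
move=> [rs xs] [//|i] p U si /idlm_cons[W hW].
have [|V hV] := IH rs i _ W si.
  apply: (idlm_scale_regular xs); move: (idlmN (idlm_mulr (d F i) hW)).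
  by rewrite mulmxBl -mulmxA d_d mulmx0 sub0r opprK scalemxAl.
have [||V' hV'] := IH rs i.+1 _ (U - x *: V); first exact: leqW.
  move: (idlmD hW (idlmZ x hV)).
  by rewrite mulmxBl -scalemxAl scalerBr addrA subrK.
exists V'; apply/idlm_cons; exists V.
by rewrite addrAC.
Qed.

Lemma regular_on_coker_mod x s : regular_seq (x :: s) ->
  forall i p (U : 'M_(p, rk F i.+1)) V, (size s <= i)%N ->
  idlm s (x *: U - V *m d F i.+1) -> exists W, idlm s (U - W *m d F i.+1).
Proof.
move=> [rs xs] i p U V si h; apply: (idlm_exact rs) => //.
apply: (idlm_scale_regular xs); move: (idlm_mulr (d F i) h).
by rewrite mulmxBl -mulmxA d_d mulmx0 subr0 scalemxAl.
Qed.

(* [H] resolves M / s M for the module M resolved by [shift c F]; the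
   matrices [g] and [h] identify the two presentations. *)
Lemma koszul_quotient c s : noeth R -> regular_seq s -> (size s <= c)%N ->
  (forall x, x \in s -> jac x) ->
  exists (H : resolution R) (g : 'M_(rk H 0, rk F c)) (h : 'M_(rk F c, rk H 0)),
  [/\ h *m g = 1%:M,
      forall u : 'rV_(rk H 0), rspan u (d H 0) <-> exists w,
        idlm s (u *m g - w *m d F c),
      forall i p q (T : 'M_(p, q)), extv H (i + size s) T ->
        extv (shift c F) i T &
      eventually_extv (shift c F) (d F c) -> eventually_extv H (d H 0)].
Proof.
move=> Rn; elim: s => [|x s IH] rs sc sj.
  exists (shift c F), 1%:M, 1%:M; split=> //; first by rewrite mulmx1.
    move=> u; rewrite mulmx1; split=> -[w].
      by move=> ->; exists w; rewrite subrr; apply: idlm0.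
    move=> hw; exists w; apply/eqP; rewrite -subr_eq0; apply/eqP/matrixP => a b.
    by rewrite [RHS]mxE; apply: hw.
  by move=> i p q T; rewrite addn0.
have [|||H [g [h [hg HE v1 v2]]]] := IH; [exact: (proj1 rs)|exact: ltnW| |].
  by move=> y ys; apply: sj; rewrite in_cons ys orbT.
case: c {IH} sc g h hg HE v1 v2 => [//|c] sc g h hg HE v1 v2.
have xH : regular_on x (d H 0).
  move=> u /HE[w]; rewrite -scalemxAl => hw.
  by apply/HE; apply: (regular_on_coker_mod rs _ hw).
exists (cone_scalar xH), g, h; split=> //.
- move=> u; rewrite [d _ 0]/(col_mx (d H 0) x%:M) rspan_col_mx_r; split.
    move=> [W /HE[w hw]]; exists w; apply/idlm_cons; exists (W *m g).
    by move: hw; rewrite mul_mx_scalar mulmxBl -scalemxAl addrAC.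
  move=> [w /idlm_cons[W hW]]; exists (W *m h); apply/HE; exists w.
  by rewrite mul_mx_scalar mulmxBl -scalemxAl -mulmxA hg mulmx1 addrAC.
- move=> i p q T; rewrite addnS => /cone_scalar_nakayama v; apply: v1;
    apply: v => //.
  exact/sj/mem_head.
move=> /v2[e he]; exists e.+1 => -[//|i] ei.
rewrite [d _ 0]/(col_mx (d H 0) x%:M).
have v j : (e < j)%N -> extv H j (col_mx (d H 0) x%:M).
  by move=> ej; apply: (extv_mod xH); apply: he => //; apply: ltnW.
by apply: extv_cone; apply: v => //; apply: ltnW.
Qed.

End RegularSequenceOnSyzygies.

(** * Flat base change *)

Section BaseChange.
Variables (A B : comNzRingType) (f : {rmorphism A -> B}).

(** The equational criterion for flatness, with the relations collected in a matrix. *)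
Definition flat : Prop := forall a b (M : 'M[A]_(a, b)) (u : 'rV[B]_a),
  u *m map_mx f M = 0 -> exists k (K : 'M[A]_(k, a)) (v : 'rV[B]_k),
    K *m M = 0 /\ u = v *m map_mx f K.

(** Purity of f, tested on finitely presented modules; together with flatness it amounts to faithful
    flatness. *)
Definition faithful : Prop := forall a b (M : 'M[A]_(a, b)) (w : 'rV[A]_b),
  (exists u, u *m map_mx f M = map_mx f w) -> exists u, u *m M = w.

Lemma rspan_map_mx m p q (U : 'M[A]_(m, q)) (T : 'M[A]_(p, q)) :
  rspan U T -> rspan (map_mx f U) (map_mx f T).
Proof. by move=> [W ->]; exists (map_mx f W); rewrite map_mxM. Qed.

End BaseChange.

Section System.
Variables (R : comNzRingType) (n k p q : nat) (P : 'M[R]_(n, k)) (T : 'M[R]_(p,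
  q)).

(* The matrix of (Y, W) |-> P Y - W T. *)
Definition system_mx : 'M[R]_(k * q + n * p, n * q) :=
  col_mx (lin_mx (mulmx P)) (- lin_mx (mulmxr T)).

Lemma mul_system_mx (Y : 'M_(k, q)) (W : 'M_(n, p)) :
  row_mx (mxvec Y) (mxvec W) *m system_mx = mxvec (P *m Y - W *m T).
Proof. by rewrite mul_row_col mulmxN !mul_vec_lin linearB. Qed.

End System.

Lemma map_system_mx (A B : comNzRingType) (f : {rmorphism A -> B}) n k p q
    (P : 'M[A]_(n, k)) (T : 'M[A]_(p, q)) :
  map_mx f (system_mx P T) = system_mx (map_mx f P) (map_mx f T).
Proof.
rewrite map_col_mx map_mxN; congr col_mx; last congr (- _).
  by apply: map_lin_mx => M; rewrite map_mxM.
by apply: map_lin_mx => M; rewrite map_mxM.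
Qed.

Section FlatExt.
Variables (A B : comNzRingType) (f : {rmorphism A -> B}).
Hypothesis f_flat : flat f.

Local Notation "U ^f" := (map_mx f U).

Variable F : resolution A.

Lemma base_change_exact i p (U : 'M[B]_(p, rk F i.+1)) :
  U *m (d F i)^f = 0 -> rspan U (d F i.+1)^f.
Proof.
move=> U0; apply: rspan_rows => j.
have [|k [K [v [K0 ->]]]] := f_flat (u := row j U) (M := d F i).
  by rewrite -row_mul U0 row0.
by have [W ->] := d_exact K0; rewrite map_mxM; apply/rspanM/rspanM/rspan_refl.
Qed.

Lemma base_change_dd i : (d F i.+1)^f *m (d F i)^f = 0.
Proof. by rewrite -map_mxM d_d map_mx0. Qed.

Definition base_change : resolution B :=
  @Resolution B (rk F) (fun i => (d F i)^f) base_change_exact base_change_dd.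

Lemma cobound_base_change i p q (T : 'M[A]_(p, q)) (Z : 'M_(rk F i, q)) :
  cobound T Z -> cobound (F := base_change) T^f Z^f.
Proof.
case: i Z => [|i] Z /=; first exact: rspan_map_mx.
by move=> [Y h]; exists Y^f; rewrite -map_mxM -map_mxB; apply: rspan_map_mx.
Qed.

(** A cocycle is the first half of a solution (Z, W) of the linear system d Z = W T over A. By
    flatness it is a combination over B of cocycles over A. *)
Lemma extv_base_change i p q (T : 'M[A]_(p, q)) :
  extv F i T -> extv base_change i T^f.
Proof.
move=> v Z [W ZW].
have [|k [K [w [K0 ZE]]]] := f_flat (M := system_mx (d F i) T)
    (u := row_mx (mxvec Z) (mxvec W)).
  by rewrite map_system_mx mul_system_mx ZW subrr linear0.
pose ZK j := vec_mx (lsubmx (row j K)) : 'M_(rk F i, q).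
have ZKb j : cobound T (ZK j).
  apply: v; exists (vec_mx (rsubmx (row j K))); apply/eqP; rewrite -subr_eq0.
  apply/eqP/(can_inj mxvecK); rewrite -mul_system_mx !vec_mxK hsubmxK.
  by rewrite -row_mul K0 row0 linear0.
have -> : Z = \sum_j w 0 j *: (ZK j)^f.
  apply: (can_inj mxvecK); rewrite linear_sum.
  have := congr1 lsubmx ZE; rewrite row_mxKl => ->.
  rewrite mulmx_sum_row linear_sum; apply: eq_bigr => j _.
  by rewrite !linearZ /= -map_mxvec vec_mxK map_lsubmx map_row.
apply: (big_ind (fun Y => cobound (F := base_change) T^f Y)) => [||j _].
- exact/cobound_rspan/rspan0.
- by move=> *; apply: coboundD.
by apply: coboundM; apply: cobound_base_change.
Qed.

Lemma splits_base_change i : splits F i -> splits base_change i.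
Proof.
move=> /splits_cobound /cobound_base_change h; apply/splits_cobound.
by rewrite -(map_mx1 f).
Qed.

(** Being a coboundary is the solvability of a linear system with coefficients in A. *)
Lemma extv_descent i p q (T : 'M[A]_(p, q)) : faithful f ->
  extv base_change i T^f -> extv F i T.
Proof.
move=> ff v Z Zc; have {v} : cobound (F := base_change) T^f Z^f.
  by apply: v; rewrite -map_mxM; apply: rspan_map_mx.
case: i Z Zc => [|i] Z Zc /= => [[W ZW]|[Y [W ZYW]]].
  (* In degree 0 there is no Y, so the system is taken with no columns in its first matrix. *)
  have [|u] := ff _ _ (system_mx (0 : 'M_(_, 0)) T) (mxvec Z).
    exists (row_mx (mxvec (0 : 'M_(0, q))) (mxvec (- W))).
    rewrite map_system_mx mul_system_mx map_mx0 mul0mx sub0r mulNmx opprK -ZW.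
    by rewrite map_mxvec.
  rewrite -[u]hsubmxK -[lsubmx u]vec_mxK -[rsubmx u]vec_mxK mul_system_mx.
  rewrite mul0mx sub0r => /(can_inj mxvecK) <-.
  by apply/rspanN/rspanM/rspan_refl.
have [|u] := ff _ _ (system_mx (d F i) T) (mxvec Z).
  exists (row_mx (mxvec Y) (mxvec (- W))).
  rewrite map_system_mx mul_system_mx mulNmx opprK -ZYW addrC subrK.
  by rewrite map_mxvec.
rewrite -[u]hsubmxK -[lsubmx u]vec_mxK -[rsubmx u]vec_mxK mul_system_mx.
move=> /(can_inj mxvecK) <-; exists (vec_mx (lsubmx u)).
by rewrite addrAC subrr sub0r; apply/rspanN/rspanM/rspan_refl.
Qed.

End FlatExt.

Lemma selfext_bound_descent (A B : comNzRingType) (f : {rmorphism A -> B}) D :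
  flat f -> faithful f -> selfext_bound B D -> selfext_bound A D.
Proof.
move=> f_flat ff BD F [e h] i Di; apply: (extv_descent (f_flat := f_flat) ff).
apply: (BD (base_change f_flat F)) => //; exists e => j ej.
by apply: extv_base_change; apply: h.
Qed.

(** * Ascent along a dense flat extension *)

Section FiniteLengthDescent.
Variables (A B : comNzRingType) (f : {rmorphism A -> B}) (s : seq A).
Hypotheses (A_noeth : noeth A) (B_noeth : noeth B).
Hypotheses (f_flat : flat f) (f_faithful : faithful f).
Hypotheses (s_regular : regular_seq s) (s_jac : forall x, x \in s -> jac (f x)).
Hypothesis f_dense : forall b, exists a, idl (map f s) (b - f a).

Local Notation "U ^f" := (map_mx f U).

Lemma idl_map t y : idl t y -> idl (map f t) (f y).
Proof.
elim: t y => [|x t IH] y /=; first by move=> ->; rewrite rmorph0.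
by move=> [a /IH]; rewrite rmorphB rmorphM => h; exists (f a).
Qed.

Lemma idl_map_rspan t : exists p (G : 'M[A]_(p, 1)),
  (forall y, idl t y <-> rspan y%:M G) /\
  (forall y, idl (map f t) y <-> rspan y%:M G^f).
Proof.
elim: t => [|x t [p [G [IH IHf]]]].
  exists 0%N, 0; split=> y; rewrite ?map_mx0 rspan_zero; split=> [->|].
  - by rewrite raddf0.
  - by move=> /matrixP /(_ 0 0); rewrite !mxE.
  - by rewrite raddf0.
  by move=> /matrixP /(_ 0 0); rewrite !mxE.
exists (p + 1)%N, (col_mx G x%:M); split=> y.
  rewrite rspan_col_mx_r; split.
    by move=> [a] /IH h; exists a%:M; rewrite -scalar_mxM -raddfB.
  by move=> [W]; rewrite [W]mx11_scalar -scalar_mxM -raddfB => /IH h;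
    exists (W 0 0).
rewrite map_col_mx map_scalar_mx rspan_col_mx_r; split.
  by move=> [a] /IHf h; exists a%:M; rewrite -scalar_mxM -raddfB.
by move=> [W]; rewrite [W]mx11_scalar -scalar_mxM -raddfB => /IHf h;
  exists (W 0 0).
Qed.

Lemma regular_seq_map t : regular_seq t -> regular_seq (map f t).
Proof.
elim: t => [//|x t IH] /= [/IH rt xt]; split=> // b.
have [p [G [GE GfE]]] := idl_map_rspan t; rewrite !GfE => -[w e].
have [|k [K [v [K0 vE]]]] := f_flat (M := col_mx x%:M G) (u :=
  row_mx b%:M (- w)).
  by rewrite map_col_mx map_scalar_mx mul_row_col -scalar_mxM mulrC e mulNmx
    subrr.
have := congr1 lsubmx vE; rewrite row_mxKl => ->.
rewrite -mulmx_lsub -map_lsubmx; apply/rspanM/rspan_map_mx.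
apply: rspan_rows => j; rewrite [row j _]mx11_scalar; apply/GE/xt/GE.
exists (- row j (rsubmx K)); rewrite mulNmx -row_mul scalar_mxM -mx11_scalar.
move: (congr1 (row j) K0); rewrite -[K]hsubmxK mul_row_col.
rewrite row_mxKl row_mxKr linearD /= row0 => /eqP; rewrite addr_eq0 => /eqP <-.
by rewrite row_mul mul_mx_scalar mul_scalar_mx.
Qed.

(* Over [B] the Koszul quotient K / s K of a syzygy module K is the base change
   of a module over [A]: a presentation of it modulo [s] lifts to [A]. *)
Lemma finite_length_model (F : resolution B) : exists (H : resolution B)
    (G : resolution A) (g : 'M_(rk H 0, rk G 0)) (h : 'M_(rk G 0, rk H 0)),
  [/\ rspan (d H 0 *m g) (d G 0)^f /\ rspan ((d G 0)^f *m h) (d H 0),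
      h *m g = 1%:M /\ rspan (g *m h - 1%:M) (d H 0),
      forall i p q (T : 'M_(p, q)),
        extv H (i + size s) T -> extv (shift (size s) F) i T &
      eventually_extv (shift (size s) F) (d F (size s)) ->
      eventually_extv H (d H 0)].
Proof.
set c := size s; set n := rk F c.
have [||H [g [h [hg HE v1 v2]]]] :=
    @koszul_quotient _ F c (map f s) B_noeth (regular_seq_map s_regular).
- by rewrite size_map.
- by move=> _ /mapP[x xs ->]; apply: s_jac.
rewrite size_map in v1.
pose D : 'M[A]_(rk F c.+1, n) :=
  \matrix_(i, j) xget 0 (fun a => idl (map f s) (d F c i j - f a)).
have DE : idlm (map f s) (d F c - D^f).
  by move=> i j; rewrite !mxE; apply: (xgetPex 0 (f_dense (d F c i j))).
(* [D] agrees with [d F c] modulo s, so S, generated over A by the rows of D and by s times the free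
   module, generates over B the relations of K / s K. *)
pose S (v : 'rV[A]_n) := exists w, idlm s (v - w *m D).
have [||p [Psi PsiE]] := A_noeth (S := S).
- by exists 0; rewrite mul0mx subr0; apply: idlm0.
- move=> a u v [w hu] [w' hv]; exists (a *: w + w').
  rewrite mulmxDl -scalemxAl opprD addrACA -scalerBr.
  by apply: idlmD => //; apply: idlmZ.
have SfE (v : 'rV[B]_n) :
    rspan v Psi^f <-> exists w, idlm (map f s) (v - w *m d F c).
  split=> [[w ->]|[w hw]].
    have hrow j : exists w, idlm s (row j Psi - w *m D).
      by apply/PsiE/rspan_row/rspan_refl.
    have [W hW] := choice hrow.
    exists (w *m (\matrix_j W j)^f *m 1%:M); rewrite mulmx1 -mulmxA -mulmxBr.
    apply: idlm_mull.
    have -> : Psi^f - (\matrix_j W j)^f *m d F c =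
        (Psi - (\matrix_j W j) *m D)^f - (\matrix_j W j)^f *m (d F c - D^f).
      by rewrite mulmxBr map_mxB map_mxM opprB addrA subrK.
    apply: idlmB; last exact: idlm_mull.
    move=> a b; rewrite mxE; apply: idl_map.
    have := hW a 0 b; congr (idl s _).
    suff -> : row a Psi - W a *m D = row a (Psi - (\matrix_j W j) *m D) by
      rewrite mxE.
    by rewrite linearB /= row_mul rowK.
  have hw' : idlm (map f s) (v - w *m D^f).
    have -> : v - w *m D^f = (v - w *m d F c) + w *m (d F c - D^f).
      by rewrite mulmxBr addrA subrK.
    by apply: idlmD => //; apply: idlm_mull.
  rewrite -(subrK (w *m D^f) v); apply: rspanD; last first.
    apply/rspanM/rspan_map_mx; apply: rspan_rows => j; apply/PsiE.
    by exists (delta_mx 0 j); rewrite -rowE subrr; apply: idlm0.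
  rewrite [_ - _]row_sum_delta; apply: rspan_sum => j _.
  have := hw' 0 j; apply: (idl_min (I := fun b =>
    rspan (b *: delta_mx 0 j) Psi^f)).
    split=> [|a x y hx hy]; first by rewrite scale0r; apply: rspan0.
    by rewrite scalerDl -scalerA; apply: rspanD => //; apply: rspanZ.
  move=> _ /mapP[x xs ->]; rewrite -(map_delta_mx f) -map_mxZ.
  apply/rspan_map_mx/PsiE; exists 0; rewrite mul0mx subr0 => a b.
  by rewrite mxE mulrC; apply: idealM; [exact: idl_ideal|exact: idl_mem].
exists H, (mkres A_noeth Psi), g, h; split=> //; split.
- by apply: rspan_rows => j; apply/SfE; rewrite row_mul;
    apply/HE/rspan_row/rspan_refl.
- apply: rspan_rows => j; apply/HE; rewrite row_mul -mulmxA hg mulmx1.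
  by apply/SfE/rspan_row/rspan_refl.
- by [].
apply: rspan_rows => j; apply/HE; exists 0.
rewrite mul0mx subr0 -row_mul mulmxBl -mulmxA hg mulmx1 mul1mx subrr row0.
exact: idlm0.
Qed.

Lemma extv_target (R : comNzRingType) (F : resolution R) i p q (T : 'M[R]_(p,
  q))
    p' q' (T' : 'M[R]_(p', q')) (g : 'M_(q, q')) h :
  rspan (T *m g) T' -> rspan (T' *m h) T -> h *m g = 1%:M ->
  extv F i T -> extv F i T'.
Proof.
move=> Tg T'h hg v Z Zc; have {v} : cobound T (Z *m h).
  by apply: v; rewrite mulmxA; apply: rspan_trans T'h; apply: rspan_mulr.
case: i Z Zc => [|i] Z Zc /=.
  by move=> /(rspan_mulr g) /rspan_trans /(_ Tg); rewrite -mulmxA hg mulmx1.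
move=> [Y hY]; exists (Y *m g).
by move: (rspan_trans (rspan_mulr g hY) Tg); rewrite mulmxBl -!mulmxA hg mulmx1.
Qed.

(** Passing to the syzygy lowers the degree by [size s] and the Koszul quotient raises it again;
    [size s] enters the bound to keep the degree of the syzygy positive. *)
Lemma free_ext_bound_completion n :
  free_ext_bound A n -> free_ext_bound B (n + size s).
Proof.
move=> An F i q; have [H [G [g [h [[Hg Gh] [_ gh] v1 _]]]]] :=
  finite_length_model F.
move=> ni; have si : (size s <= i)%N by apply: leq_trans (ltnW ni);
  apply: leq_addl.
rewrite -(subnK si); apply/extv_shift;
  first by rewrite subn_gt0 (leq_ltn_trans _ ni) ?leq_addl.
apply: v1; rewrite subnK //;
  apply: (@extv_iso _ H (base_change f_flat G) g h) => //.
rewrite -(map_mx0 f); apply: extv_base_change; apply: An.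
by apply: leq_ltn_trans ni; apply: leq_addr.
Qed.

Lemma pd_bound_completion n D :
  free_ext_bound A n -> pd_bound A D -> pd_bound B (D + size s).
Proof.
move=> An AD F F0 i Di.
have [H [G [g [h [[Hg Gh] [hg gh] v1 v2]]]]] := finite_length_model F.
have [e HH] : eventually_extv H (d H 0).
  apply: v2; have [e he] := eventually_extv_syzygy (size s)
    (free_ext_bound_completion An) F0.
  exists e => j ej; apply/extv_shift; first by apply: leq_ltn_trans ej.
  exact/he/ltn_addr.
(* H and the base change of G resolve the same module, so both arguments of Ext are exchanged:
   [extv_iso] treats the first, [extv_target] the second. *)
have GG : eventually_extv G (d G 0).
  exists e => j ej; apply: (extv_descent (f_flat := f_flat) f_faithful).
  apply: (extv_target Hg Gh hg).
  apply: (@extv_iso _ (base_change f_flat G) H h g) => //; last exact: HH.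
  by rewrite hg subrr; apply: rspan0.
have si : (size s <= i)%N by apply: leq_trans (ltnW Di); apply: leq_addl.
rewrite /splits -{1}(subnK si).
apply/extv_shift; first by rewrite subn_gt0 (leq_ltn_trans _ Di) ?leq_addl.
apply: v1; rewrite subnK //;
  apply: (@extv_iso _ H (base_change f_flat G) g h) => //.
apply/splits_extv/splits_base_change/AD => //.
by apply: leq_ltn_trans Di; apply: leq_addr.
Qed.

End FiniteLengthDescent.

(** * Complete rings, power series and polynomials *)

Section CompleteElement.
Variable B : comNzRingType.

(* Completeness: the [x]-adic series [c k + c k.+1 * x + ...] have sums [r k]. *)
Definition adic_complete (x : B) : Prop := forall c : nat -> B,
  exists r : nat -> B, forall k, r k = c k + x * r k.+1.

(** Only elements with a coherent chain of quotients by x are tested, so that x may be a zero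
    divisor. *)
Definition adic_separated (x : B) : Prop := forall y : nat -> B,
  (forall k, y k = x * y k.+1) -> y 0%N = 0.

(** The inverse of 1 - x b is the geometric series, the sum of the b^k x^k. *)
Lemma adic_jac x : adic_complete x -> adic_separated x -> jac x.
Proof.
move=> xc xs b; have [r rE] := xc (fun k => b ^+ k); exists (r 0%N).
apply/eqP; rewrite -subr_eq0; apply/eqP.
apply: (xs (fun k => r k * (1 - x * b) - b ^+ k)) => k.
by rewrite {1}rE exprS; ring.
Qed.

End CompleteElement.

(** * Noetherianity of complete rings *)

Section CompleteNoetherian.
Variables (A B : comNzRingType) (f : {rmorphism A -> B}) (S : seq B).
Hypothesis A_noeth : noeth A.
Hypothesis S_lift : forall b, exists a, idl S (b - f a).
Hypothesis S_complete : forall x, x \in S -> adic_complete x.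
Hypothesis S_separated : forall x, x \in S -> adic_separated x.

Lemma max_not_fg (I : B -> Prop) : ideal I -> ~ fg_ideal I -> exists M : B ->
  Prop,
  [/\ ideal M, ~ fg_ideal M & forall J, ideal J -> (forall y, M y -> J y) ->
     ~ (forall y, J y -> M y) -> fg_ideal J].
Proof.
move=> Ii nI.
pose P (X : classical_sets.set B) := X = classical_sets.set0 \/ ideal (X : B ->
  Prop) /\ ~ fg_ideal (X : B -> Prop).
have [|M [PM Mmax]] := @Zorn_bigcup B P.
  move=> C CP Ctot.
  have [[X [CX X0]]|nX] := pselect (exists X, C X /\ X <> classical_sets.set0);
    last first.
    left; apply/seteqP; split=> // y [X CX Xy].
    case: nX; exists X; split=> // X0; by rewrite X0 in Xy.
  have CI Y y : C Y -> Y y -> ideal Y.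
    by move=> /CP[->//|[]].
  have XI : ideal X by have [|[]] := CP X CX.
  right; split.
    split=> [|a x y [Y CY Yx] [Z CZ Zy]]; first by exists X => //; case: XI.
    have [YZ|ZY] := Ctot _ _ CY CZ.
      by exists Z => //; have [_ h] := CI _ _ CZ Zy; apply: h => //; apply: YZ.
    by exists Y => //; have [_ h] := CI _ _ CY Yx; apply: h => //; apply: ZY.
  move=> [s [sU Us]].
  have [Y [CY YI Ys]] : exists Y, [/\ C Y, ideal Y & forall x, x \in s -> Y x].
    elim: s sU {Us} => [|x s IH] sU; first by exists X.
    have [|Y [CY YI Ys]] := IH; first by move=> y ys; apply: sU;
      rewrite in_cons ys orbT.
    have [Z CZ Zx] := sU x (mem_head _ _).
    have [YZ|ZY] := Ctot _ _ CY CZ.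
      exists Z; split=> // [|y]; first exact: CI Zx.
      by rewrite in_cons => /predU1P[->//|/Ys/YZ].
    by exists Y; split=> // y; rewrite in_cons => /predU1P[->|/Ys//]; apply: ZY.
  have [Y0|[_ nY]] := CP Y CY; first by case: YI; rewrite Y0.
  by apply: nY; exists s; split=> // y Yy; apply: Us; exists Y.
have nI0 : P I by right.
have [M0|[Mi nM]] := PM.
  exfalso; apply: (Mmax I) => //; rewrite M0; split=> // h.
  by have := h 0; case: Ii => I0 _ /(_ I0).
exists M; split=> // J Ji MJ JM; apply: contrapT => nJ; apply: (Mmax J).
  by split.
by right.
Qed.

(* Cohen's argument: for an ideal [M] maximal among those which are not
   finitely generated and [x] outside [M], [M + (x)] is finitely generated
   and [M : x] is either so or equal to [M]; in the latter case generators of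
   [M] modulo [x] generate [M] by completeness. *)
Lemma complete_noeth : noeth B.
Proof.
apply: noeth_of_ideals => I Ii; apply: contrapT => nI.
have [M [Mi nM Mmax]] := max_not_fg Ii nI.
(* If S lies in M, then each b in M is f a modulo (S) with f a in M: S and generators of the
   preimage of M in A generate M. *)
have [[x [xS nx]]|SM] := pselect (exists x, x \in S /\ ~ M x); last first.
  have {}SM x : x \in S -> M x.
    by move=> xS; apply: contrapT => h; apply: SM; exists x.
  have [|s sE] := @noeth_fg A A_noeth (fun a => M (f a)).
    split=> [|a x y]; first by rewrite rmorph0; case: Mi.
    by rewrite rmorphD rmorphM; case: Mi => _; apply.
  apply: nM; exists (map f s ++ S); split=> [y|b Mb].
    rewrite mem_cat => /orP[/mapP[a /idl_mem/sE Ma ->]//|]; exact: SM.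
  have [a hab] := S_lift b.
  have Mfa : M (f a).
    rewrite -(subKr b (f a)); apply: idealB => //.
    exact: (idl_min Mi SM).
  rewrite -(subrK (f a) b); apply: idealD; first exact: idl_ideal.
    by apply: idl_sub hab => y yS; rewrite mem_cat yS orbT.
  have /idl_map : idl s a by apply/sE.
  by move=> /(_ B f); apply: idl_sub => y ys; rewrite mem_cat ys.
pose J y := exists r, M (y - r * x).
have [|||t [tJ Jt]] := Mmax J.
- split=> [|a y z [r hr] [r' hr']]; first by exists 0; rewrite mul0r subr0;
    case: Mi.
  exists (a * r + r').
  have -> : a * y + z - (a * r + r') * x = a * (y - r * x) + (z - r' * x) by
    ring.
  by case: Mi => _; apply.
- by move=> y My; exists 0; rewrite mul0r subr0.
- by move=> /(_ x); apply: (contra_not _ nx) => h; apply: h; exists 1;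
    rewrite mul1r subrr; case: Mi.
have [s [sM Ms]] : exists s, (forall y, y \in s -> M y) /\
    forall y, M y -> exists a, idl s (y - a * x).
  have [r hr] : exists r, forall y, y \in t -> M (y - r y * x).
    exists (fun y => xget 0 (fun r => M (y - r * x))) => y /tJ h.
    exact: (xgetPex 0 h).
  exists [seq y - r y * x | y <- t]; split=> [_ /mapP[y yt ->]|y My];
    first exact: hr.
  have : idl t y by apply: Jt; exists 0; rewrite mul0r subr0.
  apply: (@idl_min _ t (fun y => exists a,
    idl [seq y - r y * x | y <- t] (y - a * x))).
    split=> [|a y1 y2 [b hb] [c hc]].
      by exists 0; rewrite mul0r subr0;
        case: (idl_ideal [seq y - r y * x | y <- t]).
    exists (a * b + c).
    have -> : a * y1 + y2 - (a * b + c) * x = a * (y1 - b * x) + (y2 - c * x) by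
      ring.
    by have [_ h] := idl_ideal [seq y - r y * x | y <- t]; apply: h.
  by move=> z zt; exists (r z); apply/idl_mem/mapP; exists z.
have [QM|nQM] := pselect (forall y, colon M x y -> M y); last first.
  have [|||q [qQ Qq]] := Mmax (colon M x) => //; first exact: colon_ideal.
    by move=> y My; apply: idealM.
  apply: nM; exists (s ++ [seq x * y | y <- q]); split=> [y|y My].
    by rewrite mem_cat => /orP[/sM//|/mapP[z /qQ ? ->]].
  have [a ha] := Ms y My.
  have aQ : colon M x a.
    rewrite /colon mulrC -(subKr y (a * x)); apply: idealB => //.
    exact: (idl_min Mi sM).
  rewrite -(subrK (a * x) y); apply: idealD; first exact: idl_ideal.
    by apply: idl_sub ha => z zs; rewrite mem_cat zs.
  have [_ _] := idl_ideal (s ++ [seq x * y | y <- q]).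
  have := Qq a aQ; rewrite mulrC.
  apply: (idl_min (I := fun a => idl _ (x * a))).
    apply: colon_ideal; exact: idl_ideal.
  by move=> z zq; apply/idl_mem; rewrite mem_cat map_f ?orbT.
apply: nM; exists s; split=> // y0 My0.
have [p [G GE]] := idl_rspan s.
have next (y : {y | M y}) : exists z : {y | M y} * 'rV[B]_p,
    (sval y)%:M = x *: (sval z.1)%:M + z.2 *m G :> 'M_1.
  have [a ha] := Ms _ (svalP y).
  have Ma : M a.
    apply: QM; rewrite /colon mulrC -(subKr (sval y) (a * x)).
    by apply: idealB; [|exact: svalP|exact: (idl_min Mi sM)].
  have [W eW] : rspan (sval y - a * x)%:M G by apply/GE.
  exists (exist _ a Ma, W) => /=.
  by rewrite -eW raddfB /= scale_scalar_mx mulrC addrC subrK.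
have [g gE] := choice next.
pose y k := iter k (fun y => (g y).1) (exist _ y0 My0).
pose w k := (g (y k)).2.
have yE k : (sval (y k))%:M = x *: (sval (y k.+1))%:M + w k *m G := gE (y k).
have [r rE] := choice (fun i => S_complete xS (fun k => w k 0 i)).
pose V k : 'rV_p := \row_i r i k.
have VE k : V k = w k + x *: V k.+1 by apply/rowP => i; rewrite !mxE rE.
apply/GE; exists (V 0%N).
apply/eqP; rewrite -subr_eq0; apply/eqP/matrixP => i j; rewrite !ord1 [RHS]mxE.
apply: (S_separated xS (y := fun k => ((sval (y k))%:M - V k *m G) 0 0)) => k.
rewrite yE VE (addrC (w k)) mulmxDl opprD addrACA subrr addr0 -scalemxAl
  -scalerBr.
by rewrite mxE.
Qed.

End CompleteNoetherian.

Section PowerSeriesRing.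
Variable A : comNzRingType.
Local Notation B := (power_series A).

Definition ps_const (a : A) : B := PowerSeries (fun n =>
  if n is 0 then a else 0).
Definition ps_X : B := PowerSeries (fun n => (n == 1)%:R).

Lemma ps_coef0 n : ps_coef (0 : B) n = 0.
Proof. by []. Qed.

Lemma ps_coefD (g h : B) n : ps_coef (g + h) n = ps_coef g n + ps_coef h n.
Proof. by []. Qed.

Lemma ps_coefN (g : B) n : ps_coef (- g) n = - ps_coef g n.
Proof. by []. Qed.

Lemma ps_coefM (g h : B) n :
  ps_coef (g * h) n = \sum_(i < n.+1) ps_coef g i * ps_coef h (n - i)%N.
Proof. by []. Qed.

Lemma ps_coef_sum (I : Type) (r : seq I) (P : pred I) (g : I -> B) n :
  ps_coef (\sum_(i <- r | P i) g i) n = \sum_(i <- r | P i) ps_coef (g i) n.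
Proof. exact: (big_morph (fun g => ps_coef g n)). Qed.

Lemma ps_coef_constM a g n : ps_coef (ps_const a * g) n = a * ps_coef g n.
Proof.
rewrite ps_coefM big_ord_recl subn0 big1 ?addr0 // => i _.
by rewrite /= mul0r.
Qed.

Lemma ps_coef_XM g n : ps_coef (ps_X * g) n = if n is n'.+1 then ps_coef g n'
  else 0.
Proof.
rewrite ps_coefM; case: n => [|n]; first by rewrite big_ord1 /= mul0r.
rewrite big_ord_recl /= mul0r add0r big_ord_recl /= mul1r subSS subn0.
by rewrite big1 ?addr0 // => i _; rewrite mul0r.
Qed.

Lemma ps_const_zmod : zmod_morphism ps_const.
Proof.
move=> a b; apply: power_series_eq => -[|n] //=.
by rewrite subrr.
Qed.
HB.instance Definition _ :=
  GRing.isZmodMorphism.Build A B ps_const ps_const_zmod.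

Lemma ps_const_monoid : monoid_morphism ps_const.
Proof.
split=> [|a b]; apply: power_series_eq => -[|n] //.
  by rewrite ps_coef_constM.
by rewrite ps_coef_constM /= mulr0.
Qed.
HB.instance Definition _ :=
  GRing.isMonoidMorphism.Build A B ps_const ps_const_monoid.

Definition ps_eval0 (g : B) : A := ps_coef g 0.

Lemma ps_eval0_zmod : zmod_morphism ps_eval0.
Proof. by []. Qed.
HB.instance Definition _ :=
  GRing.isZmodMorphism.Build B A ps_eval0 ps_eval0_zmod.

Lemma ps_eval0_monoid : monoid_morphism ps_eval0.
Proof. by split=> // g h; rewrite /ps_eval0 ps_coefM big_ord1. Qed.
HB.instance Definition _ :=
  GRing.isMonoidMorphism.Build B A ps_eval0 ps_eval0_monoid.

Lemma ps_eval0_surj a : exists g, ps_eval0 g = a.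
Proof. by exists (ps_const a). Qed.

Lemma ps_eval0_X : ps_eval0 ps_X = 0.
Proof. by []. Qed.

Lemma ps_eval0_ker g : ps_eval0 g = 0 -> exists h, g = ps_X * h.
Proof.
move=> g0; exists (PowerSeries (fun n => ps_coef g n.+1)).
by apply: power_series_eq => -[|n]; rewrite ps_coef_XM.
Qed.

Lemma ps_X_regular g : ps_X * g = 0 -> g = 0.
Proof.
move=> Xg; apply: power_series_eq => n.
by have := congr1 (fun h => ps_coef h n.+1) Xg; rewrite ps_coef_XM.
Qed.

Lemma ps_X_complete : adic_complete ps_X.
Proof.
move=> c.
exists (fun k => PowerSeries (fun n =>
  \sum_(j < n.+1) ps_coef (c (j + k)%N) (n - j)%N)).
move=> k; apply: power_series_eq => n; rewrite ps_coefD ps_coef_XM /=.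
case: n => [|n]; first by rewrite big_ord1 addr0.
rewrite big_ord_recl subn0; congr (_ + _); apply: eq_bigr => j _ /=.
by rewrite subSS addSnnS.
Qed.

Lemma ps_X_separated : adic_separated ps_X.
Proof.
move=> y yX; apply: power_series_eq => n; rewrite ps_coef0.
move: 0%N; elim: n => [|n IH] k; first by rewrite yX ps_coef_XM.
by rewrite yX ps_coef_XM IH.
Qed.

Hypothesis A_noeth : noeth A.

Lemma power_series_noeth : noeth B.
Proof.
apply: (@complete_noeth A B ps_const [:: ps_X] A_noeth) => [b|x|x].
- exists (ps_eval0 b); have [|h e] := @ps_eval0_ker (b - ps_const (ps_eval0 b)).
    by rewrite /ps_eval0 ps_coefD ps_coefN subrr.
  by exists h => /=; rewrite e mulrC subrr.
- by rewrite inE => /eqP->; apply: ps_X_complete.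
by rewrite inE => /eqP->; apply: ps_X_separated.
Qed.

Lemma ps_coef_mulmx a b c (u : 'M[B]_(a, b)) (M : 'M[A]_(b, c)) n :
  map_mx (fun g => ps_coef g n) (u *m map_mx ps_const M) =
  map_mx (fun g => ps_coef g n) u *m M.
Proof.
apply/matrixP => i j; rewrite !mxE ps_coef_sum; apply: eq_bigr => k _.
by rewrite !mxE mulrC ps_coef_constM mulrC.
Qed.

(** The matrix has constant entries, so every coefficient of u is a relation over A. All are
    combinations of the same finitely many rows, and their multipliers are the coefficients of power
    series. *)
Lemma power_series_flat : flat ps_const.
Proof.
move=> a b M u uM; have [K [KM KE]] := left_kernel_fg A_noeth M.
exists (tag K), (tagged K).
pose un n : 'rV[A]_a := map_mx (fun g => ps_coef g n) u.
have unK n : rspan (un n) (tagged K).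
  apply: KE; rewrite -ps_coef_mulmx uM; apply/matrixP => i j.
  by rewrite !mxE.
exists (\row_i PowerSeries (fun n => mdiv (un n) (tagged K) 0 i)); split=> //.
apply/rowP => i; apply: power_series_eq => n.
transitivity (un n 0 i); first by rewrite mxE.
rewrite -{1}(mdivK (unK n)); set v := \row_j _.
have -> : mdiv (un n) (tagged K) = map_mx (fun g => ps_coef g n) v.
  by apply/rowP => j; rewrite !mxE.
by rewrite -ps_coef_mulmx [LHS]mxE.
Qed.

Lemma power_series_faithful : faithful ps_const.
Proof.
move=> a b M w [u uM]; exists (map_mx (fun g => ps_coef g 0) u).
rewrite -ps_coef_mulmx uM; apply/matrixP => i j.
by rewrite !mxE.
Qed.

Lemma power_series_jac : jac ps_X.
Proof. by apply: adic_jac; [apply: ps_X_complete|apply: ps_X_separated]. Qed.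

Lemma power_series_pd_bound n D :
  free_ext_bound A n -> pd_bound A D -> pd_bound B D.+1.
Proof.
apply: (@pd_bound_reduction B A ps_eval0 ps_X ps_eval0_surj ps_eval0_X
         ps_eval0_ker ps_X_regular power_series_noeth power_series_jac).
Qed.

End PowerSeriesRing.

(** * Hilbert's basis theorem *)

Section HilbertBasis.
Variables (A : comNzRingType) (A_noeth : noeth A).
Variable J : {poly A} -> Prop.
Hypothesis Ji : ideal J.

Definition lead_ideal (a : A) : Prop :=
  exists n p, [/\ J p, (size p <= n.+1)%N & p`_n = a].

Lemma lead_ideal_shift n k p : J p -> (size p <= n.+1)%N ->
  [/\ J (p * 'X^k), (size (p * 'X^k)%R <= (k + n).+1)%N &
    (p * 'X^k)`_(k + n) = p`_n].
Proof.
move=> Jp sp; split; first by rewrite mulrC; apply: idealM.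
  apply/leq_sizeP => j knj; rewrite coefMXn; case: ltnP => // kj.
  by move/leq_sizeP: sp; apply; lia.
by rewrite coefMXn ltnNge leq_addr addKn.
Qed.

Lemma lead_ideal_ideal : ideal lead_ideal.
Proof.
split=> [|a x y [n [p [Jp sp <-]]] [k [q [Jq sq <-]]]].
  by exists 0%N, 0; rewrite size_poly0 coef0; split=> //; case: Ji.
have [Jp' sp' cp] := lead_ideal_shift k Jp sp.
have [Jq' sq' cq] := lead_ideal_shift n Jq sq.
exists (k + n)%N, (a%:P * (p * 'X^k) + q * 'X^n); split.
- by case: Ji => _; apply.
- rewrite (leq_trans (size_polyD _ _)) // geq_max {2}addnC sq' andbT.
  by rewrite mul_polyC (leq_trans (size_scale_leq _ _)).
by rewrite coefD coefCM cp addnC cq.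
Qed.

Lemma hilbert_fg : fg_ideal J.
Proof.
have [s sE] := noeth_fg A_noeth lead_ideal_ideal.
(* A common N for all generators of the leading ideal. Below degree N, J is a submodule of A^N; from
   N on, multiples of the [g a] remove the leading term. *)
have [N hN] : exists N, forall a, a \in s -> exists p,
    [/\ J p, (size p <= N.+1)%N & p`_N = a].
  have : forall a, a \in s -> lead_ideal a by move=> a /idl_mem /sE.
  elim: s {sE} => [|a s IH] h; first by exists 0%N.
  have [|N hN] := IH; first by move=> x xs; apply: h; rewrite in_cons xs orbT.
  have [n [p [Jp sp pa]]] := h a (mem_head _ _).
  exists (N + n)%N => x; rewrite in_cons => /predU1P[->|/hN[q [Jq sq qx]]].
    by have [? ? e] := lead_ideal_shift N Jp sp; exists (p * 'X^N); rewrite e.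
  by have [? ? e] := lead_ideal_shift n Jq sq; exists (q * 'X^n);
    rewrite addnC e.
pose g a : {poly A} := xget 0 (fun p : {poly A} => [/\ J p, (size p <= N.+1)%N &
  p`_N = a]).
have gP a : a \in s -> [/\ J (g a), (size (g a) <= N.+1)%N & (g a)`_N = a].
  by move=> /hN h; apply: (xgetPex 0 h).
have [||k [G GE]] := A_noeth (S := fun u : 'rV_N => J (rVpoly u)).
- by rewrite linear0; case: Ji.
- move=> a u v Ju Jv; rewrite linearP /= -mul_polyC.
  by case: Ji => _; apply.
pose t : seq {poly A} := [seq g a | a <- s] ++ [seq rVpoly (row i G) | i <- enum
  'I_k].
exists t; split=> [p|].
  rewrite mem_cat => /orP[/mapP[a /gP[Ja _ _] ->]//|/mapP[i _ ->]].
  by apply/GE/rspan_row/rspan_refl.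
have ti := idl_ideal t.
suff h n (p : {poly A}) : (size p <= n)%N -> J p -> idl t p by move=> p;
  apply: h (leqnn _).
elim: n p => [|n IH] p sp Jp.
  by move: sp; rewrite leqn0 size_poly_eq0 => /eqP->; case: ti.
have [nN|Nn] := ltnP n N.
  rewrite -(@poly_rV_K _ N p); last exact: leq_trans sp nN.
  have /GE[w ->] : J (rVpoly (poly_rV p : 'rV_N)).
    by rewrite poly_rV_K // (leq_trans sp nN).
  rewrite mulmx_sum_row linear_sum; apply: ideal_sum => // i _.
  rewrite linearZ /= -mul_polyC; apply: idealM => //; apply/idl_mem.
  by rewrite mem_cat; apply/orP; right; apply/mapP; exists i;
    rewrite // mem_enum.
have [q [tq sq qp]] : exists q, [/\ idl t q, (size q <= N.+1)%N & q`_N = p`_n].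
  have /sE : lead_ideal p`_n by exists n, p.
  apply: (@idl_min _ s (fun a => exists q, [/\ idl t q, (size q <= N.+1)%N &
    q`_N = a])).
    split=> [|a x y [q [tq sq <-]] [r [tr sr <-]]].
      by exists 0; rewrite size_poly0 coef0; split=> //; case: ti.
    exists (a%:P * q + r); split; first by case: ti => _; apply.
      rewrite (leq_trans (size_polyD _ _)) // geq_max sr andbT.
      by rewrite mul_polyC (leq_trans (size_scale_leq _ _)).
    by rewrite coefD coefCM.
  move=> a as_; have [Ja sa ga] := gP a as_; exists (g a); split=> //.
  by apply: idl_mem; rewrite mem_cat map_f.
have Jq : J q.
  apply: (idl_min Ji) tq => r; rewrite mem_cat.
  move=> /orP[/mapP[a /gP[Ja _ _] ->]//|/mapP[i _ ->]].
  by apply/GE/rspan_row/rspan_refl.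
rewrite -(subrK ('X^(n - N) * q) p); apply: idealD => //; last exact: idealM.
apply: IH; last by apply: idealB => //; apply: idealM.
apply/leq_sizeP => j; rewrite leq_eqVlt coefB coefXnM => /predU1P[<-|nj].
  by rewrite ltnNge leq_subr /= subKn // qp subrr.
move/leq_sizeP: sp => -> //; move/leq_sizeP: sq => sq.
by rewrite sub0r; case: ltnP => [|_]; rewrite ?oppr0 // sq ?oppr0 //; lia.
Qed.

End HilbertBasis.

Lemma poly_noeth (A : comNzRingType) : noeth A -> noeth {poly A}.
Proof. by move=> An; apply: noeth_of_ideals => J; apply: hilbert_fg. Qed.

Section Localization.
Variables (R : comNzRingType) (P : prime_idealr R).
Local Notation B := (localization P).

Definition loc_of (a : R) : B := loc_frac (frac_of P a).

Lemma loc_of_zmod : zmod_morphism loc_of.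
Proof.
move=> a b.
transitivity (loc_frac (frac_add (frac_of P a) (frac_opp (frac_of P b)))).
  by apply: loc_eq => /=; ring.
by rewrite -loc_addE -loc_oppE.
Qed.
HB.instance Definition _ := GRing.isZmodMorphism.Build R B loc_of loc_of_zmod.

Lemma loc_of_monoid : monoid_morphism loc_of.
Proof.
split=> // a b.
transitivity (loc_frac (frac_mul (frac_of P a) (frac_of P b))).
  by apply: loc_eq => /=; ring.
by rewrite -loc_mulE.
Qed.
HB.instance Definition _ :=
  GRing.isMonoidMorphism.Build R B loc_of loc_of_monoid.

Lemma loc_of_unit s : s \notin P -> exists b, b * loc_of s = 1.
Proof.
move=> sP; exists (loc_frac (FracPair 1 sP)).
transitivity (loc_frac (frac_mul (FracPair 1 sP) (frac_of P s))).
  by rewrite -loc_mulE.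
by apply: loc_eq => /=; ring.
Qed.

Lemma loc_of_num x : exists p s, s \notin P /\ loc_of s * x = loc_of p.
Proof.
have [[a s sP] ->] := loc_fracP x; exists a, s; split=> //.
transitivity (loc_frac (frac_mul (frac_of P s) (FracPair a sP))).
  by rewrite -loc_mulE.
by apply: loc_eq => /=; ring.
Qed.

Lemma loc_of_eq0 p : loc_of p = 0 -> exists2 t, t \notin P & t * p = 0.
Proof.
move=> /eqP/loc_frac_eq[t tP] /=; rewrite !mulr1 subr0 => ?.
by exists t.
Qed.

Lemma localization_noeth : noeth R -> noeth B.
Proof.
move=> Rn; apply: noeth_of_ideals => J Ji.
have [|s sE] := @noeth_fg R Rn (fun a => J (loc_of a)).
  split=> [|a x y]; first by rewrite rmorph0; case: Ji.
  by rewrite rmorphD rmorphM; case: Ji => _; apply.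
exists (map loc_of s); split=> [_ /mapP[a /idl_mem/sE ? ->]//|x Jx].
have [p [t [tP e]]] := loc_of_num x; have [b bt] := loc_of_unit tP.
rewrite -[x]mul1r -bt -mulrA e; apply: idealM; first exact: idl_ideal.
by apply/idl_map/sE; rewrite -e; apply: idealM.
Qed.

Lemma common_denominator n (Q : 'I_n -> R -> Prop) :
  (forall j s r, Q j s -> Q j (r * s)) ->
  (forall j, exists s, s \notin P /\ Q j s) ->
  exists s, s \notin P /\ forall j, Q j s.
Proof.
move=> Qm Qe; have [g gE] := choice Qe; exists (\prod_j g j); split.
  apply: (big_ind (fun s => s \notin P)) => [|s t|j _];
    first exact: prime_compl1.
    exact: prime_complM.
  by have [] := gE j.
by move=> j; rewrite (bigD1 j) //= mulrC; apply: Qm; have [] := gE j.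
Qed.

End Localization.

(** * The localized polynomial ring *)

Section LocalizedPolynomials.
Variables (A : comNzRingType) (m : idealr A) (m_max : maximal_ideal m).
Hypothesis A_noeth : noeth A.
Hypothesis m_unit : forall a, a \notin m -> exists b, b * a = 1.

Local Notation P := (mX_prime_ideal m_max).
Local Notation B := (localization P).
Local Notation iota := (@loc_of _ P).

Lemma mX_prime_coef0 p : (p \in P) = (p`_0 \in m).
Proof. exact: mX_ideal_coef0. Qed.

Lemma coef0_regular t : t \notin P -> forall a, t`_0 * a = 0 -> a = 0.
Proof.
rewrite mX_prime_coef0 => /m_unit[b bt] a ta.
by rewrite -[a]mul1r -bt -mulrA ta mulr0.
Qed.

(** The constant term of t is a unit, so the coefficients of p vanish one after the other. *)
Lemma poly_regular t : t \notin P -> forall p, t * p = 0 -> p = 0.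
Proof.
move=> tP p tp; apply/polyP => i; rewrite coef0.
have [n] := ubnP i; elim: n i => // n IH i; rewrite ltnS => ni.
apply: (coef0_regular tP); have := congr1 (fun q : {poly A} => q`_i) tp.
rewrite coef0 coefM big_ord_recl subn0 big1 ?addr0 // => j _.
by rewrite lift0 IH ?mulr0 //; have := ltn_ord j; lia.
Qed.

Lemma loc_of_inj p : iota p = 0 -> p = 0.
Proof. by move=> /loc_of_eq0[t tP]; apply: poly_regular. Qed.

(** The quotient p(0) / s(0) for some fraction p / s; independence of the fraction rests on s(0)
    being a unit and on the injectivity of [iota]. *)
Definition loc_eval0_rel (x : B) (a : A) : Prop :=
  exists p s, [/\ s \notin P, iota s * x = iota p & s`_0 * a = p`_0].

Lemma loc_eval0_rel_ex x : exists a, loc_eval0_rel x a.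
Proof.
have [p [s [sP e]]] := loc_of_num x.
have [|b bs] := @m_unit s`_0; first by rewrite -mX_prime_coef0.
by exists (b * p`_0), p, s; split=> //; rewrite mulrA [_ * b]mulrC bs mul1r.
Qed.

Lemma loc_eval0_rel_fun x a b : loc_eval0_rel x a -> loc_eval0_rel x b -> a = b.
Proof.
move=> [p [s [sP e sa]]] [q [t [tP e' tb]]]; apply/eqP; rewrite -subr_eq0;
  apply/eqP.
apply: (coef0_regular (prime_complM sP tP)).
have /(congr1 (fun r : {poly A} => r`_0)) : s * q - t * p = 0.
  by apply: loc_of_inj; rewrite rmorphB !rmorphM /= -e -e'; ring.
rewrite coefB !coef0M coef0 -sa -tb => h.
apply/eqP; rewrite -oppr_eq0; apply/eqP; rewrite -[RHS]h; ring.
Qed.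

Definition loc_eval0 (x : B) : A := xget 0 (loc_eval0_rel x).

Lemma loc_eval0P x : loc_eval0_rel x (loc_eval0 x).
Proof. exact: (xgetPex 0 (loc_eval0_rel_ex x)). Qed.

Lemma loc_eval0E x a : loc_eval0_rel x a -> loc_eval0 x = a.
Proof. exact/loc_eval0_rel_fun/loc_eval0P. Qed.

Lemma loc_eval0_of p : loc_eval0 (iota p) = p`_0.
Proof.
apply: loc_eval0E; exists p, 1; rewrite rmorph1 mul1r coef1 mul1r.
by split=> //; apply: prime_compl1.
Qed.

Lemma loc_eval0_zmod : zmod_morphism loc_eval0.
Proof.
move=> x y; apply: loc_eval0E.
have [p [s [sP e sa]]] := loc_eval0P x; have [q [t [tP e' tb]]] := loc_eval0P y.
exists (t * p - s * q), (s * t); split; first exact: prime_complM.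
  by rewrite rmorphB !rmorphM /= -e -e'; ring.
by rewrite coefB !coef0M -sa -tb; ring.
Qed.
HB.instance Definition _ :=
  GRing.isZmodMorphism.Build B A loc_eval0 loc_eval0_zmod.

Lemma loc_eval0_monoid : monoid_morphism loc_eval0.
Proof.
split=> [|x y]; first by rewrite -(rmorph1 iota) loc_eval0_of coef1.
apply: loc_eval0E.
have [p [s [sP e sa]]] := loc_eval0P x; have [q [t [tP e' tb]]] := loc_eval0P y.
exists (p * q), (s * t); split; first exact: prime_complM.
  by rewrite !rmorphM /= -e -e'; ring.
by rewrite !coef0M -sa -tb; ring.
Qed.
HB.instance Definition _ :=
  GRing.isMonoidMorphism.Build B A loc_eval0 loc_eval0_monoid.

Lemma loc_eval0_surj a : exists x, loc_eval0 x = a.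
Proof. by exists (iota a%:P); rewrite loc_eval0_of coefC. Qed.

Lemma loc_eval0_X : loc_eval0 (iota 'X) = 0.
Proof. by rewrite loc_eval0_of coefX. Qed.

Lemma loc_eval0_ker x : loc_eval0 x = 0 -> exists c, x = iota 'X * c.
Proof.
move=> x0; have [p [s [sP e]]] := loc_eval0P x; rewrite x0 mulr0 => p0.
have [b bs] := loc_of_unit sP; exists (b * iota (drop_poly 1 p)).
rewrite -[x]mul1r -bs -mulrA e mulrCA -rmorphM /=; congr (_ * iota _).
rewrite -{1}[p](poly_take_drop 1) expr1 mulrC.
suff -> : take_poly 1 p = 0 by rewrite add0r.
by apply/polyP => -[|i]; rewrite coef_take_poly coef0.
Qed.

Lemma loc_X_regular x : iota 'X * x = 0 -> x = 0.
Proof.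
move=> Xx; have [p [s [sP e]]] := loc_of_num x; have [b bs] := loc_of_unit sP.
rewrite -[x]mul1r -bs -mulrA e.
suff -> : p = 0 by rewrite rmorph0 mulr0.
have /loc_of_inj pX : iota (p * 'X) = 0.
  by rewrite rmorphM /= -e mulrC mulrCA Xx mulr0.
apply/polyP => i; have := congr1 (fun q : {poly A} => q`_i.+1) pX.
by rewrite coefMX !coef0.
Qed.

(** 1 - X b is (s - X p) / s, and s - X p has the constant term of s. *)
Lemma loc_X_jac : jac (iota 'X).
Proof.
move=> b; have [p [s [sP e]]] := loc_of_num b.
have tP : s - 'X * p \notin P.
  by rewrite mX_prime_coef0 coefB coefXM subr0 -mX_prime_coef0.
have [c ct] := loc_of_unit tP; exists (c * iota s).
by rewrite -mulrA mulrBr mulr1 mulrCA e -rmorphM -rmorphB.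
Qed.

Lemma localized_poly_noeth : noeth B.
Proof. exact/localization_noeth/poly_noeth. Qed.

Definition loc_const (a : A) : B := iota a%:P.
Lemma loc_const_zmod : zmod_morphism loc_const.
Proof. by move=> a b; rewrite /loc_const !rmorphB. Qed.
HB.instance Definition _ :=
  GRing.isZmodMorphism.Build A B loc_const loc_const_zmod.
Lemma loc_const_monoid : monoid_morphism loc_const.
Proof. by split=> [|a b]; rewrite /loc_const ?rmorph1 ?rmorphM. Qed.
HB.instance Definition _ :=
  GRing.isMonoidMorphism.Build A B loc_const loc_const_monoid.

Lemma coef_mulmx a b c (u : 'M[{poly A}]_(a, b)) (M : 'M[A]_(b, c)) n :
  map_mx (fun p : {poly A} => p`_n) (u *m map_mx polyC M) =
  map_mx (fun p : {poly A} => p`_n) u *m M.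
Proof.
apply/matrixP => i j; rewrite !mxE coef_sum; apply: eq_bigr => k _.
by rewrite !mxE coefMC.
Qed.

Lemma row_denominator n (u : 'rV[B]_n) : exists (s : {poly A}) (p : 'rV[{poly
  A}]_n),
  s \notin P /\ iota s *: u = map_mx iota p.
Proof.
have [||s [sP h]] := @common_denominator _ P n
  (fun j s => exists p, iota s * u 0 j = iota p).
- by move=> j s r [p e]; exists (r * p); rewrite !rmorphM /= -mulrA e.
- by move=> j; have [p [s [sP e]]] := loc_of_num (u 0 j); exists s; split=> //;
    exists p.
have [p hp] := choice h; exists s, (\row_j p j); split=> //.
by apply/rowP => j; rewrite !mxE hp.
Qed.

Lemma map_loc_const a b (M : 'M[A]_(a, b)) :
  map_mx loc_const M = map_mx iota (map_mx polyC M).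
Proof. by apply/matrixP => i j; rewrite !mxE. Qed.

Lemma map_iota_inj a b (U : 'M[{poly A}]_(a, b)) : map_mx iota U = 0 -> U = 0.
Proof.
by move=> /matrixP h; apply/matrixP => i j; have := h i j;
  rewrite !mxE => /loc_of_inj.
Qed.

Lemma localized_poly_flat : flat loc_const.
Proof.
move=> a b M u uM; have [s [p [sP e]]] := row_denominator u.
have [K [KM KE]] := left_kernel_fg A_noeth M.
exists (tag K), (tagged K).
have pM : p *m map_mx polyC M = 0.
  by apply: map_iota_inj; rewrite map_mxM -e -map_loc_const -scalemxAl uM
    scaler0.
pose pn n : 'rV[A]_a := map_mx (fun q : {poly A} => q`_n) p.
have pnK n : rspan (pn n) (tagged K).
  apply: KE; rewrite -coef_mulmx pM; apply/matrixP => i j.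
  by rewrite !mxE coef0.
have [N hN] : exists N, forall j, (size (p 0%R j) <= N)%N.
  exists (\max_j size (p 0%R j)) => j; exact: (leq_bigmax j).
(* The cut at N is needed because [mdiv] applied to 0 may return any syzygy of the rows of K, not
   necessarily 0. *)
pose v := \row_i \poly_(n < N) mdiv (pn n) (tagged K) 0 i.
have [c cs] := loc_of_unit sP; exists (c *: map_mx iota v); split=> //.
rewrite -[u]scale1r -cs -scalerA e -scalemxAl map_loc_const -map_mxM.
congr (_ *: map_mx _ _); apply/rowP => i; apply/polyP => n.
transitivity (pn n 0 i); first by rewrite mxE.
transitivity ((map_mx (fun q : {poly A} =>
  q`_n) (v *m map_mx polyC (tagged K))) 0 i);
  last by rewrite [LHS]mxE.
rewrite coef_mulmx; have [nN|Nn] := ltnP n N.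
  rewrite -{1}(mdivK (pnK n)); congr ((_ *m _) 0 i).
  by apply/rowP => j; rewrite !mxE coef_poly nN.
have -> : pn n = 0.
  by apply/rowP => j; rewrite !mxE nth_default // (leq_trans (hN j)).
rewrite (_ : map_mx _ v = 0) ?mul0mx //.
by apply/rowP => j; rewrite !mxE coef_poly ltnNge Nn.
Qed.

Lemma localized_poly_faithful : faithful loc_const.
Proof.
move=> a b M w [u uM]; have [s [p [sP e]]] := row_denominator u.
have : p *m map_mx polyC M - s *: map_mx polyC w = 0.
  apply: map_iota_inj; rewrite map_mxB map_mxM map_mxZ -e -!map_loc_const.
  by rewrite -scalemxAl uM subrr.
move=> /eqP; rewrite subr_eq0 => /eqP pM.
have [|c cs] := @m_unit s`_0; first by rewrite -mX_prime_coef0.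
exists (c *: map_mx (fun q : {poly A} => q`_0) p).
rewrite -scalemxAl -coef_mulmx pM; apply/rowP => j.
by rewrite !mxE coefMC mulrA cs mul1r.
Qed.

Lemma localized_poly_pd_bound n D :
  free_ext_bound A n -> pd_bound A D -> pd_bound B D.+1.
Proof.
exact: (@pd_bound_reduction B A loc_eval0 (iota 'X) loc_eval0_surj loc_eval0_X
         loc_eval0_ker loc_X_regular localized_poly_noeth loc_X_jac).
Qed.

End LocalizedPolynomials.

(** * The completion *)

Section IdealPowers.
Variables (A : comNzRingType) (m : idealr A).

(* The k-th power of [m], including the unit ideal for [k = 0]. *)
Definition ipow (k : nat) (y : A) : Prop :=
  if k is n.+1 then y \in power_ideal m n else True.

Lemma idealr_ideal (I : idealr A) : ideal (fun y => y \in I).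
Proof.
split=> [|a x y xI yI]; first exact: idealr0.
by apply: rpredD => //; apply: idealMr.
Qed.

Lemma ipow_ideal k : ideal (ipow k).
Proof. by case: k => [//|n]; apply: idealr_ideal. Qed.

Lemma ipow_prod t : (forall y, y \in t -> y \in m) ->
  ipow (size t) (\prod_(y <- t) y).
Proof.
case: t => [//|y t] tm; apply: gen_ideal_mem.
by exists (in_tuple (y :: t)).
Qed.

Lemma ipow_min k (I : A -> Prop) : ideal I ->
  (forall t : seq A, size t = k -> (forall y, y \in t -> y \in m) ->
     I (\prod_(y <- t) y)) ->
  forall y, ipow k y -> I y.
Proof.
move=> Ii; case: k => [|k] h y /=.
  by move=> _; rewrite -[y]mulr1; apply: idealM => //; have := h [::] erefl;
    rewrite big_nil; apply.
move=> /gen_idealP[s sP ->]; rewrite big_seq;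
  apply: ideal_sum => // p /sP[t tm ->].
by apply: idealM => //; apply: h; rewrite ?size_tuple.
Qed.

Lemma ipow_le j k y : (j <= k)%N -> ipow k y -> ipow j y.
Proof.
move=> jk; apply: ipow_min => [|t tk tm]; first exact: ipow_ideal.
rewrite -(cat_take_drop j t) big_cat /= mulrC; apply: idealM;
  first exact: ipow_ideal.
have {1}<- : size (take j t) = j by rewrite size_takel // tk.
by apply: ipow_prod => z /mem_take/tm.
Qed.

Lemma ipow_expr x k : x \in m -> ipow k (x ^+ k).
Proof.
move=> xm; have := @ipow_prod (nseq k x); rewrite size_nseq.
by rewrite big_nseq iter_mulr_1; apply=> y /nseqP[->].
Qed.

Lemma ipow1 y : ipow 1 y -> y \in m.
Proof.
apply: (@ipow_min 1 (fun y => y \in m)) => [|[//|z[]//] _ h].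
  exact: idealr_ideal.
by rewrite big_seq1; apply: h; rewrite mem_head.
Qed.

Lemma prods_in_ipow K (I : A -> Prop) y : ideal I ->
  prods_in (fun y => y \in m) K I -> ipow K y -> I y.
Proof.
by move=> Ii h; apply: ipow_min => // t tK tm; apply: h; rewrite ?tK.
Qed.

Hypothesis A_noeth : noeth A.

Lemma chain_stable_rV p (Q : nat -> 'rV[A]_p -> Prop) :
  (forall n, Q n 0 /\ forall a u v, Q n u -> Q n v -> Q n (a *: u + v)) ->
  (forall n u, Q n u -> Q n.+1 u) ->
  exists N, forall n u, Q n u -> Q N u.
Proof.
move=> Qs Qc.
have Qmono n k u : (n <= k)%N -> Q n u -> Q k u.
  by move=> /subnK <-; elim: (k - n)%N => // j IH /IH /Qc.
have [||r [G GE]] := A_noeth (S := fun u => exists n, Q n u).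
- by exists 0%N; case: (Qs 0%N).
- move=> a u v [n Qu] [k Qv]; exists (maxn n k); have [_ h] := Qs (maxn n k).
  by apply: h; [apply: Qmono Qu; apply: leq_maxl|apply: Qmono Qv;
    apply: leq_maxr].
have rowQ i : exists n, Q n (row i G) by apply/GE/rspan_row/rspan_refl.
have [g gE] := choice rowQ.
exists (\max_i g i) => n u Qu.
have /GE[w ->] : exists n, Q n u by exists n.
have [Q0 Ql] := Qs (\max_i g i).
rewrite mulmx_sum_row; apply: (big_ind (Q (\max_i g i))) => // [x y Qx Qy|i _].
  by rewrite -[x]scale1r; apply: Ql.
rewrite -[_ *: _]addr0; apply: Ql => //.
by apply: Qmono (gE i); apply: (leq_bigmax i).
Qed.

Section ArtinRees.
Variables (n p k : nat) (Phi : 'M[A]_(n, p)).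

Let N' (y : 'rV[A]_p) := exists w, y = w *m Phi /\ forall i, ipow k (w 0 i).

Let sub (Q : 'rV[A]_p -> Prop) :=
  Q 0 /\ forall a u v, Q u -> Q v -> Q (a *: u + v).

(** [Q'] is Q + x^c A^p, with c where the submodules (Q : x^j) become constant. If y = q + x^c v
    lies in the row space, then x^k y is in N', hence in Q. So x^(k+c) v is in Q, hence x^c v by the
    choice of c, and therefore y. *)
Lemma artin_rees_step Q x : sub Q -> (forall y, N' y -> Q y) ->
  (forall y, rspan y Phi -> Q y -> N' y) -> x \in m ->
  exists c Q', [/\ sub Q', forall y, Q y -> Q' y, forall v, Q' (x ^+ c *: v) &
    forall y, rspan y Phi -> Q' y -> N' y].
Proof.
move=> [Q0 Ql] N'Q QN' xm.
have Qd u v : Q u -> Q v -> Q (u + v) by move=> ? ?; rewrite -[u]scale1r;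
  apply: Ql.
have Qz a u : Q u -> Q (a *: u) by move=> ?; rewrite -[_ *: _]addr0; apply: Ql.
have [||c0 hc0] := @chain_stable_rV p (fun j v => Q (x ^+ j *: v)).
- move=> j; split=> [|a u v hu hv]; first by rewrite scaler0.
  by rewrite scalerDr scalerA mulrC -scalerA; apply: Ql.
- by move=> j u h; rewrite exprS -scalerA; apply: Qz.
exists c0, (fun u => exists v, Q (u - x ^+ c0 *: v)); split.
- split=> [|a u v [u' hu] [v' hv]]; first by exists 0; rewrite scaler0 subr0.
  exists (a *: u' + v'); rewrite scalerDr scalerA mulrC -scalerA opprD addrACA.
  by rewrite -scalerBr; apply: Ql.
- by move=> y Qy; exists 0; rewrite scaler0 subr0.
- by move=> v; exists v; rewrite subrr.
move=> y yPhi [v Qyv]; apply: QN' => //.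
have Qxy : Q (x ^+ k *: y).
  have [w ->] := yPhi; apply: N'Q; exists (x ^+ k *: w).
  rewrite scalemxAl; split=> // i; rewrite mxE mulrC; apply: idealM.
    exact: ipow_ideal.
  exact: ipow_expr.
rewrite -(subrK (x ^+ c0 *: v) y); apply: (Qd) => //; apply: (hc0 (k + c0)%N).
have -> : x ^+ (k + c0) *: v = x ^+ k *: y + (-1) *: (x ^+ k *: (y - x ^+ c0 *:
  v)).
  by rewrite scaleN1r scalerBr opprB addrC subrK scalerA exprD.
by apply: Qd => //; apply/Qz/Qz.
Qed.

(* A weak form of the Artin-Rees lemma: only the topologies are compared. The
   submodules [Q] meet the row space of [Phi] in m^k times that row space and
   are enlarged by a high power of one generator of [m] at a time. *)
Lemma artin_rees : exists K, forall y : 'rV[A]_p, (forall j, ipow K (y 0 j)) ->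
  rspan y Phi -> exists w, y = w *m Phi /\ forall i, ipow k (w 0 i).
Proof.
have [gs gE] := noeth_fg A_noeth (idealr_ideal m).
have [Q [c [Qs N'Q Qg QN']]] : exists Q c, [/\ sub Q, forall y, N' y -> Q y,
    forall g, g \in gs -> forall v, Q (g ^+ c *: v) &
    forall y, rspan y Phi -> Q y -> N' y].
  have : forall g, g \in gs -> g \in m by move=> g /idl_mem/gE.
  elim: gs {gE} => [|g gs IH] gm.
    exists N', 0%N; split=> //; split.
      exists 0; rewrite mul0mx; split=> // i; rewrite mxE.
      by case: (ipow_ideal k).
    move=> a _ _ [u [-> hu]] [v [-> hv]]; exists (a *: u + v).
    rewrite mulmxDl scalemxAl; split=> // i; rewrite !mxE.
    by case: (ipow_ideal k) => _; apply.
  have [|Q [c [Qs N'Q Qg QN']]] := IH.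
    by move=> h hg; apply: gm; rewrite in_cons hg orbT.
  have [c' [Q' [Q's QQ' Q'g Q'N']]] :=
    artin_rees_step Qs N'Q QN' (gm g (mem_head _ _)).
  exists Q', (c + c')%N; split=> // [y /N'Q/QQ' //|h].
  rewrite in_cons => /predU1P[->|hg] v; first by rewrite addnC exprD -scalerA.
  by rewrite exprD -scalerA; apply/QQ'/Qg.
have [Q0 Ql] := Qs.
(* This ideal contains [g ^+ c] for all generators g of m, hence the power of m whose exponent is
   taken as K. *)
have Ii : ideal (fun a => forall v, Q (a *: v)).
  split=> [v|a x y hx hy v]; first by rewrite scale0r.
  by rewrite scalerDl -scalerA; apply: Ql.
exists (size gs * c).+1 => y hy yPhi; apply: QN' => //.
rewrite [y]row_sum_delta; apply: (big_ind Q) => // [u v Qu Qv|j _].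
  by rewrite -[u]scale1r; apply: Ql.
move: (delta_mx 0 j); apply: (prods_in_ipow Ii _ (hy j)).
apply: prods_in_trans (prods_in_nilpotent Ii Qg).
by move=> z zm; apply/gE.
Qed.

End ArtinRees.
End IdealPowers.

(** * The completion: density and faithful flatness *)

Section CompletionRing.
Variables (A : comNzRingType) (m : idealr A).
Local Notation B := (completion m).
Local Notation Res n := {ideal_quot (power_ideal m n)}.

Lemma residue_zmod n : zmod_morphism (residue m n).
Proof. by move=> a b; rewrite residueD residueN. Qed.
HB.instance Definition _ n :=
  GRing.isZmodMorphism.Build A (Res n) (residue m n) (residue_zmod n).
Lemma residue_monoid n : monoid_morphism (residue m n).
Proof. by split=> [|a b]; [rewrite /residue rmorph1|rewrite residueM]. Qed.
HB.instance Definition _ n :=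
  GRing.isMonoidMorphism.Build A (Res n) (residue m n) (residue_monoid n).

Lemma residueB n x y : residue m n (x - y) = residue m n x - residue m n y.
Proof. exact: rmorphB. Qed.

Lemma residue_sum n (I : Type) (r : seq I) (P : pred I) (z : I -> A) :
  residue m n (\sum_(i <- r | P i) z i) = \sum_(i <- r | P i) residue m n (z i).
Proof. exact: rmorph_sum. Qed.

Lemma residue_eq n x y : residue m n x = residue m n y <-> ipow m n.+1 (x - y).
Proof.
rewrite /= Quotient.idealrBE.
by split=> [/eqP//|/eqP].
Qed.

Lemma residue_eq0 n x : residue m n x = 0 <-> ipow m n.+1 x.
Proof. by rewrite -(rmorph0 (residue m n)) residue_eq subr0. Qed.

Definition comp_proj n (z : B) : Res n := comp_val z n.
Lemma comp_proj_zmod n : zmod_morphism (comp_proj n).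
Proof. by []. Qed.
HB.instance Definition _ n :=
  GRing.isZmodMorphism.Build B (Res n) (comp_proj n) (comp_proj_zmod n).
Lemma comp_proj_monoid n : monoid_morphism (comp_proj n).
Proof. by []. Qed.
HB.instance Definition _ n :=
  GRing.isMonoidMorphism.Build B (Res n) (comp_proj n) (comp_proj_monoid n).

Lemma transition_zmod n : zmod_morphism (@transition A m n).
Proof. by move=> x y; rewrite transitionD transitionN. Qed.
HB.instance Definition _ n :=
  GRing.isZmodMorphism.Build (Res n.+1) (Res n) (@transition A m n)
    (@transition_zmod n).

Definition comp_of (a : A) : B :=
  Completion (comp_val := fun n => residue m n a) (fun n =>
    transition_residue m n a).

Lemma comp_of_zmod : zmod_morphism comp_of.
Proof. by move=> a b; apply: completion_eq => n /=; rewrite rmorphB. Qed.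
HB.instance Definition _ := GRing.isZmodMorphism.Build A B comp_of comp_of_zmod.
Lemma comp_of_monoid : monoid_morphism comp_of.
Proof.
by split=> [|a b]; apply: completion_eq => n /=; rewrite ?rmorph1 ?rmorphM.
Qed.
HB.instance Definition _ :=
  GRing.isMonoidMorphism.Build A B comp_of comp_of_monoid.

Lemma comp_proj_of n a : comp_proj n (comp_of a) = residue m n a.
Proof. by []. Qed.

Lemma comp_projD n (x y : B) : comp_proj n (x + y) = comp_proj n x + comp_proj n
  y.
Proof. by []. Qed.

Lemma comp_projB n (x y : B) : comp_proj n (x - y) = comp_proj n x - comp_proj n
  y.
Proof. by []. Qed.

Lemma comp_projM n (x y : B) : comp_proj n (x * y) = comp_proj n x * comp_proj n
  y.
Proof. by []. Qed.

Lemma comp_proj_sum n (I : Type) (r : seq I) (P : pred I) (z : I -> B) :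
  comp_proj n (\sum_(i <- r | P i) z i) = \sum_(i <- r | P i) comp_proj n (z i).
Proof. exact: rmorph_sum. Qed.

Lemma comp_proj_eq (x y : B) : (forall n, comp_proj n x = comp_proj n y) ->
  x = y.
Proof. exact: completion_eq. Qed.

Lemma comp_approx (z : B) : exists a : nat -> A,
  (forall n k, (n <= k)%N -> comp_proj n z = residue m n (a k)) /\
  forall n, ipow m n.+1 (a n.+1 - a n).
Proof.
pose a n := repr (comp_proj n z).
have aE n : residue m n (a n) = comp_proj n z by rewrite /residue /a reprK.
have aS n : residue m n (a n.+1) = residue m n (a n).
  by rewrite aE -transition_residue aE; apply: comp_coherent.
exists a; split=> [n k|n]; last exact/residue_eq.
move=> /subnK <-; elim: (k - n)%N => [|j IH]; first by rewrite aE.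
rewrite IH addSn; apply/esym/residue_eq.
by apply: (@ipow_le _ _ _ (j + n).+1); [rewrite ltnS leq_addl|apply/residue_eq].
Qed.

(** Level n of the completion is A modulo m^(n+1), so there the terms of index above n do not
    count. *)
Lemma comp_series (delta : nat -> A) : (forall k, ipow m k (delta k)) ->
  exists z : B, forall n, comp_proj n z = residue m n (\sum_(j < n.+1) delta j).
Proof.
move=> h.
have coh n : transition (residue m n.+1 (\sum_(j < n.+2) delta j)) =
             residue m n (\sum_(j < n.+1) delta j).
  rewrite transition_residue; apply/residue_eq.
  rewrite big_ord_recr /= addrAC subrr add0r; exact: (h n.+1).
by exists (Completion (comp_val := fun n =>
  residue m n (\sum_(j < n.+1) delta j)) coh).
Qed.

Lemma comp_complete x : x \in m -> adic_complete (comp_of x).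
Proof.
move=> xm c.
have xn n : residue m n (x ^+ n.+1) = 0 by apply/residue_eq0/ipow_expr.
have coh k n : transition (\sum_(j < n.+2)
    residue m n.+1 (x ^+ j) * comp_val (c (j + k)%N) n.+1) =
  \sum_(j < n.+1) residue m n (x ^+ j) * comp_val (c (j + k)%N) n.
  rewrite raddf_sum big_ord_recr /= transitionM transition_residue xn mul0r
    addr0.
  by apply: eq_bigr => j _; rewrite transitionM transition_residue
    comp_coherent.
exists (fun k => Completion (comp_val := fun n =>
  \sum_(j < n.+1) residue m n (x ^+ j) * comp_val (c (j + k)%N) n) (coh k)).
move=> k; apply: completion_eq => n /=.
rewrite mulr_sumr [in RHS]big_ord_recr /= mulrA -residueM -exprS xn mul0r addr0.
rewrite big_ord_recl expr0 rmorph1 mul1r; congr (_ + _).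
by apply: eq_bigr => j _ /=; rewrite mulrA -residueM -exprS addSnnS.
Qed.

Lemma comp_separated x : x \in m -> adic_separated (comp_of x).
Proof.
move=> xm y yx.
have yE k : y 0%N = comp_of (x ^+ k) * y k.
  elim: k => [|k IH]; first by rewrite expr0 rmorph1 mul1r.
  by rewrite IH yx mulrA -rmorphM exprSr.
apply: comp_proj_eq => n; rewrite (yE n.+1) comp_projM comp_proj_of.
suff -> : residue m n (x ^+ n.+1) = 0 by rewrite mul0r.
exact/residue_eq0/ipow_expr.
Qed.

(* If a power of [m] lies in (s) then [A] is dense for the (s)-adic topology
   of the completion. *)
Lemma comp_dense s K : prods_in (fun y => y \in m) K (idl s) ->
  forall z : B, exists a, idl (map comp_of s) (z - comp_of a).
Proof.
move=> sK z; have [a [aE aS]] := comp_approx z; exists (a K).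
have [p [G [GE GfE]]] := idl_map_rspan comp_of s.
(* The increments lie in m^(K+k), which is inside m^k (s). Their coefficients with respect to s
   therefore form convergent series. *)
pose delta k := a (K + k).+1 - a (K + k)%N.
have split_pow k y : ipow m (K + k) y ->
    exists W : 'rV_p, y%:M = W *m G /\ forall i, ipow m k (W 0 i).
  apply: (@ipow_min _ _ _ (fun y => exists W : 'rV_p,
    y%:M = W *m G /\ forall i, ipow m k (W 0 i))).
    have [I0 Il] := ipow_ideal m k.
    split=> [|b x x' [W [e hW]] [W' [e' hW']]].
      by exists 0; rewrite mul0mx raddf0; split=> // i; rewrite mxE.
    exists (b *: W + W'); split=> [|i]; last by rewrite !mxE; apply: Il.
    by rewrite mulmxDl -scalemxAl -e -e' scale_scalar_mx -raddfD.
  move=> t tK tm.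
  have /GE[W eW] : idl s (\prod_(y <- take K t) y).
    apply: sK => [|x /mem_take/tm //].
    by rewrite size_takel ?tK ?leq_addr.
  exists (\prod_(y <- drop K t) y *: W); split.
    rewrite -scalemxAl -eW scale_scalar_mx -{1}(cat_take_drop K t) big_cat.
    by rewrite mulrC.
  move=> i; rewrite mxE mulrC; apply: idealM; first exact: ipow_ideal.
  have {1}<- : size (drop K t) = k by rewrite size_drop tK addKn.
  by apply: ipow_prod => x /mem_drop/tm.
have hdelta k : exists W : 'rV_p, (delta k)%:M = W *m G /\ forall i,
  ipow m k (W 0 i).
  by apply: split_pow; apply: (@ipow_le _ _ _ (K + k).+1).
have [W WE] := choice hdelta.
have hC i : exists c : B, forall n,
    comp_proj n c = residue m n (\sum_(j < n.+1) W j 0 i).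
  by apply: (@comp_series (fun j => W j 0 i)) => k; have [_] := WE k; apply.
have [C CE] := choice hC.
apply/GfE; exists (\row_i C i); apply/matrixP => i0 j0;
  rewrite !ord1 !mxE eqxx mulr1n.
apply: comp_proj_eq => n; rewrite comp_projB comp_proj_of comp_proj_sum.
rewrite (aE n (K + n.+1)%N); last by rewrite addnS ltnW // ltnS leq_addl.
rewrite -residueB.
have -> : a (K + n.+1)%N - a K = \sum_(j < n.+1) delta j.
  rewrite /delta; elim: n => [|n IH]; first by rewrite big_ord1 addn0 addn1.
  by rewrite big_ord_recr /= -IH addnS addrC addrA subrK addnS.
have -> : \sum_(j < n.+1) delta j = \sum_i (\sum_(j < n.+1) W j 0 i) * G i 0.
  transitivity (\sum_(j < n.+1) \sum_i W j 0 i * G i 0).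
    apply: eq_bigr => j _; have [/matrixP/(_ 0 0)] := WE j.
    by rewrite !mxE eqxx mulr1n.
  rewrite exchange_big; apply: eq_bigr => i _.
  by rewrite mulr_suml.
rewrite residue_sum; apply: eq_bigr => i _.
by rewrite !mxE comp_projM residueM CE comp_proj_of.
Qed.

Hypothesis A_noeth : noeth A.

Lemma completion_noeth : noeth B.
Proof.
have [gs gE] := noeth_fg A_noeth (idealr_ideal m).
have gm g : g \in gs -> g \in m by move=> /idl_mem/gE.
apply: (@complete_noeth A B comp_of (map comp_of gs) A_noeth).
- apply: (@comp_dense gs 1) => -[//|y t] _ ym.
  rewrite big_cons mulrC; apply: idealM; first exact: idl_ideal.
  by apply/gE/ym/mem_head.
- by move=> _ /mapP[x /gm xm ->]; apply: comp_complete.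
by move=> _ /mapP[x /gm xm ->]; apply: comp_separated.
Qed.

Lemma comp_jac x : x \in m -> jac (comp_of x).
Proof. by move=> xm; apply: adic_jac;
  [apply: comp_complete|apply: comp_separated]. Qed.

Lemma row_approx a (u : 'rV[B]_a) n : exists w : 'rV[A]_a,
  forall k, (k <= n)%N -> map_mx (comp_proj k) u = map_mx (residue m k) w.
Proof.
have [w wE] := choice (fun i => comp_approx (u 0 i)).
exists (\row_i w i n) => k kn; apply/rowP => i; rewrite !mxE.
by have [h _] := wE i; apply: h.
Qed.

Lemma map_residue_eq n a (u v : 'rV[A]_a) :
  map_mx (residue m n) u = map_mx (residue m n) v <->
  forall i, ipow m n.+1 ((u - v) 0 i).
Proof.
split=> [/rowP h i|h]; last apply/rowP => i.
  by have := h i; rewrite !mxE; apply: (iffLR (residue_eq _ _ _)).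
by have := h i; rewrite !mxE; apply: (iffRL (residue_eq _ _ _)).
Qed.

Lemma map_comp_proj_of n a b (M : 'M[A]_(a, b)) :
  map_mx (comp_proj n) (map_mx comp_of M) = map_mx (residue m n) M.
Proof. by apply/matrixP => i j; rewrite !mxE. Qed.

Lemma map_residueM n a b c (U : 'M[A]_(a, b)) (V : 'M[A]_(b, c)) :
  map_mx (residue m n) (U *m V) = map_mx (residue m n) U *m map_mx (residue m n)
    V.
Proof. exact: map_mxM. Qed.

Lemma map_comp_projM n a b c (U : 'M[B]_(a, b)) (V : 'M[B]_(b, c)) :
  map_mx (comp_proj n) (U *m V) = map_mx (comp_proj n) U *m map_mx (comp_proj n)
    V.
Proof. exact: map_mxM. Qed.

(** An approximation w of u satisfies w M = 0 only modulo a high power of m. Artin-Rees writes w M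
    as y M with y small, and w - y is an exact solution close to u. *)
Lemma kernel_approx a b (M : 'M[A]_(a, b)) (u : 'rV[B]_a) n :
  u *m map_mx comp_of M = 0 -> exists w : 'rV[A]_a, w *m M = 0 /\
  forall k, (k <= n)%N -> map_mx (comp_proj k) u = map_mx (residue m k) w.
Proof.
move=> uM; have [K hK] := artin_rees m A_noeth n.+1 M.
have [w wE] := row_approx u (K + n).
have [||y [yE ypow]] := hK (w *m M).
- have wM : map_mx (residue m (K + n)) (w *m M) = map_mx (residue m (K + n)) 0.
    rewrite map_residueM -wE // -map_comp_proj_of -map_comp_projM uM.
    exact: etrans (map_mx0 _ _ _) (esym (map_mx0 _ _ _)).
  move=> j; apply: (@ipow_le _ _ _ (K + n).+1);
    first by rewrite ltnW // ltnS leq_addr.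
  by have /map_residue_eq/(_ j) := wM; rewrite subr0.
- exact/rspanM/rspan_refl.
exists (w - y); split=> [|k kn]; first by rewrite mulmxBl yE subrr.
rewrite wE; last exact: leq_trans kn (leq_addl _ _).
apply/map_residue_eq => i; rewrite subKr.
exact: ipow_le (ypow i).
Qed.

Lemma completion_flat : flat comp_of.
Proof.
move=> a b M u uM; have [Ks [KM KE]] := left_kernel_fg A_noeth M.
set q := tag Ks; pose K : 'M_(q, a) := tagged Ks; exists q, K.
have [L LE] := choice (fun k => artin_rees m A_noeth k K).
(* Nondecreasing in k and at least [L k], so that the increment of w at stage k is a combination of
   the rows of K with coefficients in m^k; the summand k makes w converge to u. *)
pose N k := (k + \sum_(j < k.+1) L j)%N.
have NS k : (N k <= N k.+1)%N by rewrite /N [X in (_ <= _ + X)%N]big_ord_recr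
  /=; lia.
have LN k : (L k <= N k)%N by rewrite /N big_ord_recr /=; lia.
have kN k : (k <= N k)%N by apply: leq_addr.
have [w wE] := choice (fun k => kernel_approx (N k) uM).
have hd k : exists y : 'rV_q, w k.+1 - w k = y *m K /\ forall i,
  ipow m k (y 0 i).
  apply: LE => [j|]; last first.
    by apply: KE; rewrite mulmxBl (wE k.+1).1 (wE k).1 subrr.
  apply: (@ipow_le _ _ _ (N k).+1); first exact: leqW.
  move: j; apply/map_residue_eq.
  by rewrite -(wE k.+1).2 // -(wE k).2.
have [y yE] := choice hd.
have [y0 y0E] : rspan (w 0%N) K by apply: KE; rewrite (wE 0%N).1.
have hc i : exists c : B, forall n,
    comp_proj n c = residue m n (\sum_(j < n.+1) y j 0 i).
  by apply: (@comp_series (fun j => y j 0 i)) => k; have [_] := yE k; apply.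
have [c cE] := choice hc.
exists (map_mx comp_of y0 + \row_i c i); split=> //.
apply/rowP => i; apply: comp_proj_eq => n.
have vE : map_mx (comp_proj n) (map_mx comp_of y0 + \row_i c i) =
    map_mx (residue m n) (y0 + \sum_(j < n.+1) y j).
  apply/rowP => l; rewrite !mxE comp_projD comp_proj_of cE -residueD summxE.
  by [].
have yS : (y0 + \sum_(j < n.+1) y j) *m K = w n.+1.
  rewrite mulmxDl mulmx_suml -y0E.
  elim: (n.+1) => [|j IH]; first by rewrite big_ord0 addr0.
  by rewrite big_ord_recr /= addrA IH -(yE j).1 addrC subrK.
have := wE n.+1; rewrite -yS => -[_ /(_ n (leq_trans (leqnSn n) (kN n.+1)))].
rewrite map_residueM -vE -(map_comp_proj_of n K) -map_comp_projM => /rowP/(_ i).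
by rewrite [LHS]mxE [RHS]mxE.
Qed.

Hypothesis m_unit : forall a, a \notin m -> exists b, b * a = 1.

(** Artin-Rees with exponent 1, for M with the row w added, turns a solution modulo a high power of
    m into w - u' M = v M + c w with c in m, and 1 - c is a unit. *)
Lemma completion_faithful : faithful comp_of.
Proof.
move=> a b M w [u uM].
have [K hK] := artin_rees m A_noeth 1 (col_mx M w).
have [u' u'E] := row_approx u K.
have [||y [yE ypow]] := hK (w - u' *m M).
- move=> j; apply: (@ipow_le _ _ _ K.+1) => //; move: j; apply/map_residue_eq.
  by rewrite map_residueM -u'E // -!map_comp_proj_of -map_comp_projM uM.
- exists (row_mx (- u') 1%:M).
  by rewrite mul_row_col mulNmx mul1mx addrC.
have ym : rsubmx y 0 0 \in m by rewrite mxE; apply/ipow1/ypow.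
have [|c hc] := @m_unit (1 - rsubmx y 0 0).
  apply/negP => h; have : 1 \in m by rewrite -(subrK (rsubmx y 0 0) 1) rpredD.
  by rewrite idealr1.
exists (c *: (u' + lsubmx y)).
rewrite -scalemxAl mulmxDl -[w in RHS]scale1r -hc -scalerA; congr (_ *: _).
have {}yE : w - u' *m M = lsubmx y *m M + rsubmx y 0 0 *: w.
  by rewrite yE -{1}[y]hsubmxK mul_row_col {1}[rsubmx y]mx11_scalar
    mul_scalar_mx.
rewrite scalerBl scale1r.
have -> : lsubmx y *m M = w - u' *m M - rsubmx y 0 0 *: w by rewrite yE addrK.
by rewrite addrA (addrC (u' *m M)) subrK.
Qed.

End CompletionRing.

(** * Finitistic extension degree *)

Lemma local_ring_unit (A : comNzRingType) (m : idealr A) : noeth A ->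
  local_ring_with m -> forall a, a \notin m -> exists b, b * a = 1.
Proof.
move=> An [_ mloc] a am; apply: contrapT => na.
have [||I [[Ii [I1 Ia]] Imax]] := noeth_max An
  (P := fun I => ideal I /\ ~ I 1 /\ I a).
- by move=> I [].
- exists (idl [:: a]); split; first exact: idl_ideal.
  split=> [[b /eqP]|]; last exact/idl_mem/mem_head.
  by rewrite subr_eq0 => /eqP ba; apply: na; exists b.
pose J : {pred A} := fun x => `[< I x >].
have Jid : idealr_closed J.
  split=> [||b x y /asboolP Ix /asboolP Iy]; first by apply/asboolP; case: Ii.
    by apply/asboolP.
  by apply/asboolP; case: Ii => _; apply.
pose JI : idealr A := HB.pack J (isIdealr.Build A J Jid).
have /mloc Jm : maximal_ideal JI.
  move=> K JK x xK; apply/asboolP; move: x xK; apply: (Imax (fun x => x \in K)).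
    split; first exact: idealr_ideal.
    by split; [rewrite idealr1|apply: JK; apply/asboolP].
  by move=> x Ix; apply: JK; apply/asboolP.
by move/negP: am; apply; rewrite -Jm; apply/asboolP.
Qed.

Lemma finite_fed_pd_bound (R : comNzRingType) D :
  noeth R -> pd_bound R D -> finite_fed R.
Proof.
move=> Rn RD; apply/finite_fedP => //; exists D => F F0 i Di.
exact/splits_extv/RD.
Qed.

Lemma finite_fed_descent (A B : comNzRingType) (f : {rmorphism A -> B}) :
  noeth A -> noeth B -> flat f -> faithful f -> finite_fed B -> finite_fed A.
Proof.
move=> An Bn f_flat ff /(finite_fedP Bn)[D BD]; apply/(finite_fedP An).
by exists D; apply: selfext_bound_descent f_flat ff BD.
Qed.

Theorem theorem4p3 (A : comNzRingType) (m : idealr A)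
    (A_noetherian : noetherian A)
    (A_local : local_ring_with m)
    (A_gorenstein : gorenstein A) :
  [\/ finite_fed A,
      finite_fed (completion m),
      finite_fed (power_series A)
    | finite_fed (localization (mX_prime_ideal (proj1 A_local)))] ->
  [/\ finite_fed A,
      finite_fed (completion m),
      finite_fed (power_series A)
    & finite_fed (localization (mX_prime_ideal (proj1 A_local)))].
Proof.
move=> fed4.
have An := noeth_of_noetherian A_noetherian.
have m_unit := local_ring_unit An A_local.
have cn : noeth (completion m) := completion_noeth An.
have cf : flat (@comp_of A m) := completion_flat An.
have ln : noeth (localization (mX_prime_ideal (proj1 A_local))) :=
  localized_poly_noeth An.
have Afed : finite_fed A.
  case: fed4 => // h.
  - exact: finite_fed_descent An cn cf (completion_faithful An m_unit) h.
  - exact: finite_fed_descent An (power_series_noeth An) (power_series_flat An)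
             (@power_series_faithful A) h.
  exact: finite_fed_descent An ln (localized_poly_flat An m_unit)
           (localized_poly_faithful m_unit) h.
have [n Gn] := free_ext_bound_gorenstein A_gorenstein.
have [D AD] := (finite_fedP An).1 Afed.
have {AD} AD := pd_bound_of_selfext Gn AD.
have m_unit' a : ~ a \in m -> exists b, b * a = 1 by move=> /negP/m_unit.
have m1 : ~ 1 \in m by rewrite idealr1.
have [s [K [rs sm sK]]] := regular_parameters An (idealr_ideal m) m1 m_unit' Gn.
split=> //.
- apply: (finite_fed_pd_bound cn).
  apply: (pd_bound_completion An cn cf (completion_faithful An m_unit) rs _ _ Gn
    AD).
    by move=> x /sm; apply: comp_jac.
  exact: comp_dense sK.
- exact/(finite_fed_pd_bound (power_series_noeth An))/(power_series_pd_bound An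
    Gn AD).
exact/(finite_fed_pd_bound ln)/(localized_poly_pd_bound An m_unit Gn AD).
Qed.
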